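(* Let $W$ be a complex reflection group with reflection representation $\mathfrak{h}$ over $\mathbb{C}$, let $\mathbf{c}:\mathcal{S}\to\mathbb{C}$ be a $W$-invariant function on the set $\mathcal{S}$ of complex reflections of $W$, let $b\in\mathfrak{h}$ with stabilizer $W_b$ in $W$, and let $\mathbf{c}'$ be the restriction of $\mathbf{c}$ to the set of reflections in $W_b$. Let $\pi_W:X_{\mathbf{c}}(W)\to\mathfrak{h}/W$ and $\pi_{W_b}:X_{\mathbf{c}'}(W_b)\to\mathfrak{h}/W_b$ be the canonical morphisms from the generalized Calogero-Moser spaces. Then there is an isomorphism of (not necessarily reduced) schemes between the scheme-theoretic fibres $$\Phi:\pi_W^{-1}(b)\xrightarrow{\ \sim\ }\pi_{W_b}^{-1}(0).$$
   Context: $W$ is a complex reflection group: a finite group with a faithful representation $\mathfrak{h}$ (its reflection representation) of dimension $n$ over $\mathbb{C}$, generated by the set $\mathcal{S}$ of elements acting as complex reflections on $\mathfrak{h}$. Let $(y,x)=x(y)$ for $y\in\mathfrak{h}$, $x\in\mathfrak{h}^*$. For $s\in\mathcal{S}$ fix a basis $\alpha_s$ of the line $\mathrm{Im}(s-1)|_{\mathfrak{h}^*}$ and a basis $\alpha_s^\vee$ of the line $\mathrm{Im}(s-1)|_{\mathfrak{h}}$ with $\alpha_s(\alpha_s^\vee)=2$. The rational Cherednik algebra $H_{0,\mathbf{c}}(W)=H_{0,\mathbf{c}}(W,\mathfrak{h})$ at $t=0$ is the quotient of $T(\mathfrak{h}\oplus\mathfrak{h}^* )\rtimes W$ by the relations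 $[x_1,x_2]=0$, $[y_1,y_2]=0$, $[x_1,y_1]=-\sum_{s\in\mathcal{S}}\mathbf{c}(s)(y_1,\alpha_s)(\alpha_s^\vee,x_1)s$ for all $x_1,x_2\in\mathfrak{h}^*$, $y_1,y_2\in\mathfrak{h}$. The stabilizer $W_b$ is again a complex reflection group acting on $\mathfrak{h}$ (Steinberg); its set of reflections is $\mathcal{S}\cap W_b$, and $H_{0,\mathbf{c}'}(W_b,\mathfrak{h})$ is defined in the same way using the whole space $\mathfrak{h}$. $Z_{0,\mathbf{c}}(W)$ is the centre of $H_{0,\mathbf{c}}(W,\mathfrak{h})$ and the generalized Calogero-Moser space $X_{\mathbf{c}}(W)$ is the affine variety with coordinate ring $Z_{0,\mathbf{c}}(W)$. It is known that $\mathbb{C}[\mathfrak{h}]^W\subset Z_{0,\mathbf{c}}(W)$, and this inclusion defines a surjective morphism $\pi_W:X_{\mathbf{c}}(W)\to\mathfrak{h}/W$. Similarly $X_{\mathbf{c}'}(W_b)$ and $\pi_{W_b}:X_{\mathbf{c}'}(W_b)\to\mathfrak{h}/W_b$ are defined from $H_{0,\mathbf{c}'}(W_b,\mathfrak{h})$. Let $\mathfrak{m}(b)\subset\mathbb{C}[\mathfrak{h}]^W$ be the maximal ideal of the orbit $W\cdot b$ and $\mathfrak{n}(0)\subset\mathbb{C}[\mathfrak{h}]^{W_b}$ the maximal ideal of $W_b\cdot 0$. Then $\pi_W^{-1}(b)$ denotes the affine scheme with coordinate ring $Z_{0,\mathbf{c}}(W)/\mathfrak{m}(b)Z_{0,\mathbf{c}}(W)$,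 and $\pi_{W_b}^{-1}(0)$ the affine scheme with coordinate ring $Z_{0,\mathbf{c}'}(W_b)/\mathfrak{n}(0)Z_{0,\mathbf{c}'}(W_b)$. *)

(* Defs.v *)
From HB Require Import structures.
From mathcomp Require Import all_boot all_order all_fingroup all_algebra all_character.
From mathcomp Require Import finmap complex monalg.
From mathcomp Require Import boolp classical_sets reals topology_structure.
From mathcomp Require Import generic_quotient ring_quotient.
From mathcomp Require mpoly.

From mathcomp Require Import ring.

Set Implicit Arguments.
Unset Strict Implicit.
Unset Printing Implicit Defensive.

Import Order.TTheory GRing.Theory Num.Theory.
Import Quotient.

Local Open Scope ring_scope.
Local Open Scope quotient_scope.
Local Open Scope classical_set_scope.

(* Rings are taken in the pz (possibly zero) part of the hierarchy: 1 != 0 is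
   not available a priori for a ring given by generators and relations. *)

Section RingQuotient.
Variables (R : pzRingType) (r : set R).

Definition two_sided_ideal (I : set R) : Prop :=
  [/\ I 0, forall x y, I x -> I y -> I (x - y)
    & forall a x b, I x -> I (a * x * b)].

Definition ideal_gen : set R := smallest two_sided_ideal r.

Lemma ideal_genP : two_sided_ideal ideal_gen.
Proof.
split=> [I [[]]//|x y Ix Iy I HI|a x b Ix I HI].
  by case: (HI) => -[_ IB _] _; apply: IB; [exact: Ix | exact: Iy].
by case: (HI) => -[_ _ IM] _; apply: IM; exact: Ix.
Qed.

(* rquot is the quotient of R by the two-sided ideal generated by r. *)
Definition ideal_pred : {pred R} := fun x => `[< ideal_gen x >].

Lemma ideal_pred_zmod_closed : zmod_closed ideal_pred.
Proof.
have [I0 IB _] := ideal_genP.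
by split=> [|x y /asboolP Ix /asboolP Iy]; apply/asboolP; [|exact: IB].
Qed.

HB.instance Definition _ :=
  GRing.isZmodClosed.Build R ideal_pred ideal_pred_zmod_closed.

Definition rquot : Type := {quot ideal_pred}.

HB.instance Definition _ := GRing.Zmodule.on rquot.

Definition rpi (x : R) : rquot := \pi_{quot ideal_pred} x.

Lemma rpiE x y : rpi x = rpi y <-> ideal_gen (x - y).
Proof.
split=> [/eqP|Ixy]; first by rewrite -idealrBE => /asboolP.
by apply/eqP; rewrite -idealrBE; apply/asboolP.
Qed.

Lemma rpi_surj (u : rquot) : exists x, u = rpi x.
Proof. by exists (repr u); rewrite /rpi reprK. Qed.

Lemma rpi_is_zmod_morphism : zmod_morphism rpi.
Proof. by move=> x y; rewrite /rpi !piE. Qed.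

HB.instance Definition _ :=
  GRing.isZmodMorphism.Build R rquot rpi rpi_is_zmod_morphism.

Definition rquot_one : rquot := rpi 1.
Definition rquot_mul (u v : rquot) : rquot :=
  rpi (repr (u : {quot ideal_pred}) * repr (v : {quot ideal_pred})).

Lemma rpiM_subproof x y : rquot_mul (rpi x) (rpi y) = rpi (x * y).
Proof.
have [_ IB IM] := ideal_genP.
have reprI z : ideal_gen (repr (rpi z : {quot ideal_pred}) - z).
  by apply/rpiE; rewrite /rpi reprK.
apply/rpiE; set x' := repr _; set y' := repr _.
have -> : x' * y' - x * y = (x' - x) * y' - x * (y - y').
  by rewrite mulrBl mulrBr opprB addrA subrK.
apply: IB; first by have := IM 1 _ y' (reprI x); rewrite mul1r.
by have := IM (- x) _ 1 (reprI y); rewrite mulr1 mulNr -mulrN opprB.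
Qed.

Lemma rquot_mulA : associative rquot_mul.
Proof.
move=> u v w; have [x ->] := rpi_surj u; have [y ->] := rpi_surj v.
by have [z ->] := rpi_surj w; rewrite !rpiM_subproof mulrA.
Qed.

Lemma rquot_mul1 : left_id rquot_one rquot_mul.
Proof. by move=> u; have [x ->] := rpi_surj u; rewrite rpiM_subproof mul1r. Qed.

Lemma rquot_1mul : right_id rquot_one rquot_mul.
Proof. by move=> u; have [x ->] := rpi_surj u; rewrite rpiM_subproof mulr1. Qed.

Lemma rquot_mulDl : left_distributive rquot_mul +%R.
Proof.
move=> u v w; have [x ->] := rpi_surj u; have [y ->] := rpi_surj v.
have [z ->] := rpi_surj w.
by rewrite -raddfD !rpiM_subproof mulrDl raddfD.
Qed.

Lemma rquot_mulDr : right_distributive rquot_mul +%R.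
Proof.
move=> u v w; have [x ->] := rpi_surj u; have [y ->] := rpi_surj v.
have [z ->] := rpi_surj w.
by rewrite -raddfD !rpiM_subproof mulrDr raddfD.
Qed.

HB.instance Definition _ := GRing.Zmodule_isPzRing.Build rquot
  rquot_mulA rquot_mul1 rquot_1mul rquot_mulDl rquot_mulDr.

Lemma rpi_is_monoid_morphism : monoid_morphism rpi.
Proof. by split=> // x y; rewrite -rpiM_subproof. Qed.

HB.instance Definition _ :=
  GRing.isMonoidMorphism.Build R rquot rpi rpi_is_monoid_morphism.

End RingQuotient.

Lemma rquot_mulC (R : comPzRingType) (r : set R) :
  commutative (@GRing.mul (rquot r)).
Proof.
move=> u v; have [x ->] := rpi_surj u; have [y ->] := rpi_surj v.
by rewrite -!rmorphM mulrC.
Qed.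

HB.instance Definition _ (R : comPzRingType) (r : set R) :=
  GRing.PzRing_hasCommutativeMul.Build (rquot r) (@rquot_mulC R r).

Section Center.
Variable R : pzRingType.

Definition central : {pred R} := fun z => `[< forall a, z * a = a * z >].

Lemma central_subring_closed : subring_closed central.
Proof.
split=> [|x y /asboolP Zx /asboolP Zy|x y /asboolP Zx /asboolP Zy].
- by apply/asboolP => a; rewrite mul1r mulr1.
- by apply/asboolP => a; rewrite mulrBl mulrBr Zx Zy.
- by apply/asboolP => a; rewrite -mulrA Zy mulrA Zx mulrA.
Qed.

Record center : predArgType :=
  Center { center_val :> R; _ : center_val \in central }.

HB.instance Definition _ := [isSub for center_val].
HB.instance Definition _ := [Choice of center by <:].
HB.instance Definition _ :=
  GRing.SubChoice_isSubPzRing.Build R central center central_subring_closed.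

Lemma center_mulC : commutative (@GRing.mul center).
Proof.
move=> x y; apply: val_inj; rewrite !rmorphM /=.
by case: x => x /= /asboolP ->.
Qed.

HB.instance Definition _ :=
  GRing.PzRing_hasCommutativeMul.Build center center_mulC.

End Center.

Section Spec.
Variable A : comPzRingType.

Definition prime_ideal (I : set A) : Prop :=
  [/\ two_sided_ideal I, ~ I 1 & forall x y, I (x * y) -> I x \/ I y].

Record Spec : Type := SpecPoint {
  point_ideal :> A -> Prop;
  point_idealP : prime_ideal point_ideal
}.

HB.instance Definition _ := gen_eqMixin Spec.
HB.instance Definition _ := gen_choiceMixin Spec.

Definition zariski_open : set_system Spec :=
  [set U | exists E : set A, U = [set p : Spec | exists2 f, E f & ~ p f]].

Lemma zariski_openT : zariski_open setT.
Proof.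
exists setT; apply/seteqP; split=> // p _; exists 1 => //.
by have [_ ? _] := point_idealP p.
Qed.

Lemma zariski_openI : setI_closed zariski_open.
Proof.
move=> _ _ [E ->] [F ->]; exists [set x | exists2 f, E f & exists2 g, F g & x = f * g].
apply/seteqP; split=> p /=.
  move=> [[f Ef pf] [g Fg pg]]; exists (f * g); first by exists f => //; exists g.
  by have [_ _ pM] := point_idealP p; case/pM.
have [[_ _ IM] _ _] := point_idealP p.
move=> [_ [f Ef [g Fg ->]] pfg]; split; [exists f|exists g] => // px; apply: pfg.
  by have := IM 1 _ g px; rewrite mul1r.
by have := IM f _ 1 px; rewrite mulr1.
Qed.

Lemma zariski_open_bigU (I : Type) (U : I -> set Spec) :
  (forall i, zariski_open (U i)) -> zariski_open (\bigcup_i U i).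
Proof.
move=> oU; exists [set f | exists i, forall p : Spec, ~ p f -> U i p].
apply/seteqP; split=> p /=; last by move=> [f [i fU] pf]; exists i => //; exact: fU.
move=> [i _]; have [E UE] := oU i; rewrite UE => -[f Ef pf]; exists f => //.
by exists i => q qf; rewrite UE; exists f.
Qed.

HB.instance Definition _ := isOpenTopological.Build Spec
  zariski_openT zariski_openI zariski_open_bigU.

End Spec.


(* localization p is the local ring A_p; fractions are a / s with s not in p. *)

Section Localization.
Variables (A : comPzRingType) (p : Spec A).

Record denominator : predArgType :=
  Denominator { denominator_val :> A; _ : `[< ~ p denominator_val >] }.

HB.instance Definition _ := [isSub for denominator_val].
HB.instance Definition _ := [Choice of denominator by <:].

Lemma denominatorP (s : denominator) : ~ p (val s).
Proof. by case: s => s /= /asboolP. Qed.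

Lemma prime_idealMN x y : ~ p x -> ~ p y -> ~ p (x * y).
Proof. by have [_ _ pM] := point_idealP p; move=> px py /pM[]. Qed.

Lemma denominator1_subproof : `[< ~ p 1 >].
Proof. by apply/asboolP; have [] := point_idealP p. Qed.
Definition denominator1 := Denominator denominator1_subproof.

Lemma denominatorM_subproof (s t : denominator) : `[< ~ p (val s * val t) >].
Proof. by apply/asboolP/prime_idealMN; exact: denominatorP. Qed.
Definition denominatorM s t := Denominator (denominatorM_subproof s t).

Definition frac_eq : rel (A * denominator) := fun x y =>
  `[< exists2 u, ~ p u & u * (x.1 * val y.2 - y.1 * val x.2) = 0 >].

Lemma frac_eq_equiv : equiv_class_of frac_eq.
Proof.
have sym x y : frac_eq x y -> frac_eq y x.
  move=> /asboolP[u pu uxy]; apply/asboolP; exists u => //.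
  by rewrite -opprB mulrN uxy oppr0.
split=> [x|x y|y x z].
- apply/asboolP; exists 1; last by rewrite subrr mulr0.
  by have [] := point_idealP p.
- by apply/idP/idP => /sym.
- move=> /asboolP[u pu uxy] /asboolP[v pv vyz]; apply/asboolP.
  exists (u * v * val y.2).
    by apply: prime_idealMN; [exact: prime_idealMN | exact: denominatorP].
  have -> : u * v * val y.2 * (x.1 * val z.2 - z.1 * val x.2) =
      v * val z.2 * (u * (x.1 * val y.2 - y.1 * val x.2)) +
      u * val x.2 * (v * (y.1 * val z.2 - z.1 * val y.2)) by ring.
  by rewrite uxy vyz !mulr0 addr0.
Qed.

Canonical frac_eq_equivRel := EquivRelPack frac_eq_equiv.
Canonical frac_eq_encModRel := defaultEncModRel frac_eq.

Definition localization : Type := {eq_quot frac_eq}.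

HB.instance Definition _ := Choice.on localization.

Definition frac (a : A) (s : denominator) : localization :=
  \pi_{eq_quot frac_eq} (a, s).

Lemma fracE a s b t : frac a s = frac b t <->
  exists2 u, ~ p u & u * (a * val t - b * val s) = 0.
Proof.
split=> [/eqP|H]; first by rewrite eqmodE => /asboolP.
by apply/eqP; rewrite eqmodE; apply/asboolP.
Qed.

Lemma frac_surj (x : localization) : exists a s, x = frac a s.
Proof.
exists (repr (x : {eq_quot frac_eq})).1, (repr (x : {eq_quot frac_eq})).2.
by rewrite /frac -surjective_pairing reprK.
Qed.

Let num (x : localization) : A := (repr (x : {eq_quot frac_eq})).1.
Let den (x : localization) : denominator := (repr (x : {eq_quot frac_eq})).2.

Let frac_num_den a s :
  exists2 u, ~ p u & u * (num (frac a s) * val s - a * val (den (frac a s))) = 0.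
Proof. by apply/fracE; rewrite /frac -surjective_pairing reprK. Qed.

Definition loc_add (x y : localization) : localization :=
  frac (num x * val (den y) + num y * val (den x)) (denominatorM (den x) (den y)).
Definition loc_opp (x : localization) : localization := frac (- num x) (den x).
Definition loc_mul (x y : localization) : localization :=
  frac (num x * num y) (denominatorM (den x) (den y)).

Lemma loc_addE a s b t : loc_add (frac a s) (frac b t) =
  frac (a * val t + b * val s) (denominatorM s t).
Proof.
have [u pu ua] := frac_num_den a s; have [v pv vb] := frac_num_den b t.
apply/fracE; exists (u * v) => /=; first exact: prime_idealMN.
set a' := num _ in ua *; set s' := val (den _) in ua *.
set b' := num _ in vb *; set t' := val (den _) in vb *.
have -> : u * v * ((a' * t' + b' * s') * (val s * val t)
      - (a * val t + b * val s) * (s' * t')) =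
    v * t' * val t * (u * (a' * val s - a * s')) +
    u * s' * val s * (v * (b' * val t - b * t')) by ring.
by rewrite ua vb !mulr0 addr0.
Qed.

Lemma loc_oppE a s : loc_opp (frac a s) = frac (- a) s.
Proof.
have [u pu ua] := frac_num_den a s; apply/fracE; exists u => //=.
by rewrite !mulNr -opprD mulrN ua oppr0.
Qed.

Lemma loc_mulE a s b t :
  loc_mul (frac a s) (frac b t) = frac (a * b) (denominatorM s t).
Proof.
have [u pu ua] := frac_num_den a s; have [v pv vb] := frac_num_den b t.
apply/fracE; exists (u * v) => /=; first exact: prime_idealMN.
set a' := num _ in ua *; set s' := val (den _) in ua *.
set b' := num _ in vb *; set t' := val (den _) in vb *.
have -> : u * v * (a' * b' * (val s * val t) - a * b * (s' * t')) =
    v * val t * b' * (u * (a' * val s - a * s')) +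
    u * a * s' * (v * (b' * val t - b * t')) by ring.
by rewrite ua vb !mulr0 addr0.
Qed.

Let fracW a s b t : a * val t = b * val s -> frac a s = frac b t.
Proof.
move=> eq_ab; apply/fracE; exists 1; last by rewrite eq_ab subrr mulr0.
by have [] := point_idealP p.
Qed.

Lemma loc_addA : associative loc_add.
Proof.
move=> x y z; have [a [s ->]] := frac_surj x; have [b [t ->]] := frac_surj y.
have [d [r ->]] := frac_surj z.
by rewrite !loc_addE; apply: fracW => /=; ring.
Qed.

Lemma loc_addC : commutative loc_add.
Proof.
move=> x y; have [a [s ->]] := frac_surj x; have [b [t ->]] := frac_surj y.
by rewrite !loc_addE; apply: fracW => /=; ring.
Qed.

Lemma loc_add0 : left_id (frac 0 denominator1) loc_add.
Proof.
move=> x; have [a [s ->]] := frac_surj x.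
by rewrite loc_addE; apply: fracW => /=; ring.
Qed.

Lemma loc_addN : left_inverse (frac 0 denominator1) loc_opp loc_add.
Proof.
move=> x; have [a [s ->]] := frac_surj x.
by rewrite loc_oppE loc_addE; apply: fracW => /=; ring.
Qed.

Lemma loc_mulA : associative loc_mul.
Proof.
move=> x y z; have [a [s ->]] := frac_surj x; have [b [t ->]] := frac_surj y.
have [d [r ->]] := frac_surj z.
by rewrite !loc_mulE; apply: fracW => /=; ring.
Qed.

Lemma loc_mulC : commutative loc_mul.
Proof.
move=> x y; have [a [s ->]] := frac_surj x; have [b [t ->]] := frac_surj y.
by rewrite !loc_mulE; apply: fracW => /=; ring.
Qed.

Lemma loc_mul1 : left_id (frac 1 denominator1) loc_mul.
Proof.
move=> x; have [a [s ->]] := frac_surj x.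
by rewrite loc_mulE; apply: fracW => /=; ring.
Qed.

Lemma loc_mulD : left_distributive loc_mul loc_add.
Proof.
move=> x y z; have [a [s ->]] := frac_surj x; have [b [t ->]] := frac_surj y.
have [d [r ->]] := frac_surj z.
by rewrite !(loc_addE, loc_mulE); apply: fracW => /=; ring.
Qed.

HB.instance Definition _ :=
  GRing.isZmodule.Build localization loc_addA loc_addC loc_add0 loc_addN.
HB.instance Definition _ := GRing.Zmodule_isComPzRing.Build localization
  loc_mulA loc_mulC loc_mul1 loc_mulD.

End Localization.

Section StructureSheaf.
Variable A : comPzRingType.

Section StalkFamily.
Variable U : set (Spec A).

(* The sections of the structure sheaf over U are the families of elements of
   the A_p, p in U, that are locally given by a single fraction a / s. *)
Definition stalk_family : Type := forall p : Spec A, U p -> localization p.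

HB.instance Definition _ := gen_eqMixin stalk_family.
HB.instance Definition _ := gen_choiceMixin stalk_family.

Let sf_ext (f g : stalk_family) : (forall p Up, f p Up = g p Up) -> f = g.
Proof.
by move=> fg; apply: functional_extensionality_dep => p;
  apply: functional_extensionality_dep => Up.
Qed.

Let sf0 : stalk_family := fun _ _ => 0.
Let sf1 : stalk_family := fun _ _ => 1.
Let sf_opp (f : stalk_family) : stalk_family := fun p Up => - f p Up.
Let sf_add (f g : stalk_family) : stalk_family := fun p Up => f p Up + g p Up.
Let sf_mul (f g : stalk_family) : stalk_family := fun p Up => f p Up * g p Up.

Let sf_addA : associative sf_add.
Proof. by move=> f g h; apply: sf_ext => p Up; rewrite /sf_add addrA. Qed.
Let sf_addC : commutative sf_add.
Proof. by move=> f g; apply: sf_ext => p Up; rewrite /sf_add addrC. Qed.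
Let sf_add0 : left_id sf0 sf_add.
Proof. by move=> f; apply: sf_ext => p Up; rewrite /sf_add add0r. Qed.
Let sf_addN : left_inverse sf0 sf_opp sf_add.
Proof. by move=> f; apply: sf_ext => p Up; rewrite /sf_add addNr. Qed.
Let sf_mulA : associative sf_mul.
Proof. by move=> f g h; apply: sf_ext => p Up; rewrite /sf_mul mulrA. Qed.
Let sf_mulC : commutative sf_mul.
Proof. by move=> f g; apply: sf_ext => p Up; rewrite /sf_mul mulrC. Qed.
Let sf_mul1 : left_id sf1 sf_mul.
Proof. by move=> f; apply: sf_ext => p Up; rewrite /sf_mul mul1r. Qed.
Let sf_mulD : left_distributive sf_mul sf_add.
Proof. by move=> f g h; apply: sf_ext => p Up; rewrite /sf_mul mulrDl. Qed.

HB.instance Definition _ :=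
  GRing.isZmodule.Build stalk_family sf_addA sf_addC sf_add0 sf_addN.
HB.instance Definition _ := GRing.Zmodule_isComPzRing.Build stalk_family
  sf_mulA sf_mulC sf_mul1 sf_mulD.

Definition locally_fraction : {pred stalk_family} := fun f =>
  `[< forall p, U p -> exists V : set (Spec A),
        [/\ open V, V p & exists a s,
          forall q (Uq : U q), V q -> exists s' : denominator q,
            val s' = s /\ f q Uq = frac a s'] >].


Let locally_fraction_op (op : stalk_family -> stalk_family -> stalk_family)
    (nop : A -> A -> A -> A -> A) :
  (forall (f g : stalk_family) p Up a (s : denominator p) b (t : denominator p),
     f p Up = frac a s -> g p Up = frac b t ->
     op f g p Up = frac (nop a (val s) b (val t)) (denominatorM s t)) ->
  forall f g, f \in locally_fraction -> g \in locally_fraction ->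
    op f g \in locally_fraction.
Proof.
move=> opE f g /asboolP lf /asboolP lg; apply/asboolP => p Up.
have [V [oV Vp [a [s fV]]]] := lf p Up; have [V' [oV' Vp' [b [t gV]]]] := lg p Up.
exists (V `&` V'); split; [exact: openI | by [] |].
exists (nop a s b t), (s * t) => q Uq [Vq Vq'].
have [s' [<- fq]] := fV q Uq Vq; have [t' [<- gq]] := gV q Uq Vq'.
by exists (denominatorM s' t'); split=> //; exact: opE.
Qed.

Lemma locally_fraction_subring_closed : subring_closed locally_fraction.
Proof.
split.
- apply/asboolP => p Up; exists setT; split=> //; first exact: openT.
  by exists 1, 1 => q Uq _; exists (denominator1 q).
- apply: (locally_fraction_op (nop := fun a s b t => a * t + - b * s)).
  move=> f g p Up a s b t fE gE.
  have -> : (f - g) p Up = f p Up - g p Up by [].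
  by rewrite fE gE -loc_addE -loc_oppE.
- apply: (locally_fraction_op (nop := fun a s b t => a * b)).
  move=> f g p Up a s b t fE gE.
  have -> : (f * g) p Up = f p Up * g p Up by [].
  by rewrite fE gE -loc_mulE.
Qed.

Record sections : predArgType := SheafSection {
  section_val :> stalk_family;
  section_valP : section_val \in locally_fraction
}.

HB.instance Definition _ := [isSub for section_val].
HB.instance Definition _ := [Choice of sections by <:].
HB.instance Definition _ := GRing.SubChoice_isSubComPzRing.Build stalk_family
  locally_fraction sections locally_fraction_subring_closed.

Lemma constant_section_subproof (a : A) :
  (fun p (_ : U p) => frac a (denominator1 p)) \in locally_fraction.
Proof.
apply/asboolP => p Up; exists setT; split=> //; first exact: openT.
by exists a, 1 => q Uq _; exists (denominator1 q).
Qed.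

Definition constant_section (a : A) : sections :=
  SheafSection (constant_section_subproof a).

End StalkFamily.

Lemma restriction_subproof (U V : set (Spec A)) (VU : V `<=` U) (f : sections U) :
  (fun p (Vp : V p) => section_val f (VU p Vp)) \in @locally_fraction V.
Proof.
apply/asboolP => p Vp; have /asboolP/(_ p (VU p Vp)) := section_valP f.
move=> [V' [oV' V'p [a [s fV']]]]; exists V'; split=> //.
by exists a, s => q Vq V'q; apply: fV'.
Qed.

Definition restriction (U V : set (Spec A)) (VU : V `<=` U) (f : sections U) :
  sections V := SheafSection (restriction_subproof VU f).

End StructureSheaf.

(* An isomorphism (Spec A, O_A) -> (Spec B, O_B) of schemes over Spec k, the
   structure morphisms being given by the ring morphisms iA and iB.  Since the
   morphism is invertible, the maps induced on stalks are automatically local. *)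
Record affine_scheme_iso (k A B : comPzRingType)
    (iA : {rmorphism k -> A}) (iB : {rmorphism k -> B}) : Type := {
  iso_map : Spec A -> Spec B;
  iso_inv : Spec B -> Spec A;
  iso_mapK : cancel iso_map iso_inv;
  iso_invK : cancel iso_inv iso_map;
  iso_map_continuous : continuous iso_map;
  iso_inv_continuous : continuous iso_inv;
  iso_comap : forall V : set (Spec B), open V ->
    {rmorphism sections V -> sections (iso_map @^-1` V)};
  iso_comap_bij : forall V (oV : open V), bijective (iso_comap oV);
  iso_comap_restriction : forall (U V : set (Spec B)) (oU : open U) (oV : open V)
    (VU : V `<=` U) (f : sections U),
    iso_comap oV (restriction VU f) =
    restriction (fun p (Vp : V (iso_map p)) => VU _ Vp) (iso_comap oU f);
  iso_comap_const : forall V (oV : open V) (a : k),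
    iso_comap oV (constant_section V (iB a)) = constant_section _ (iA a)
}.

Section ReflectionGroup.
Variables (R : realType) (gT : finGroupType) (W : {group gT}) (n : nat).
Variable h : mx_representation R[i] W n.

(* The reflection representation is C^n, viewed as column vectors on which w
   acts by y |-> h w *m y; its dual is the space of row vectors, on which w acts
   by x |-> x *m h w^-1. *)

Definition reflections : {set gT} := [set s in W | \rank (h s - 1%:M) == 1%N].

Definition complex_reflection_group : Prop :=
  mx_faithful h /\ generated reflections = W :> {set gT}.

Definition stabilizer (b : 'cV[R[i]]_n) : {set gT} := [set w in W | h w *m b == b].

Lemma stabilizer_group_set b : group_set (stabilizer b).
Proof.
apply/group_setP; split=> [|w w']; first by rewrite inE group1 repr_mx1 mul1mx eqxx.
rewrite !inE => /andP[Ww /eqP wb] /andP[Ww' /eqP wb'].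
by rewrite groupM //= repr_mxM // -mulmxA wb' wb.
Qed.

Canonical stabilizer_group b := Group (stabilizer_group_set b).

Lemma stabilizer_sub b : stabilizer b \subset W.
Proof. by apply/fintype.subsetP => w; rewrite inE => /andP[]. Qed.

Definition pairing (y : 'cV[R[i]]_n) (x : 'rV[R[i]]_n) : R[i] := (x *m y) 0 0.

(* The image of s - 1 on row vectors is the row space of h s^-1 - 1, and its
   image on column vectors is the column space of h s - 1. *)
Definition roots_of_reflections (alpha : gT -> 'rV[R[i]]_n) (alphav : gT -> 'cV[R[i]]_n) :=
  forall s, s \in reflections ->
    [/\ (alpha s == h s^-1%g - 1%:M)%MS,
        ((alphav s)^T == (h s - 1%:M)^T)%MS
      & pairing (alphav s) (alpha s) = 2].

End ReflectionGroup.

Section CherednikAlgebra.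
Variables (R : realType) (gT : finGroupType) (W : {group gT}) (n : nat).
Variable h : mx_representation R[i] W n.
(* Only the values of c, alpha and alphav on reflections h are used. *)
Variables (c : gT -> R[i]) (alpha : gT -> 'rV[R[i]]_n) (alphav : gT -> 'cV[R[i]]_n).

Definition rca_gens : Type := ('cV[R[i]]_n + 'rV[R[i]]_n + [subg W])%type.
HB.instance Definition _ := Choice.on rca_gens.

Definition rca_free : Type := {malg R[i][{fmonom rca_gens}]}.
HB.instance Definition _ := GRing.Lalgebra.on rca_free.

Definition rca_y (y : 'cV[R[i]]_n) : rca_free := << fmu (inl (inl y) : rca_gens) >>.
Definition rca_x (x : 'rV[R[i]]_n) : rca_free := << fmu (inl (inr x) : rca_gens) >>.
Definition rca_w (w : [subg W]) : rca_free := << fmu (inr w : rca_gens) >>.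

(* The crossed product of W with the tensor algebra of the direct sum of h and
   its dual is the quotient of the free algebra rca_free by these relations. *)
Inductive rca_smash : set rca_free :=
| smash_y_linear a y y' : rca_smash (rca_y (a *: y + y') - (a *: rca_y y + rca_y y'))
| smash_x_linear a x x' : rca_smash (rca_x (a *: x + x') - (a *: rca_x x + rca_x x'))
| smash_w1 : rca_smash (rca_w 1%g - 1)
| smash_wM w w' : rca_smash (rca_w (w * w')%g - rca_w w * rca_w w')
| smash_wy w y :
    rca_smash (rca_w w * rca_y y - rca_y (h (sgval w) *m y) * rca_w w)
| smash_wx w x :
    rca_smash (rca_w w * rca_x x - rca_x (x *m h (sgval w)^-1%g) * rca_w w).

Inductive rca_commutation : set rca_free :=
| comm_xx x x' : rca_commutation (rca_x x * rca_x x' - rca_x x' * rca_x x)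
| comm_yy y y' : rca_commutation (rca_y y * rca_y y' - rca_y y' * rca_y y)
| comm_xy x y : rca_commutation (rca_x x * rca_y y - rca_y y * rca_x x
    - (- \sum_(s in reflections h)
          (c s * pairing y (alpha s) * pairing (alphav s) x) *: rca_w (subg W s))).

Definition rca : Type := rquot (rca_smash `|` rca_commutation).
HB.instance Definition _ := GRing.PzRing.on rca.

Definition rca_pi : {rmorphism rca_free -> rca} :=
  rpi (rca_smash `|` rca_commutation).

Definition rca_scalar : {rmorphism R[i] -> rca} := rca_pi \o @malgC _ R[i].

Lemma rca_free_scalarC a (f : rca_free) : malgC a * f = f * malgC a.
Proof.
rewrite (malgM_def f) fgmulgU [LHS]malgM_def fgmulUg.
by apply: eq_bigr => k _; rewrite mul1m mulm1 mulrC.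
Qed.

Lemma rca_scalar_central a : rca_scalar a \in @central rca.
Proof.
apply/asboolP => u; have [f ->] := rpi_surj u.
refine (etrans (esym (rmorphM rca_pi (malgC a) f)) _).
refine (etrans (congr1 rca_pi (rca_free_scalarC a f)) _).
exact (rmorphM rca_pi f (malgC a)).
Qed.

Definition rca_center_scalar a : center rca := Center (rca_scalar_central a).

Lemma rca_center_scalar_is_zmod_morphism : zmod_morphism rca_center_scalar.
Proof. by move=> x y; apply: val_inj; exact: (rmorphB rca_scalar). Qed.

Lemma rca_center_scalar_is_monoid_morphism : monoid_morphism rca_center_scalar.
Proof.
by split=> [|x y]; apply: val_inj; [exact: (rmorph1 rca_scalar)
                                   | exact: (rmorphM rca_scalar)].
Qed.

HB.instance Definition _ := GRing.isZmodMorphism.Build R[i] (center rca)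
  rca_center_scalar rca_center_scalar_is_zmod_morphism.
HB.instance Definition _ := GRing.isMonoidMorphism.Build R[i] (center rca)
  rca_center_scalar rca_center_scalar_is_monoid_morphism.

(* C[h] is the ring of polynomials in the coordinate forms delta_mx 0 i, seen
   (the field being infinite) as functions on h. *)
Definition polyfun (p : mpoly.mpoly n R[i]) (v : 'cV[R[i]]_n) : R[i] :=
  mpoly.meval (fun i => v i 0) p.

Definition invariant_poly : set (mpoly.mpoly n R[i]) :=
  [set p | forall w v, w \in W -> polyfun p (h w *m v) = polyfun p v].

Definition orbit_ideal (b : 'cV[R[i]]_n) : set (mpoly.mpoly n R[i]) :=
  [set p | invariant_poly p /\ forall w, w \in W -> polyfun p (h w *m b) = 0].

Definition rca_poly (p : mpoly.mpoly n R[i]) : rca :=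
  rca_pi (mpoly.mmap (fun a => malgC a : rca_free) (fun i => rca_x (delta_mx 0 i)) p).

(* Generators of the ideal m(b)Z of the centre Z: as C[h]^W lies in Z, the image
   of every element of orbit_ideal b occurs among them. *)
Definition fibre_relations (b : 'cV[R[i]]_n) : set (center rca) :=
  [set z | exists2 p, orbit_ideal b p & val z = rca_poly p].

Definition fibre_ring (b : 'cV[R[i]]_n) : Type := rquot (fibre_relations b).
HB.instance Definition _ b := GRing.ComPzRing.on (fibre_ring b).

Definition fibre_scalar (b : 'cV[R[i]]_n) : {rmorphism R[i] -> fibre_ring b} :=
  rpi (fibre_relations b) \o rca_center_scalar.

End CherednikAlgebra.

(* Main.v *)
(* At t = 0 the Dunkl embedding realizes H(W) inside the crossed product of W
   with functions on h_reg x h^*, where h_reg is the locus of trivial stabilizers;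
   it is injective because H(W) is spanned by words x..x y..y w whose leading
   terms are independent.  The algebra H(W_b), with its x's translated by b, is
   realized in the same crossed product.  An element of H(W) is central exactly
   when it is a W-invariant function, and likewise for W_b.

   Let Q(W) and Q(W_b) be the rings of functions contained in the two images.
   Both Dunkl operators attached to y differ by a sum over reflections s not
   fixing b.  Multiplying by a polynomial that cancels the poles of these terms
   shows that Q(W_b) lies in a localization of Q(W).  Conversely, multiplying the
   coefficient at w by a polynomial in (v, w^-1 v) that vanishes unless w fixes b
   brings H(W) into H(W_b).  Hence Q(W) and Q(W_b) agree after inverting some
   W_b-invariant polynomial phi with phi(b) <> 0.

   It remains to descend from h/W_b to h/W at b, which is elementary: if v is a
   W_b-invariant polynomial with v(b) <> 0 that vanishes on the rest of the orbit
   of b, then V = v^|W| satisfies V . wV in m(b) C[h] for w outside W_b (the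
   characteristic polynomial of v . wv has its lower coefficients in m(b)), and
   traces over W of V-multiples give both the surjectivity of
   Z(W) -> Z(W_b)/n(0) Z(W_b) and the determination of its kernel. *)

From HB Require Import structures.
From mathcomp Require Import all_boot all_order all_fingroup all_algebra all_character.
From mathcomp Require Import complex reals.
From mathcomp Require Import finmap monalg.
From mathcomp Require Import boolp classical_sets functions topology_structure.
From mathcomp Require mpoly.
From mathcomp Require Import ring.
Require Import Defs.
Import -(notations) mpoly.

Set Implicit Arguments.
Unset Strict Implicit.
Unset Printing Implicit Defensive.

Import Order.TTheory GRing.Theory Num.Theory.

Local Open Scope ring_scope.
Local Open Scope classical_set_scope.

(** * Isomorphic rings have isomorphic spectra *)

Section SpecIso.

Lemma Spec_ext (A : comPzRingType) (p q : Spec A) : (forall a, p a <-> q a) -> p = q.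
Proof.
case: p => P hP; case: q => Q hQ /= PQ.
have E : P = Q by apply/funext => a; apply/propext.
by subst Q; congr SpecPoint; exact: Prop_irrelevance.
Qed.

Section LocMap.
Variables (A B : comPzRingType) (f : {rmorphism A -> B}).
Variables (p : Spec A) (q : Spec B).
Hypothesis qp : forall a, q (f a) -> p a.

Lemma loc_den_subproof (s : denominator p) : `[< ~ q (f (val s)) >].
Proof. by apply/asboolP => /qp; exact: denominatorP. Qed.
Definition loc_den s : denominator q := Denominator (loc_den_subproof s).

(** Only an inclusion between the preimage of [q] and [p] is assumed. The map is thus available
    between points that are equal but not convertible, and no transport between localizations is
    needed. *)
Definition loc_map (x : localization p) : localization q :=
  let a := cid (frac_surj x) in let s := cid (svalP a) in
  frac (f (sval a)) (loc_den (sval s)).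

Lemma loc_mapE a s : loc_map (frac a s) = frac (f a) (loc_den s).
Proof.
rewrite /loc_map; case: cid => a' /= H; case: cid => s' /= E.
apply/fracE; move/esym/fracE: E => -[u pu E].
exists (f u); first by move/qp.
by rewrite /= -!rmorphM -rmorphB -rmorphM E rmorph0.
Qed.

Lemma loc_map_zmod_morphism : zmod_morphism loc_map.
Proof.
move=> x y; have [a [s ->]] := frac_surj x; have [b [t ->]] := frac_surj y.
have E : frac a s - frac b t = frac (a * val t + - b * val s) (denominatorM s t).
  by rewrite -loc_addE -loc_oppE.
have E' : forall a s b t, frac a s - frac b t =
   frac (a * val t + - b * val s) (denominatorM s t) :> localization q.
  by move=> *; rewrite -loc_addE -loc_oppE.
rewrite E !loc_mapE E'; apply/fracE; exists 1.
  by have [] := point_idealP q.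
by rewrite /= rmorphD !rmorphM rmorphN subrr mulr0.
Qed.

Lemma loc_map_monoid_morphism : monoid_morphism loc_map.
Proof.
split.
  have -> : 1 = frac 1 (denominator1 p) by [].
  have -> : 1 = frac 1 (denominator1 q) by [].
  rewrite loc_mapE; apply/fracE; exists 1; first by have [] := point_idealP q.
  by rewrite /= !rmorph1 subrr mulr0.
move=> x y; have [a [s ->]] := frac_surj x; have [b [t ->]] := frac_surj y.
have E : frac a s * frac b t = frac (a * b) (denominatorM s t) by rewrite -loc_mulE.
have E' : forall a s b t, frac a s * frac b t =
   frac (a * b) (denominatorM s t) :> localization q by move=> *; rewrite -loc_mulE.
rewrite E !loc_mapE E'; apply/fracE; exists 1; first by have [] := point_idealP q.
by rewrite /= !rmorphM subrr mulr0.
Qed.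

HB.instance Definition _ := GRing.isZmodMorphism.Build
  (localization p) (localization q) loc_map loc_map_zmod_morphism.
HB.instance Definition _ := GRing.isMonoidMorphism.Build
  (localization p) (localization q) loc_map loc_map_monoid_morphism.

End LocMap.

Lemma comap_prime (A B : comPzRingType) (f : {rmorphism A -> B}) (q : Spec B) :
  prime_ideal [set a | q (f a)].
Proof.
have [[q0 qB qM] q1 qP] := point_idealP q.
split=> [||x y] /=; rewrite ?rmorph1 //; last by rewrite rmorphM; exact: qP.
split=> [|x y|a x b] /=; rewrite ?rmorph0 ?rmorphB ?rmorphM //; first exact: qB.
exact: qM.
Qed.

Definition comap (A B : comPzRingType) (f : {rmorphism A -> B}) (q : Spec B) : Spec A :=
  SpecPoint (comap_prime f q).

Lemma comap_continuous (A B : comPzRingType) (f : {rmorphism A -> B}) :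
  continuous (comap f).
Proof.
apply/continuousP => U [E ->]; exists [set f x | x in E].
apply/seteqP; split=> q /= [a Ea qa]; first by exists (f a) => //; exists a.
by case: Ea => b Eb ba; subst a; exists b.
Qed.

Section Pullback.
Variables (A B : comPzRingType) (f : {rmorphism B -> A}) (V : set (Spec B)).

Definition pullback_family (s : sections V) : stalk_family (comap f @^-1` V) :=
  fun p Vp => loc_map (f := f) (p := comap f p) (q := p) (fun _ => id)
                (section_val s Vp).

Lemma pullback_subproof s : pullback_family s \in @locally_fraction A (comap f @^-1` V).
Proof.
apply/asboolP => p Vp; have /asboolP/(_ _ Vp) := section_valP s.
move=> [V' [oV' V'p [a [d sV']]]].
exists (comap f @^-1` V'); split=> //.
  by move/continuousP: (@comap_continuous _ _ f); apply.
exists (f a), (f d) => q Vq V'q; have [d' [<- E]] := sV' _ Vq V'q.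
by exists (loc_den (f := f) (p := comap f q) (q := q) (fun _ => id) d'); split=> //;
  rewrite /pullback_family E loc_mapE.
Qed.

Definition pullback s : sections (comap f @^-1` V) := SheafSection (pullback_subproof s).

Lemma pullback_zmod_morphism : zmod_morphism pullback.
Proof.
move=> s t; apply: val_inj; apply: functional_extensionality_dep => p.
apply: functional_extensionality_dep => Vp /=.
by rewrite /pullback_family; exact: raddfB.
Qed.

Lemma pullback_monoid_morphism : monoid_morphism pullback.
Proof.
split=> [|s t]; apply: val_inj; apply: functional_extensionality_dep => p;
  apply: functional_extensionality_dep => Vp.
  exact: rmorph1.
by rewrite /= /pullback_family; exact: rmorphM.
Qed.

HB.instance Definition _ := GRing.isZmodMorphism.Build
  (sections V) (sections (comap f @^-1` V)) pullback pullback_zmod_morphism.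
HB.instance Definition _ := GRing.isMonoidMorphism.Build
  (sections V) (sections (comap f @^-1` V)) pullback pullback_monoid_morphism.

End Pullback.

Section Iso.
Variables (k A B : comPzRingType) (iA : {rmorphism k -> A}) (iB : {rmorphism k -> B}).
Variables (f : {rmorphism A -> B}) (g : {rmorphism B -> A}).
Hypotheses (fK : cancel f g) (gK : cancel g f) (fi : forall a, f (iA a) = iB a).

Lemma comap_gK : cancel (comap g) (comap f).
Proof. by move=> p; apply: Spec_ext => a /=; rewrite fK. Qed.

Lemma comap_fK : cancel (comap f) (comap g).
Proof. by move=> p; apply: Spec_ext => a /=; rewrite gK. Qed.

Lemma comap_loc_map_inj (q : Spec B) (p : Spec A) (pq : forall b, p (g b) -> q b) :
  (forall b, q b -> p (g b)) ->
  injective (loc_map (f := g) (p := q) (q := p) pq).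
Proof.
move=> qp x y; have [a [s ->]] := frac_surj x; have [b [t ->]] := frac_surj y.
rewrite !loc_mapE => /fracE[u pu] /= E; apply/fracE; exists (f u).
  by move/qp; rewrite fK.
by apply: (can_inj gK); rewrite rmorphM fK rmorphB !rmorphM E rmorph0.
Qed.

(** [comap g (comap f p)] equals [p] only propositionally. With the equality as a hypothesis between
    two variables, substitution removes the dependency of the stalks. *)
Lemma loc_map_cancel (p p' : Spec A) (q : Spec B) (e : p' = p)
    (h1 : forall a, q (f a) -> p' a) (h2 : forall b, p (g b) -> q b)
    (V : set (Spec A)) (t : stalk_family V) (Vp : V p) (Vp' : V p') :
  loc_map h2 (loc_map h1 (t p' Vp')) = t p Vp.
Proof.
subst p'; rewrite (Prop_irrelevance Vp' Vp).
have [a [s ->]] := frac_surj (t p Vp).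
rewrite !loc_mapE; apply/fracE; exists 1; first by have [] := point_idealP p.
by rewrite /= !fK subrr mulr0.
Qed.

Lemma pullback_bij V : bijective (pullback g (V := V)).
Proof.
have inj : injective (pullback g (V := V)).
  move=> s s' /(congr1 (@section_val _ _)) E.
  apply: val_inj; apply: functional_extensionality_dep => q.
  apply: functional_extensionality_dep => Vq.
  suff H p (Vp : V (comap g p)) : section_val s Vp = section_val s' Vp.
    by move: (comap_fK q); move: (comap f q) => p e; subst q; exact: H.
  have := congr1 (fun h : stalk_family (comap g @^-1` V) => h p Vp) E.
  by apply: comap_loc_map_inj.
have surj t : exists s, pullback g (V := V) s = t.
  (* The inverse image under both maps is [V] only up to a proof, so the section pulled back along
     the inverse must still be restricted to [V]. *)
  have sub : V `<=` comap f @^-1` (comap g @^-1` V).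
    by move=> q Vq /=; rewrite comap_fK.
  exists (restriction sub (pullback f t)); apply: val_inj.
  apply: functional_extensionality_dep => p.
  apply: functional_extensionality_dep => Vp.
  by apply: loc_map_cancel; rewrite comap_gK.
exists (fun t => sval (cid (surj t))) => [s|t]; last by case: cid.
by apply: inj; case: cid.
Qed.

Lemma ring_iso_affine_scheme_iso : affine_scheme_iso iA iB.
Proof.
refine (@Build_affine_scheme_iso _ _ _ iA iB (comap g) (comap f) comap_gK comap_fK
  (@comap_continuous _ _ g) (@comap_continuous _ _ f)
  (fun V _ => pullback g (V := V)) _ _ _).
- by move=> V _; exact: pullback_bij.
- by move=> U V oU oV VU s; apply: val_inj.
- move=> V oV a; apply: val_inj; apply: functional_extensionality_dep => p.
  apply: functional_extensionality_dep => Vp /=.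
  rewrite /pullback_family /= loc_mapE -fi fK; apply/fracE; exists 1.
    by have [] := point_idealP p.
  by rewrite /= rmorph1 subrr mulr0.
Qed.

End Iso.
End SpecIso.

(** * Dunkl operators *)

Record group_action (G : finGroupType) (T : Type) := MkGroupAction {
  gact :> G -> T -> T;
  gact1 : forall t, gact 1%g t = t;
  gactM : forall u w t, gact (u * w)%g t = gact u (gact w t)
}.

(** * The crossed product of a finite group with functions *)

Section CrossedProduct.
Variables (G : finGroupType) (T : Type) (a : group_action G T) (k : comNzRingType).

(* The element \sum_w f_w w of the crossed product of G with the functions
   T -> k is represented by the family of its coefficients f_w; the action b is
   a phantom parameter on which the product depends. *)
Definition crossed (b : group_action G T) : Type := G -> T -> k.
Local Notation D := (crossed a).

HB.instance Definition _ := GRing.Zmodule.copy D (G -> T -> k).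

Implicit Types d e : D.

Definition crossed_one : D := fun w _ => (w == 1%g)%:R.
Definition crossed_mul d e : D :=
  fun w t => \sum_u d u t * e (u^-1 * w)%g (a u^-1%g t).

Lemma crossed_ext d e : (forall w t, d w t = e w t) -> d = e.
Proof. by move=> de; apply/funext => w; apply/funext => t. Qed.

Lemma crossed_mulA : associative crossed_mul.
Proof.
move=> d e f; apply: crossed_ext => w t; rewrite /crossed_mul.
under eq_bigr do rewrite mulr_sumr.
under [RHS]eq_bigr do rewrite mulr_suml.
rewrite [RHS]exchange_big /=; apply: eq_bigr => u _.
rewrite (reindex_inj (mulgI u^-1%g)) /=; apply: eq_bigr => v _.
by rewrite mulrA invMg invgK -gactM !mulgA !mulgK.
Qed.

Lemma crossed_mul1 : left_id crossed_one crossed_mul.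
Proof.
move=> d; apply: crossed_ext => w t; rewrite /crossed_mul (bigD1 1%g) //=.
rewrite /crossed_one eqxx mul1r invg1 mul1g gact1 big1 ?addr0 // => u /negPf ->.
by rewrite mul0r.
Qed.

Lemma crossed_1mul : right_id crossed_one crossed_mul.
Proof.
move=> d; apply: crossed_ext => w t; rewrite /crossed_mul (bigD1 w) //=.
rewrite /crossed_one mulVg eqxx mulr1 big1 ?addr0 // => u uw.
by rewrite -eq_invg_mul invgK (negPf uw) mulr0.
Qed.

Lemma crossed_mulDl : left_distributive crossed_mul +%R.
Proof.
move=> d e f; apply: crossed_ext => w t; rewrite /crossed_mul.
rewrite [RHS](_ : _ = \sum_u d u t * f (u^-1 * w)%g (a u^-1%g t)
                    + \sum_u e u t * f (u^-1 * w)%g (a u^-1%g t)) //.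
by rewrite -big_split; apply: eq_bigr => u _; exact: mulrDl.
Qed.

Lemma crossed_mulDr : right_distributive crossed_mul +%R.
Proof.
move=> f d e; apply: crossed_ext => w t; rewrite /crossed_mul.
rewrite [RHS](_ : _ = \sum_u f u t * d (u^-1 * w)%g (a u^-1%g t)
                    + \sum_u f u t * e (u^-1 * w)%g (a u^-1%g t)) //.
by rewrite -big_split; apply: eq_bigr => u _; exact: mulrDr.
Qed.

HB.instance Definition _ := GRing.Zmodule_isPzRing.Build D
  crossed_mulA crossed_mul1 crossed_1mul crossed_mulDl crossed_mulDr.

Lemma crossedD d e w t : (d + e) w t = d w t + e w t. Proof. by []. Qed.
Lemma crossedN d w t : (- d) w t = - d w t. Proof. by []. Qed.
Lemma crossed0 w t : (0 : D) w t = 0. Proof. by []. Qed.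
Lemma crossed1 w t : (1 : D) w t = (w == 1%g)%:R. Proof. by []. Qed.
Lemma crossedM d e w t :
  (d * e) w t = \sum_u d u t * e (u^-1 * w)%g (a u^-1%g t).
Proof. by []. Qed.

Lemma crossed_sum (I : Type) (r : seq I) (P : pred I) (F : I -> D) w t :
  (\sum_(i <- r | P i) F i) w t = \sum_(i <- r | P i) F i w t.
Proof. by elim/big_rec2: _ => //= i y1 y2 _ <-; rewrite crossedD. Qed.

Definition xfun (f : T -> k) : D := fun w t => f t *+ (w == 1%g).
Definition xgrp (u : G) : D := fun w _ => (w == u)%:R.

Lemma xfunM_coef f d w t : (xfun f * d) w t = f t * d w t.
Proof.
rewrite crossedM (bigD1 1%g) //= /xfun eqxx mulr1n invg1 mul1g gact1.
by rewrite big1 ?addr0 // => u /negPf ->; rewrite mulr0n mul0r.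
Qed.

Lemma Mxfun_coef f d w t : (d * xfun f) w t = d w t * f (a w^-1%g t).
Proof.
rewrite crossedM (bigD1 w) //= /xfun mulVg eqxx mulr1n.
rewrite big1 ?addr0 // => u uw.
by rewrite -eq_invg_mul invgK (negPf uw) mulr0n mulr0.
Qed.

Lemma xgrpM_coef u d w t : (xgrp u * d) w t = d (u^-1 * w)%g (a u^-1%g t).
Proof.
rewrite crossedM (bigD1 u) //= /xgrp eqxx mul1r.
by rewrite big1 ?addr0 // => v /negPf ->; rewrite mul0r.
Qed.

Lemma Mxgrp_coef d u w t : (d * xgrp u) w t = d (w * u^-1)%g t.
Proof.
rewrite crossedM (bigD1 (w * u^-1)%g) //= /xgrp invMg invgK mulgKV eqxx mulr1.
rewrite big1 ?addr0 // => v /eqP vw; case: eqP => [E|]; last by rewrite mulr0.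
by case: vw; rewrite -E invMg invgK mulKVg.
Qed.

Lemma xfun_is_zmod_morphism : zmod_morphism xfun.
Proof. by move=> f g; apply: crossed_ext => w t; exact: mulrnBl. Qed.

Lemma xfun_is_monoid_morphism : monoid_morphism xfun.
Proof.
split; first by apply: crossed_ext => w t.
by move=> f g; apply: crossed_ext => w t; rewrite xfunM_coef /xfun mulrnAr.
Qed.

HB.instance Definition _ :=
  GRing.isZmodMorphism.Build (T -> k) D xfun xfun_is_zmod_morphism.
HB.instance Definition _ :=
  GRing.isMonoidMorphism.Build (T -> k) D xfun xfun_is_monoid_morphism.

Lemma xfun_inj : injective xfun.
Proof.
move=> f g /(congr1 (fun d : D => d 1%g)) E; apply/funext => t.
by move: (congr1 (fun h : T -> k => h t) E); rewrite /xfun eqxx !mulr1n.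
Qed.

Lemma xgrp1 : xgrp 1%g = 1. Proof. by []. Qed.

Lemma xgrpM u w : xgrp (u * w)%g = xgrp u * xgrp w.
Proof.
apply: crossed_ext => v t; rewrite xgrpM_coef /xgrp.
by rewrite -(inj_eq (mulgI u^-1%g) v) mulKg.
Qed.

Lemma xgrp_xfun u f : xgrp u * xfun f = xfun (f \o a u^-1%g) * xgrp u.
Proof.
apply: crossed_ext => v t; rewrite xgrpM_coef xfunM_coef /xfun /xgrp /=.
by rewrite -eq_invg_mul invgK [v == u]eq_sym mulr_natr.
Qed.

Lemma xfun_comm f g : xfun f * xfun g = xfun g * xfun f.
Proof. by rewrite -!rmorphM mulrC. Qed.

Lemma crossed_sub d e w t : (d - e) w t = d w t - e w t.
Proof. by []. Qed.

End CrossedProduct.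

(** * Reflections as rank-one matrices *)

Section Roots.
Variables (C : numFieldType) (gT : finGroupType) (W : {group gT}) (n : nat).
Variable h : mx_representation C W n.
Variables (alpha : gT -> 'rV[C]_n) (alphav : gT -> 'cV[C]_n).

(** [dot], [refl_set] and [root_system] restate [pairing], [reflections] and [roots_of_reflections]
    over any numeric field. Over R[i] they are convertible to them, so the hypotheses of the theorem
    fit without translation. *)
Definition dot (y : 'cV[C]_n) (x : 'rV[C]_n) : C := (x *m y) 0 0.

Definition refl_set : {set gT} := [set s in W | \rank (h s - 1%:M) == 1%N].

Definition root_system :=
  forall s, s \in refl_set ->
    [/\ (alpha s == h s^-1%g - 1%:M)%MS,
        ((alphav s)^T == (h s - 1%:M)^T)%MS
      & dot (alphav s) (alpha s) = 2].

Hypothesis hroots : root_system.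

Local Notation refl := refl_set.

Lemma dotDl (y y' : 'cV[C]_n) x : dot (y + y') x = dot y x + dot y' x.
Proof. by rewrite /dot mulmxDr mxE. Qed.
Lemma dotDr (y : 'cV[C]_n) x x' : dot y (x + x') = dot y x + dot y x'.
Proof. by rewrite /dot mulmxDl mxE. Qed.
Lemma dotZl a (y : 'cV[C]_n) x : dot (a *: y) x = a * dot y x.
Proof. by rewrite /dot -scalemxAr mxE. Qed.
Lemma dotZr a (y : 'cV[C]_n) x : dot y (a *: x) = a * dot y x.
Proof. by rewrite /dot -scalemxAl mxE. Qed.
Lemma dot_mulmx (A : 'M_n) (y : 'cV[C]_n) x : dot (A *m y) x = dot y (x *m A).
Proof. by rewrite /dot mulmxA. Qed.
Lemma dot0r (y : 'cV[C]_n) : dot y 0 = 0.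
Proof. by rewrite /dot mul0mx mxE. Qed.

Lemma dot_delta (v : 'cV[C]_n) i : dot v (delta_mx 0 i) = v i 0.
Proof. by rewrite /dot -rowE mxE. Qed.

Lemma mulmx_dot (m : nat) (A : 'M_(m, 1)) (y : 'cV[C]_n) x :
  A *m x *m y = dot y x *: A.
Proof. by rewrite -mulmxA [x *m y]mx11_scalar mul_mx_scalar. Qed.

Lemma refl_setW s : s \in refl -> s \in W.
Proof. by rewrite inE => /andP[]. Qed.

Lemma refl_setJ s w : s \in refl -> w \in W -> (s ^ w)%g \in refl.
Proof.
rewrite !inE => /andP[Ws rs] Ww; rewrite groupJ //=.
have -> : h (s ^ w)%g - 1%:M = h w^-1%g *m (h s - 1%:M) *m h w.
  rewrite mulmxBr mulmxBl mulmx1 -!repr_mxM ?groupM ?groupV // mulVg repr_mx1.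
  by rewrite -mulgA.
rewrite mxrankMfree ?row_free_unit ?repr_mx_unit //.
by rewrite -mxrank_tr trmx_mul mxrankMfree ?row_free_unit ?unitmx_tr
  ?repr_mx_unit ?groupV // mxrank_tr.
Qed.

Lemma memJ_refl_set s w : w \in W -> ((s ^ w)%g \in refl) = (s \in refl).
Proof.
move=> Ww; apply/idP/idP => rs; last exact: refl_setJ.
by rewrite -(conjgK w s) refl_setJ ?groupV.
Qed.

Lemma refl_set_neq1 : 1%g \notin refl.
Proof. by rewrite inE group1 repr_mx1 subrr mxrank0. Qed.

(** If mu is the nontrivial eigenvalue of the inverse of s on h, this is (mu - 1)/2: the matrix
    [alphav s *m alpha s] has trace 2, so half the trace recovers its scalar factor in s^-1 - 1. *)
Definition refl_coef (s : gT) : C := \tr (h s^-1%g - 1%:M) / 2.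

Lemma refl_mxE s : s \in refl ->
  h s^-1%g - 1%:M = refl_coef s *: (alphav s *m alpha s).
Proof.
move=> rs; have Ws := refl_setW rs; have [Ea Eav p2] := hroots rs.
have /andP[_ /submxP[A EA]] := Ea.
have /andP[_ /submxP[B /(congr1 trmx)]] := Eav.
rewrite trmx_mul !trmxK => EB.
(* From s^-1 - 1 = - (s - 1) s^-1: both have the same column space, spanned by [alphav s]. *)
have E1 : h s^-1%g - 1%:M = alphav s *m (- (B^T *m h s^-1%g)).
  rewrite mulmxN mulmxA -EB mulmxBl mul1mx -repr_mxM ?groupV // mulgV repr_mx1.
  by rewrite opprB.
(* Applying the two factorizations, by rows and by columns, to [alphav s] gives twice the unknown
   column on one side and a multiple of [alphav s] on the other. *)
have : (h s^-1%g - 1%:M) *m alphav s = (h s^-1%g - 1%:M) *m alphav s by [].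
rewrite {1}EA E1 !mulmx_dot p2 => /(congr1 (fun z => 2^-1 *: z)).
rewrite !scalerA mulVf ?pnatr_eq0 // scale1r => EA'.
have E2 : h s^-1%g - 1%:M =
   (2^-1 * dot (alphav s) (- (B^T *m h s^-1%g))) *: (alphav s *m alpha s).
  by rewrite EA EA' -scalemxAl.
rewrite /refl_coef E2 mxtraceZ mxtrace_mulC /mxtrace big_ord1.
have -> : (alpha s *m alphav s) 0 0 = 2 by exact: p2.
by rewrite mulfK ?pnatr_eq0 // -E1.
Qed.

Lemma refl_coef_neq0 s : s \in refl -> refl_coef s != 0.
Proof.
move=> rs; have [Ea _ p2] := hroots rs; apply/eqP => z.
move/andP: Ea => [+ _]; rewrite (refl_mxE rs) z scale0r submx0 => /eqP a0.
by move/eqP: p2; rewrite a0 dot0r eq_sym pnatr_eq0.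
Qed.

Lemma refl_invE s y : s \in refl ->
  h s^-1%g *m y - y = (refl_coef s * dot y (alpha s)) *: alphav s.
Proof.
move=> rs; rewrite -{2}[y]mul1mx -mulmxBl refl_mxE // -scalemxAl mulmx_dot.
by rewrite scalerA.
Qed.

Lemma refl_inv_fix s y : s \in refl -> dot y (alpha s) = 0 -> h s^-1%g *m y = y.
Proof.
by move=> rs p0; apply/eqP; rewrite -subr_eq0 refl_invE // p0 mulr0 scale0r.
Qed.

Lemma alpha_proportional s s' (A : 'M_n) :
  s \in refl -> s' \in refl -> (alpha s' <= alpha s *m A)%MS ->
  exists2 k : C, k != 0 & alpha s' = k *: (alpha s *m A).
Proof.
move=> rs rs' /submxP[B EB]; exists (B 0 0).
  apply/eqP => B0; have [_ _ /eqP] := hroots rs'.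
  by rewrite EB [B]mx11_scalar B0 mul_scalar_mx scale0r dot0r eq_sym pnatr_eq0.
by rewrite EB {1}[B]mx11_scalar mul_scalar_mx.
Qed.

Lemma alphaV s : s \in refl -> exists2 k : C, k != 0 & alpha s^-1%g = k *: alpha s.
Proof.
move=> rs; have Ws := refl_setW rs.
have rs' : s^-1%g \in refl.
  move: rs; rewrite !inE groupV => /andP[-> /eqP r1] /=.
  have -> : h s^-1%g - 1%:M = - h s^-1%g *m (h s - 1%:M).
    by rewrite mulNmx mulmxBr mulmx1 -repr_mxM ?groupV // mulVg repr_mx1 opprB.
  rewrite -mxrank_tr trmx_mul mxrankMfree ?mxrank_tr ?r1 //.
  by rewrite row_free_unit unitmx_tr -scaleN1r unitmxZ ?unitrN1 ?repr_mx_unit ?groupV.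
have [k k0 ->] : exists2 k : C, k != 0 & alpha s^-1%g = k *: (alpha s *m 1%:M).
  apply: alpha_proportional => //; rewrite mulmx1.
  have [/andP[aE _] _ _] := hroots rs'; have [/andP[_ Ea] _ _] := hroots rs.
  apply: submx_trans aE _; apply: submx_trans Ea; rewrite invgK.
  have -> : h s - 1%:M = - h s *m (h s^-1%g - 1%:M).
    by rewrite mulNmx mulmxBr mulmx1 -repr_mxM ?groupV // mulgV repr_mx1 opprB.
  exact: submxMl.
by exists k; rewrite ?mulmx1.
Qed.

Lemma alphaJ s w : s \in refl -> w \in W ->
  exists2 k : C, k != 0 & alpha (s ^ w)%g = k *: (alpha s *m h w).
Proof.
move=> rs Ww; have Ws := refl_setW rs; have rsw := refl_setJ rs Ww.
apply: alpha_proportional => //.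
have [/andP[aE _] _ _] := hroots rsw; apply: submx_trans aE _.
have -> : h (s ^ w)^-1%g - 1%:M = h w^-1%g *m (h s^-1%g - 1%:M) *m h w.
  rewrite mulmxBr mulmxBl mulmx1 -!repr_mxM ?groupM ?groupV // mulVg repr_mx1.
  by rewrite -conjVg -mulgA.
rewrite -mulmxA mulmxA; apply: submxMr.
have [/andP[_ Ea] _ _] := hroots rs; exact: submx_trans (submxMl _ _) Ea.
Qed.

Lemma refl_coefJ s w : s \in refl -> w \in W -> refl_coef (s ^ w)%g = refl_coef s.
Proof.
move=> rs Ww; have Ws := refl_setW rs; rewrite /refl_coef.
have -> : h (s ^ w)^-1%g - 1%:M = h w^-1%g *m ((h s^-1%g - 1%:M) *m h w).
  rewrite mulmxBl mulmxBr mul1mx -!repr_mxM ?groupM ?groupV // mulVg repr_mx1.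
  by rewrite -conjVg.
by rewrite mxtrace_mulC -mulmxA -repr_mxM ?groupV // mulgV repr_mx1 mulmx1.
Qed.

(** Homogeneous of degree 0 in [alpha s], hence independent of the choice of root; this is what
    makes [refl_ratioJ] hold although conjugation preserves roots only up to scalars. The factor
    [refl_coef s] cancels the one in s^-1 v - v when commutators with linear forms are taken. *)
Definition refl_ratio (s : gT) (y v : 'cV[C]_n) : C :=
  dot y (alpha s) / (refl_coef s * dot v (alpha s)).

Lemma refl_ratioJ s w y v : s \in refl -> w \in W ->
  refl_ratio (s ^ w)%g y v = refl_ratio s (h w *m y) (h w *m v).
Proof.
move=> rs Ww; rewrite /refl_ratio refl_coefJ //; have [k k0 ->] := alphaJ rs Ww.
by rewrite !dotZr -!dot_mulmx mulrCA -mulf_div divff // mul1r.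
Qed.

End Roots.

(** * Dunkl operators satisfy the relations of the Cherednik algebra *)

Section Dunkl.
Variables (C : numFieldType) (gT : finGroupType) (W : {group gT}) (n : nat).
Variable h : mx_representation C W n.
Local Notation V := 'cV[C]_n.
Local Notation G := [subg W].
Local Notation k := {poly C}.

Definition freely_moved (v : V) := forall w : G, h (sgval w) *m v = v -> w = 1%g.

(* A point of h_reg x h^*, where h_reg is the locus on which W acts freely. *)
Record hpoint := HPoint {
  base : V;
  cobase : 'rV[C]_n;
  base_free : freely_moved base
}.

Lemma point_ext p q : base p = base q -> cobase p = cobase q -> p = q.
Proof.
case: p => v x fv; case: q => v' x' fv' /= E E'; subst v' x'.
by congr HPoint; exact: Prop_irrelevance.
Qed.

Lemma sgvalM (u w : G) : sgval (u * w)%g = (sgval u * sgval w)%g.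
Proof. by []. Qed.

Lemma sgvalV (u : G) : sgval (u^-1)%g = (sgval u)^-1%g.
Proof. by []. Qed.

Lemma freely_moved_act (u : G) v : freely_moved v -> freely_moved (h (sgval u) *m v).
Proof.
move=> fv w E; suff : (w ^ u = 1)%g by move/eqP; rewrite conjg_eq1 => /eqP.
apply: fv; rewrite /conjg !sgvalM !repr_mxM ?groupM ?groupV ?subgP // -!mulmxA E.
by rewrite mulmxA -repr_mxM ?groupV ?subgP // mulVg repr_mx1 mul1mx.
Qed.

Definition point_act (u : G) (p : hpoint) : hpoint :=
  HPoint (cobase p *m h (sgval u)^-1%g) (@freely_moved_act u _ (@base_free p)).

Lemma point_act1 p : point_act 1%g p = p.
Proof. by apply: point_ext => /=; rewrite ?invg1 repr_mx1 ?mul1mx ?mulmx1. Qed.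

Lemma point_actM u w p : point_act (u * w)%g p = point_act u (point_act w p).
Proof.
apply: point_ext => /=; first by rewrite repr_mxM ?subgP // mulmxA.
by rewrite invMg repr_mxM ?groupV ?subgP // mulmxA.
Qed.

Definition point_action := MkGroupAction point_act1 point_actM.
Local Notation D := (crossed k point_action).
Local Notation xf := (@xfun G hpoint point_action k).
Local Notation xg := (@xgrp G hpoint point_action k).

(** Serves both for W, with shift 0, and for W_b, with shift b. The ambient [h] is a parameter, so
    that both algebras land in the crossed product of the whole of W. The shift has to be fixed by
    the group for the functions x(v - shift) to be permuted in the same way as the x's. *)
Record cherednik_datum := CherednikDatum {
  cgrp : {group gT};
  crep : mx_representation C cgrp n;
  croot : gT -> 'rV[C]_n;
  ccoroot : gT -> V;
  cpar : gT -> C;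
  cshift : V;
  cgrp_sub : cgrp \subset W;
  crepE : forall w, w \in cgrp -> crep w = h w;
  croots : root_system crep croot ccoroot;
  cparJ : forall s w, s \in refl_set crep -> w \in cgrp -> cpar (s ^ w)%g = cpar s;
  cshift_fix : forall w, w \in cgrp -> crep w *m cshift = cshift
}.

Arguments croots : clear implicits.

Variable d : cherednik_datum.
Local Notation W0 := (cgrp d).
Local Notation h0 := (crep d).
Local Notation refl := (refl_set h0).
Local Notation alpha := (croot d).
Local Notation alphav := (ccoroot d).
Local Notation H := (rca h0 (cpar d) alpha alphav).

Definition cincl (w : [subg W0]) : G := subg W (sgval w).

Lemma sgval_cincl w : sgval (cincl w) = sgval w.
Proof. by rewrite subgK //; apply: (fintype.subsetP (cgrp_sub d)); exact: subgP. Qed.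

Lemma cinclM u w : cincl (u * w)%g = (cincl u * cincl w)%g.
Proof. by apply: val_inj; rewrite /= !sgval_cincl. Qed.

Lemma cincl1 : cincl 1%g = 1%g.
Proof. by apply: val_inj; rewrite /= !sgval_cincl. Qed.

Lemma cincl_inj : injective cincl.
Proof.
by move=> u w /(congr1 val) E; apply: val_inj; move: E; rewrite /= !sgval_cincl.
Qed.

Definition crefl (s : gT) : G := cincl (subg W0 s).

Lemma sgval_crefl s : s \in W0 -> sgval (crefl s) = s.
Proof. by move=> W0s; rewrite sgval_cincl subgK. Qed.

(** A zero of [alpha s] is fixed by the inverse of s, which freeness forbids: the denominators of
    Dunkl operators are nonzero at the points considered. *)
Lemma base_root_neq0 (p : hpoint) s : s \in refl -> dot (base p) (alpha s) != 0.
Proof.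
move=> rs; have W0s := refl_setW rs; apply/eqP => p0.
have := refl_inv_fix (croots d) rs p0; rewrite crepE ?groupV // => E.
have : (crefl s)^-1%g = 1%g.
  by apply: (@base_free p); rewrite sgvalV sgval_crefl.
move/eqP; rewrite invg_eq1 => /eqP/(congr1 sgval); rewrite sgval_crefl // => s1.
by move: rs; rewrite s1; apply/negP; exact: refl_set_neq1.
Qed.

Definition dunkl_x (x : 'rV[C]_n) : D :=
  xf (fun p => (dot (base p - cshift d) x)%:P).
Definition dunkl_w (w : [subg W0]) : D := xg (cincl w).
Definition dunkl_coef (s : gT) (y : V) (v : V) : C :=
  cpar d s * refl_ratio h0 alpha s y v.
(* The variable 'X records the degree in h; setting it to 1 gives the usual
   Dunkl operator at t = 0. *)
Definition dunkl_y (y : V) : D :=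
  xf (fun p => (dot y (cobase p)) *: 'X)
  + \sum_(s in refl) xf (fun p => (dunkl_coef s y (base p))%:P)
                     * xg (crefl s).
Definition dunkl_scalar (a : C) : D := xf (fun _ => a%:P).

Lemma dunkl_yE y (u : D) w p : (dunkl_y y * u) w p =
  ((dot y (cobase p)) *: 'X) * u w p
  + \sum_(s in refl) (dunkl_coef s y (base p))%:P
        * u ((crefl s)^-1 * w)%g (point_act (crefl s)^-1%g p).
Proof.
rewrite mulrDl crossedD xfunM_coef mulr_suml crossed_sum; congr (_ + _).
by apply: eq_bigr => s _; rewrite -mulrA xfunM_coef xgrpM_coef.
Qed.

Lemma dunkl_coefDy s a y y' v :
  dunkl_coef s (a *: y + y') v = a * dunkl_coef s y v + dunkl_coef s y' v.
Proof. by rewrite /dunkl_coef /refl_ratio dotDl dotZl; ring. Qed.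

Lemma dunkl_scalar_comm a (u : D) : dunkl_scalar a * u = u * dunkl_scalar a.
Proof. by apply: crossed_ext => w p; rewrite xfunM_coef Mxfun_coef mulrC. Qed.

Lemma dunkl_y_linear a y y' :
  dunkl_y (a *: y + y') = dunkl_scalar a * dunkl_y y + dunkl_y y'.
Proof.
rewrite /dunkl_y mulrDr addrACA; congr (_ + _).
  rewrite -rmorphM -rmorphD; congr xf; apply/funext => p.
  by rewrite dotDl dotZl scalerDl -scalerA -mul_polyC.
rewrite mulr_sumr -big_split; apply: eq_bigr => s _ /=.
rewrite mulrA -rmorphM -mulrDl -rmorphD; congr (_ * _); congr (xf _).
by apply/funext => p; rewrite dunkl_coefDy polyCD polyCM.
Qed.

Lemma dunkl_x_linear a x x' :
  dunkl_x (a *: x + x') = dunkl_scalar a * dunkl_x x + dunkl_x x'.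
Proof.
rewrite -rmorphM -rmorphD; congr xf; apply/funext => p.
by rewrite dotDr dotZr polyCD polyCM.
Qed.

Lemma dunkl_wM u w : dunkl_w (u * w)%g = dunkl_w u * dunkl_w w.
Proof. by rewrite /dunkl_w cinclM xgrpM. Qed.

Lemma dunkl_w1 : dunkl_w 1%g = 1.
Proof. by rewrite /dunkl_w cincl1 xgrp1. Qed.

Lemma crep_cincl w : h (sgval (cincl w)) = h0 (sgval w).
Proof. by rewrite sgval_cincl crepE ?subgP. Qed.

Lemma dunkl_wx w x : dunkl_w w * dunkl_x x = dunkl_x (x *m h0 (sgval w)^-1%g) * dunkl_w w.
Proof.
rewrite /dunkl_w /dunkl_x xgrp_xfun; congr (_ * _); congr (xf _); apply/funext => p /=.
rewrite -dot_mulmx mulmxBr cshift_fix ?groupV ?subgP //.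
by rewrite sgval_cincl crepE ?groupV ?subgP.
Qed.

Lemma creflJ s w : s \in W0 ->
  crefl (s ^ (sgval w)^-1)%g = (cincl w * crefl s * (cincl w)^-1)%g.
Proof.
move=> W0s; apply: val_inj; rewrite /= sgval_crefl ?groupJ ?groupV ?subgP //.
by rewrite !sgval_cincl subgK // /conjg invgK mulgA.
Qed.

Lemma dunkl_wy w y : dunkl_w w * dunkl_y y = dunkl_y (h0 (sgval w) *m y) * dunkl_w w.
Proof.
have W0w := subgP w; rewrite /dunkl_y /dunkl_w mulrDr mulrDl; congr (_ + _).
  rewrite xgrp_xfun; congr (_ * _); congr (xf _); apply/funext => p /=.
  by rewrite invgK dot_mulmx crep_cincl.
rewrite mulr_sumr mulr_suml [RHS](reindex_inj (conjg_inj (sgval w)^-1%g)) /=.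
apply: eq_big => s.
  by rewrite memJ_refl_set ?groupV.
move=> rs; have W0s := refl_setW rs.
rewrite mulrA xgrp_xfun -!mulrA -!xgrpM; congr (_ * _); last first.
  by congr xg; rewrite creflJ // mulgKV.
congr xf; apply/funext => p /=; congr (_%:P); rewrite /dunkl_coef cparJ ?groupV //.
congr (_ * _); rewrite (refl_ratioJ (croots d)) ?groupV // mulmxA -repr_mxM ?groupV //.
by rewrite mulVg repr_mx1 mul1mx sgval_cincl crepE ?groupV.
Qed.

Lemma dunkl_xx x x' : dunkl_x x * dunkl_x x' = dunkl_x x' * dunkl_x x.
Proof. exact: xfun_comm. Qed.

(** The multiplication part of the Dunkl operator commutes with x. The term at s is multiplied by
    x(v) - x(s^-1 v), a multiple of [dot v (alpha s)], which cancels the pole and leaves a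
    constant. *)
Lemma dunkl_xy x y : dunkl_x x * dunkl_y y - dunkl_y y * dunkl_x x =
  - \sum_(s in refl) dunkl_scalar
       (cpar d s * dot y (alpha s) * dot (alphav s) x) * xg (crefl s).
Proof.
rewrite /dunkl_y mulrDr mulrDl opprD addrACA xfun_comm subrr add0r.
rewrite mulr_sumr mulr_suml -!sumrN -big_split; apply: eq_bigr => s rs /=.
have W0s := refl_setW rs.
rewrite /dunkl_x /dunkl_scalar -[X in _ - X]mulrA xgrp_xfun !mulrA -!rmorphM -mulrBl -rmorphB -[RHS]mulNr -rmorphN.
congr (_ * _); congr (xf _); apply/funext => p /=; rewrite !fctE /= -!polyCM -polyCB -polyCN.
congr (_%:P).
rewrite sgval_crefl // -(@crepE d) ?groupV //.
have -> : h0 s^-1%g *m base p = base p + (refl_coef h0 s * dot (base p) (alpha s)) *: alphav s.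
  by rewrite -(refl_invE (croots d)) // addrC subrK.
rewrite addrAC [dot (_ + _ *: _) _]dotDl dotZl /dunkl_coef /refl_ratio.
have := base_root_neq0 p rs; have := refl_coef_neq0 (croots d) rs.
move: (dot _ _) (dot _ _) (dot _ _) (dot _ _) => a b e f.
by move=> m0 b0; field; rewrite m0 b0.
Qed.

(** Comparing coefficients at w gives u_w (x(w^-1 v) - x(v)) = 0 for all linear x. Where u_w is
    nonzero, w^-1 fixes v, and v is free. *)
Lemma dunkl_x_comm_support (u : D) : (forall x, u * dunkl_x x = dunkl_x x * u) ->
  forall w p, w != 1%g -> u w p = 0.
Proof.
move=> cu w p w1; apply: contraNeq w1 => up0.
rewrite -invg_eq1; apply/eqP; apply: (@base_free p).
apply/matrixP => i j; rewrite ord1 {j}.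
have := congr1 (fun f : D => f w p) (cu (delta_mx 0 i)).
rewrite Mxfun_coef xfunM_coef mulrC => /(mulIf up0)/polyC_inj.
by rewrite !dot_delta [LHS]mxE [RHS]mxE => /addIr.
Qed.

Lemma dunkl_y_coef y w p : dunkl_y y w p =
  (dot y (cobase p) *: 'X) *+ (w == 1%g)
  + \sum_(s in refl) (dunkl_coef s y (base p))%:P *+ (w == crefl s).
Proof.
rewrite /dunkl_y crossedD crossed_sum; congr (_ + _); apply: eq_bigr => s _.
by rewrite xfunM_coef /xgrp mulr_natr.
Qed.

Lemma crefl_neq1 s : s \in refl -> crefl s != 1%g.
Proof.
move=> rs; have W0s := refl_setW rs; apply/eqP => /(congr1 sgval).
rewrite sgval_crefl // => s1; move: rs; rewrite s1; apply/negP; exact: refl_set_neq1.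
Qed.

(** Besides the product of the multiplication parts, only pairs of mutually inverse reflections
    reach the unit element. Their roots are proportional, so each such product is symmetric in y and
    y'. *)
Lemma dunkl_yy_coef1 y y' p : (dunkl_y y * dunkl_y y') 1%g p = (dunkl_y y' * dunkl_y y) 1%g p.
Proof.
have E0 z q : dunkl_y z 1%g q = dot z (cobase q) *: 'X.
  rewrite dunkl_y_coef eqxx mulr1n big1 ?addr0 // => s rs.
  by rewrite eq_sym (negPf (crefl_neq1 rs)).
rewrite !dunkl_yE !E0; congr (_ + _).
  by rewrite -!mul_polyC; ring.
apply: eq_bigr => s rs; have W0s := refl_setW rs.
rewrite !dunkl_y_coef mulg1 invg_eq1 (negPf (crefl_neq1 rs)) !mulr0n !add0r.
rewrite !mulr_sumr; apply: eq_bigr => s' rs'; have W0s' := refl_setW rs'.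
case: eqP => [E|_]; last by rewrite !mulr0.
have {E} -> : s' = s^-1%g.
  by move/(congr1 sgval): E; rewrite /= !sgval_crefl.
rewrite !mulr1n -!polyCM; congr (_%:P); rewrite /dunkl_coef /refl_ratio.
have [z z0 ->] := alphaV (croots d) rs; rewrite !dotZr; ring.
Qed.

Lemma dunkl_yx x y : dunkl_y y * dunkl_x x = dunkl_x x * dunkl_y y +
  \sum_(s in refl) dunkl_scalar
       (cpar d s * dot y (alpha s) * dot (alphav s) x) * dunkl_w (subg W0 s).
Proof. by rewrite -[X in _ + X]opprK -dunkl_xy opprB addrC subrK. Qed.

Lemma dunkl_scalarM a b : dunkl_scalar (a * b) = dunkl_scalar a * dunkl_scalar b.
Proof. by rewrite -rmorphM; congr xf; apply/funext => p; rewrite polyCM. Qed.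

Lemma dunkl_yB y y' : dunkl_y (y - y') = dunkl_y y - dunkl_y y'.
Proof.
have := dunkl_y_linear (-1) y' y; rewrite scaleN1r addrC => ->; rewrite addrC.
congr (_ + _); rewrite -[RHS]mulN1r; congr (_ * _).
by apply: crossed_ext => w p; rewrite crossedN /dunkl_scalar /xfun polyCN mulNrn.
Qed.

Lemma dunkl_y0 : dunkl_y 0 = 0.
Proof. by rewrite -(subrr 0) dunkl_yB subrr. Qed.

Lemma dunkl_yZ a y : dunkl_y (a *: y) = dunkl_scalar a * dunkl_y y.
Proof. by rewrite -[a *: y]addr0 dunkl_y_linear dunkl_y0 addr0. Qed.

(* The double commutator of two Dunkl operators with a linear form is visibly
   symmetric, so that their commutator commutes with all linear forms and is
   thus supported at the unit element of W. *)
Lemma dunkl_yy y y' : dunkl_y y * dunkl_y y' = dunkl_y y' * dunkl_y y.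
Proof.
suff cx x : (dunkl_y y * dunkl_y y' - dunkl_y y' * dunkl_y y) * dunkl_x x =
            dunkl_x x * (dunkl_y y * dunkl_y y' - dunkl_y y' * dunkl_y y).
  apply/eqP; rewrite -subr_eq0; apply/eqP/crossed_ext => w p.
  have [->|w1] := eqVneq w 1%g; first by rewrite crossed_sub dunkl_yy_coef1 subrr.
  exact: (dunkl_x_comm_support cx).
(* [K z] is the commutator of the Dunkl operator of z with x. Moving it past the operator of z'
   replaces z' by s z', and s z' - z' is a multiple of s [alphav s]; so the commutator depends on z
   and z' only through a symmetric product of pairings. *)
pose K y := \sum_(s in refl) dunkl_scalar
       (cpar d s * dot y (alpha s) * dot (alphav s) x) * dunkl_w (subg W0 s).
have KE z z' : K z * dunkl_y z' - dunkl_y z' * K z =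
   \sum_(s in refl) dunkl_scalar (- (cpar d s * dot (alphav s) x * refl_coef h0 s
        * (dot z (alpha s) * dot z' (alpha s))))
      * (dunkl_y (h0 s *m alphav s) * dunkl_w (subg W0 s)).
  rewrite mulr_suml mulr_sumr -sumrB; apply: eq_bigr => s rs.
  have W0s := refl_setW rs.
  rewrite -mulrA dunkl_wy subgK // [dunkl_y z' * _]mulrA -dunkl_scalar_comm -mulrA.
  rewrite -[X in _ - X]mulrA -mulrBr -mulrBl -dunkl_yB.
  have -> : h0 s *m z' - z' = (- (refl_coef h0 s * dot z' (alpha s))) *: (h0 s *m alphav s).
    rewrite scaleNr scalemxAr -(refl_invE (croots d)) // mulmxBr mulmxA.
    by rewrite -repr_mxM ?groupV // mulgV repr_mx1 mul1mx opprB.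
  move: (refl_coef h0 s) => m.
  rewrite dunkl_yZ !mulrA -dunkl_scalarM; congr (dunkl_scalar _ * _ * _); ring.
have E z z' : dunkl_y z * dunkl_y z' * dunkl_x x =
    dunkl_x x * (dunkl_y z * dunkl_y z') + (K z * dunkl_y z' + dunkl_y z * K z').
  by rewrite -mulrA dunkl_yx mulrDr mulrA dunkl_yx mulrDl -!mulrA -addrA.
have S : K y * dunkl_y y' - dunkl_y y' * K y = K y' * dunkl_y y - dunkl_y y * K y'.
  by rewrite !KE; apply: eq_bigr => s _; rewrite [dot y _ * _]mulrC.
rewrite mulrBl mulrBr !E opprD addrACA; set u := _ - _; set v := _ - _.
suff -> : v = 0 by rewrite addr0.
apply/eqP; rewrite subr_eq0; move/eqP: S; rewrite subr_eq => /eqP ->.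
by rewrite addrAC subrK.
Qed.

End Dunkl.

Arguments croots {C gT W n h} c.

(** * The Poincare-Birkhoff-Witt theorem *)

Section PolynomialFunctions.
Variable C : numFieldType.

(** Uniqueness of the digits in base B. *)
Lemma kronecker_inj n B (f g : 'I_n -> nat) :
  (forall i, f i < B)%N -> (forall i, g i < B)%N ->
  (\sum_i f i * B ^ i = \sum_i g i * B ^ i)%N -> f =1 g.
Proof.
elim: n f g => [|n IHn] f g fB gB; first by move=> _ [].
have B0 : (0 < B)%N by apply: leq_ltn_trans (fB ord0).
have step (e : 'I_n.+1 -> nat) : (\sum_i e i * B ^ i =
    (\sum_i e (lift ord0 i) * B ^ i) * B + e ord0)%N.
  rewrite big_ord_recl expn0 muln1 addnC big_distrl; congr (_ + _)%N.
  by apply: eq_bigr => i _; rewrite /= expnSr mulnA.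
rewrite !step => E.
have E0 : f ord0 = g ord0.
  by have := congr1 (modn^~ B) E; rewrite !modnMDl !modn_small.
have E' : f \o lift ord0 =1 g \o lift ord0.
  apply: IHn => [i|i|]; [exact: fB | exact: gB |].
  by move/eqP: E; rewrite E0 eqn_add2r eqn_pmul2r // => /eqP.
by move=> i; case: (unliftP ord0 i) => [j ->|->] //; exact: E'.
Qed.

Lemma poly_eq0_horner (q : {poly C}) : (forall t, q.[t] = 0) -> q = 0.
Proof.
move=> q0; apply: (@roots_geq_poly_eq0 _ _ [seq i%:R | i <- seq.iota 0 (size q)]).
- by apply/allP => _ /mapP[i _ ->]; rewrite /root q0.
- by rewrite map_inj_uniq ?iota_uniq // => i j /eqP; rewrite eqr_nat => /eqP.
- by rewrite size_map size_iota.
Qed.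

(* Kronecker substitution: X_i |-> t ^ (B ^ i) separates the monomials of p as
   soon as B exceeds their exponents. *)
Lemma meval_eq0 n (p : mpoly n C) : (forall v, meval v p = 0) -> p = 0.
Proof.
move=> p0; pose B := msize p.
pose e (m : multinom n) := (\sum_i m i * B ^ i)%N.
pose q : {poly C} := \sum_(m <- msupp p) mcoeff m p *: 'X^(e m).
have q0 : q = 0.
  apply: poly_eq0_horner => t; rewrite -(p0 (fun i => t ^+ (B ^ i))) mevalE.
  rewrite /q horner_sum; apply: eq_bigr => m _; rewrite hornerZ hornerXn.
  congr (_ * _); rewrite /e -prodrXr.
  by apply: eq_bigr => i _; rewrite -exprM mulnC.
apply/eqP/negPn/negP => pn0.
have [m mp] : exists m, m \in msupp p.
  case: (msupp p) (msupp_eq0 p) => [|m s] E; last by exists m; rewrite inE eqxx.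
  by rewrite eqxx (negPf pn0) in E.
have lt_msupp m' : m' \in msupp p -> forall i, (m' i < B)%N.
  move=> /msize_mdeg_lt m'B i; apply: leq_ltn_trans m'B.
  by rewrite mdegE (bigD1 i) //= leq_addr.
have : q`_(e m) = mcoeff m p.
  rewrite coef_sum (bigD1_seq m) ?msupp_uniq //= coefZ coefXn eqxx mulr1.
  rewrite big_seq_cond big1 ?addr0 // => m' /andP[m'p m'm].
  rewrite coefZ coefXn; case: eqP => [E|]; last by rewrite mulr0.
  case/eqP: m'm; apply/mnmP; apply: kronecker_inj (esym E); exact: lt_msupp.
by rewrite q0 coef0 => /esym/eqP; apply/negP; rewrite -mcoeff_msupp.
Qed.

(* mpoly.mmap needs a nontrivial target ring. *)
Section EvalMonomials.
Variables (n : nat) (S : pzRingType) (f : {rmorphism C -> S}) (mon : multinom n -> S).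

Definition eval_mon (p : mpoly n C) : S := \sum_(m <- msupp p) f (mcoeff m p) * mon m.

Lemma eval_monEw (r : seq (multinom n)) p : uniq r -> {subset msupp p <= r} ->
  eval_mon p = \sum_(m <- r) f (mcoeff m p) * mon m.
Proof.
move=> ur pr; rewrite (bigID (mem (msupp p))) /= [X in _ + X]big1 => [|m mp]; last first.
  by move: mp; rewrite -mcoeff_eq0 => /eqP ->; rewrite rmorph0 mul0r.
rewrite addr0 -big_filter; apply: perm_big; apply: uniq_perm.
- exact: msupp_uniq.
- exact: filter_uniq.
- by move=> m; rewrite mem_filter; case: (boolP (m \in msupp p)) => //= /pr ->.
Qed.

Lemma eval_monD p q : eval_mon (p + q) = eval_mon p + eval_mon q.
Proof.
pose r := undup (msupp p ++ msupp q ++ msupp (p + q)).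
have ur : uniq r by exact: undup_uniq.
rewrite !(@eval_monEw r) // => [|m|m|m]; rewrite ?mem_undup ?mem_cat;
  try by move=> ->; rewrite ?orbT.
by rewrite -big_split; apply: eq_bigr => m _; rewrite mcoeffD rmorphD mulrDl.
Qed.

Lemma eval_mon0 : eval_mon 0 = 0.
Proof. by rewrite /eval_mon msupp0 big_nil. Qed.

Lemma eval_mon_sum (I : Type) (r : seq I) (F : I -> mpoly n C) :
  eval_mon (\sum_(i <- r) F i) = \sum_(i <- r) eval_mon (F i).
Proof. exact: (big_morph _ eval_monD eval_mon0). Qed.

Lemma eval_monX c m : eval_mon (c *: mpolyX C m) = f c * mon m.
Proof.
rewrite (@eval_monEw [:: m]) // ?big_seq1; first by rewrite mcoeffZ mcoeffX eqxx mulr1.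
move=> m'; rewrite inE -[m' == m]negbK; apply: contraTN => mm'.
by rewrite -mcoeff_eq0 mcoeffZ mcoeffX [m == m']eq_sym (negPf mm') mulr0.
Qed.

Lemma eval_monZ c p : eval_mon (c *: p) = f c * eval_mon p.
Proof.
rewrite (@eval_monEw (msupp p)) ?msupp_uniq //; last exact: msuppZ_le.
rewrite mulr_sumr; apply: eq_bigr => m _; by rewrite mcoeffZ rmorphM mulrA.
Qed.

End EvalMonomials.

End PolynomialFunctions.

Section Model.
Variables (C : numFieldType) (gT : finGroupType) (W : {group gT}) (n : nat).
Variable h : mx_representation C W n.
Local Notation V := 'cV[C]_n.
Local Notation G := [subg W].
Local Notation k := {poly C}.
Local Notation D := (crossed k (point_action h)).

Section Relations.
Variable d : cherednik_datum h.
Local Notation W0 := (cgrp d).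
Local Notation h0 := (crep d).
Local Notation refl := (refl_set h0).
Local Notation alpha := (croot d).
Local Notation alphav := (ccoroot d).

(** The target ring is arbitrary: the same record describes the generators of H, the Dunkl
    operators, and the hypothesis of the universal property that connects them. *)
Record cherednik_relations (E : pzRingType) (es : C -> E) (ex : 'rV[C]_n -> E)
    (ey : V -> E) (ew : [subg W0] -> E) : Prop := CherednikRelations {
  rel_sC : forall a u, es a * u = u * es a;
  rel_xD : forall a x x', ex (a *: x + x') = es a * ex x + ex x';
  rel_yD : forall a y y', ey (a *: y + y') = es a * ey y + ey y';
  rel_w1 : ew 1%g = 1;
  rel_wM : forall w w', ew (w * w')%g = ew w * ew w';
  rel_wx : forall w x, ew w * ex x = ex (x *m h0 (sgval w)^-1%g) * ew w;
  rel_wy : forall w y, ew w * ey y = ey (h0 (sgval w) *m y) * ew w;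
  rel_xx : forall x x', ex x * ex x' = ex x' * ex x;
  rel_yy : forall y y', ey y * ey y' = ey y' * ey y;
  rel_xy : forall x y, ex x * ey y - ey y * ex x = - \sum_(s in refl)
     es (cpar d s * dot y (alpha s) * dot (alphav s) x) * ew (subg W0 s)
}.

Lemma dunkl_relations : cherednik_relations
  (@dunkl_scalar _ _ _ _ h) (dunkl_x d) (dunkl_y d) (dunkl_w (d := d)).
Proof.
split.
- exact: dunkl_scalar_comm.
- exact: dunkl_x_linear.
- exact: dunkl_y_linear.
- exact: dunkl_w1.
- exact: dunkl_wM.
- exact: dunkl_wx.
- exact: dunkl_wy.
- exact: dunkl_xx.
- exact: dunkl_yy.
- exact: dunkl_xy.
Qed.

(* These properties are all that is used of the rational Cherednik algebra. *)
Record cherednik_model := CherednikModel {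
  calg :> pzRingType;
  cs : {rmorphism C -> calg};
  cx : 'rV[C]_n -> calg;
  cy : V -> calg;
  cw : [subg W0] -> calg;
  crel : cherednik_relations cs cx cy cw;
  cgen : forall P : calg -> Prop, P 1 ->
    (forall u v, P u -> P v -> P (u + v)) ->
    (forall a u, P u -> P (cs a * u)) -> (forall x u, P u -> P (cx x * u)) ->
    (forall y u, P u -> P (cy y * u)) -> (forall w u, P u -> P (cw w * u)) ->
    forall u, P u;
  cdunkl : {rmorphism calg -> D};
  cdunkl_s : forall a, cdunkl (cs a) = @dunkl_scalar _ _ _ _ h a;
  cdunkl_x : forall x, cdunkl (cx x) = dunkl_x d x;
  cdunkl_y : forall y, cdunkl (cy y) = dunkl_y d y;
  cdunkl_w : forall w, cdunkl (cw w) = dunkl_w w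
}.
End Relations.

Hypothesis hfaith : forall w, w \in W -> h w = 1%:M -> w = 1%g.

Definition coords (v : V) (eta : 'rV[C]_n) (j : 'I_(n + n)) : C :=
  match fintype.split j with inl i => v i 0 | inr i => eta 0 i end.

Definition lin_x (x : 'rV[C]_n) : mpoly (n + n) C :=
  \sum_i x 0 i *: mpolyX C (mnm1 (lshift n i)).
Definition lin_y (y : V) : mpoly (n + n) C :=
  \sum_i y i 0 *: mpolyX C (mnm1 (rshift n i)).

Lemma coords_lshift v eta i : coords v eta (lshift n i) = v i 0.
Proof. by rewrite /coords (unsplitK (inl _ i)). Qed.

Lemma coords_rshift v eta i : coords v eta (rshift n i) = eta 0 i.
Proof. by rewrite /coords (unsplitK (inr _ i)). Qed.

Lemma meval_lin_x v eta x : meval (coords v eta) (lin_x x) = dot v x.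
Proof.
rewrite /lin_x raddf_sum /dot mxE; apply: eq_bigr => i _ /=.
by rewrite mevalZ mevalXU coords_lshift.
Qed.

Lemma meval_lin_y v eta y : meval (coords v eta) (lin_y y) = dot y eta.
Proof.
rewrite /lin_y raddf_sum /dot mxE; apply: eq_bigr => i _ /=.
by rewrite mevalZ mevalXU coords_rshift mulrC.
Qed.

(** The non-free vectors lie in finitely many hyperplanes, one for each w other than 1, by
    faithfulness. Multiplying P by their equations gives a polynomial that vanishes everywhere, and
    the factors can be cancelled. *)
Lemma meval_points_eq0 (b0 : V) (P : mpoly (n + n) C) :
  (forall p : hpoint h, meval (coords (base p - b0) (cobase p)) P = 0) -> P = 0.
Proof.
move=> P0; apply/eqP/negPn/negP => Pn0.
(* A nonzero row of w - 1 is a linear form that vanishes on the vectors fixed by w. *)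
have formE (w : G) : exists x : 'rV[C]_n, (w != 1%g -> x != 0) /\
    forall v, h (sgval w) *m v = v -> dot v x = 0.
  have [->|w1] := eqVneq w 1%g; first by exists 0; split=> // v _; exact: dot0r.
  have : h (sgval w) - 1%:M != 0.
    apply: contra w1; rewrite subr_eq0 => /eqP/(hfaith (subgP w)) E.
    by apply/eqP/val_inj.
  move=> _.
  have [i xi] : exists i, row i (h (sgval w) - 1%:M) != 0.
    apply/existsP; rewrite -negb_forall; apply: contra w1 => /forallP w0.
    apply/eqP/val_inj/(hfaith (subgP w))/eqP; rewrite -subr_eq0.
    by apply/eqP/row_matrixP => i; rewrite row0; apply/eqP; exact: w0.
  exists (row i (h (sgval w) - 1%:M)); split=> // v hv.
  by rewrite /dot -row_mul mulmxBl hv mul1mx subrr row0 mxE.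
have [f /all_and2[f0 f_fix]] := choice formE.
pose K w : mpoly (n + n) C := lin_x (f w) + mpolyC _ (dot b0 (f w)).
have KE w v eta : meval (coords v eta) (K w) = dot (v + b0) (f w).
  by rewrite mevalD meval_lin_x mevalC dotDl.
have Kn0 w : w != 1%g -> K w != 0.
  move=> w1; apply: contra (f0 w w1) => /eqP Kw; apply/eqP/rowP => i.
  have := KE w (delta_mx i 0 - b0) 0; rewrite Kw meval0 subrK /dot -colE !mxE.
  by move=> <-.
have : P * \prod_(w | w != 1%g) K w != 0.
  by rewrite mulf_neq0 //; apply/prodf_neq0 => w; exact: Kn0.
move/eqP; apply; apply: meval_eq0 => u.
pose v := \col_i u (lshift n i); pose eta := \row_i u (rshift n i).
have uE : u =1 coords v eta.
  move=> j; rewrite /coords; case: (fintype.splitP j) => i ji.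
    by rewrite mxE; congr u; apply: val_inj.
  by rewrite mxE; congr u; apply: val_inj.
rewrite (meval_eq _ uE) mevalM rmorph_prod /=.
have [free|] := pselect (freely_moved h (v + b0)).
  by have := P0 (HPoint eta free); rewrite /= addrK => ->; rewrite mul0r.
move=> /existsNP[w /not_implyP[hw /eqP w1]].
by rewrite (bigD1 w) //= KE f_fix // mul0r mulr0.
Qed.

End Model.

Section PBW.
Variables (C : numFieldType) (gT : finGroupType) (W : {group gT}) (n : nat).
Variable h : mx_representation C W n.
Hypothesis hfaith : forall w, w \in W -> h w = 1%:M -> w = 1%g.
Variables (d : cherednik_datum h) (M : cherednik_model d).
Local Notation V := 'cV[C]_n.
Local Notation W0 := (cgrp d).
Local Notation h0 := (crep d).
Local Notation cs := (@cs _ _ _ _ _ _ M).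
Local Notation cx := (@cx _ _ _ _ _ _ M).
Local Notation cy := (@cy _ _ _ _ _ _ M).
Local Notation cw := (@cw _ _ _ _ _ _ M).
Local Notation cdunkl := (@cdunkl _ _ _ _ _ _ M).
Local Notation rel := (crel M).

Definition xword (l : seq 'rV[C]_n) : M := \prod_(x <- l) cx x.
Definition yword (l : seq V) : M := \prod_(y <- l) cy y.

Definition word : Type := C * seq 'rV[C]_n * seq V * [subg W0].
Definition word_val (t : word) : M :=
  cs t.1.1.1 * xword t.1.1.2 * yword t.1.2 * cw t.2.

Definition spanned (u : M) := exists L : seq word, u = \sum_(t <- L) word_val t.

Lemma spannedD u v : spanned u -> spanned v -> spanned (u + v).
Proof. by move=> [L ->] [L' ->]; exists (L ++ L'); rewrite big_cat. Qed.

Lemma spanned_word t : spanned (word_val t).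
Proof. by exists [:: t]; rewrite big_seq1. Qed.

Lemma spanned_lin (f : M -> M) : (forall u v, f (u + v) = f u + f v) -> f 0 = 0 ->
  (forall t, spanned (f (word_val t))) -> forall u, spanned u -> spanned (f u).
Proof.
move=> fD f0 ft _ [L ->]; elim: L => [|t L IH].
  by rewrite big_nil f0; exists [::]; rewrite big_nil.
by rewrite big_cons fD; apply: spannedD.
Qed.

Lemma spanned_mull a : (forall t, spanned (a * word_val t)) ->
  forall u, spanned u -> spanned (a * u).
Proof. by apply: spanned_lin => [u v|]; rewrite ?mulrDr ?mulr0. Qed.

Lemma spanned_s a u : spanned u -> spanned (cs a * u).
Proof.
apply: spanned_mull => -[[[b l] l'] w].
by rewrite /word_val /= !mulrA -rmorphM; exact: (spanned_word (a * b, l, l', w)).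
Qed.

Lemma spanned_x x u : spanned u -> spanned (cx x * u).
Proof.
apply: spanned_mull => -[[[b l] l'] w].
have := spanned_word (b, x :: l, l', w); rewrite /word_val /= /xword big_cons.
by rewrite !mulrA [cs b * cx x](rel_sC rel).
Qed.

Lemma cw_xword w l :
  cw w * xword l = xword [seq x *m h0 (sgval w)^-1%g | x <- l] * cw w.
Proof.
rewrite /xword; elim: l => [|x l IH] /=; first by rewrite !big_nil mulr1 mul1r.
by rewrite !big_cons mulrA (rel_wx rel) -mulrA IH mulrA.
Qed.

Lemma cw_yword w l :
  cw w * yword l = yword [seq h0 (sgval w) *m y | y <- l] * cw w.
Proof.
rewrite /yword; elim: l => [|y l IH] /=; first by rewrite !big_nil mulr1 mul1r.
by rewrite !big_cons mulrA (rel_wy rel) -mulrA IH mulrA.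
Qed.

Lemma spanned_w w u : spanned u -> spanned (cw w * u).
Proof.
apply: spanned_mull => -[[[b l] l'] w'].
have := spanned_word (b, [seq x *m h0 (sgval w)^-1%g | x <- l],
  [seq h0 (sgval w) *m y | y <- l'], w * w')%g.
rewrite /word_val /= (rel_wM rel) !mulrA -[cw w * cs b](rel_sC rel).
by rewrite -!mulrA ![cw w * (_ * _)]mulrA cw_xword -!mulrA ![cw w * (_ * _)]mulrA
  cw_yword -!mulrA.
Qed.

(** Induction on the x-word: exchanging y with its first letter leaves commutator terms, which are
    group elements times the shorter word. *)
Lemma spanned_y y u : spanned u -> spanned (cy y * u).
Proof.
apply: spanned_mull => -[[[b l] l'] w'].
rewrite /word_val /= !mulrA -[cy y * cs b](rel_sC rel) -!mulrA.
apply: spanned_s; elim: l => [|x l IH].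
  have := spanned_word (1, [::], y :: l', w').
  by rewrite /word_val /= /xword big_nil /yword big_cons rmorph1 !mul1r mulrA.
have yx : cy y * cx x = cx x * cy y + \sum_(s in refl_set h0)
    cs (cpar d s * dot y (croot d s) * dot (ccoroot d s) x) * cw (subg W0 s).
  by rewrite -[X in _ + X]opprK -(rel_xy rel) opprB addrC subrK.
rewrite /xword big_cons -/(xword l) -[cx x * _ * _]mulrA mulrA yx mulrDl.
apply: spannedD; first by rewrite -mulrA; exact: spanned_x.
have tail : spanned (xword l * (yword l' * cw w')).
  have := spanned_word (1, l, l', w').
  by rewrite /word_val /= rmorph1 mul1r mulrA.
rewrite mulr_suml; elim/big_ind: _ => [|? ?|s _]; last 1 first.
- by rewrite -mulrA; apply: spanned_s; exact: spanned_w.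
- by exists [::]; rewrite big_nil.
- exact: spannedD.
Qed.

Lemma spanned_all u : spanned u.
Proof.
move: u; apply: (cgen (c := M)); first by have := spanned_word (1, [::], [::], 1%g);
  rewrite /word_val /= /xword /yword !big_nil rmorph1 (rel_w1 rel) !mulr1.
- exact: spannedD.
- exact: spanned_s.
- exact: spanned_x.
- exact: spanned_y.
- exact: spanned_w.
Qed.

(* Normally ordered monomials: the generators x_i come before the y_i. *)
Definition gen_var (j : 'I_(n + n)) : M :=
  match fintype.split j with
  | inl i => cx (delta_mx 0 i) | inr i => cy (delta_mx i 0)
  end.

Definition normal_form : mpoly (n + n) C -> M := 
  eval_mon cs (fun m => \prod_j gen_var j ^+ m j).

Lemma gen_var_lshift i : gen_var (lshift n i) = cx (delta_mx 0 i).
Proof. by rewrite /gen_var (unsplitK (inl _ i)). Qed.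
Lemma gen_var_rshift i : gen_var (rshift n i) = cy (delta_mx i 0).
Proof. by rewrite /gen_var (unsplitK (inr _ i)). Qed.

Lemma comm_prod_incr (S : pzRingType) (z : 'I_n -> S) (m : 'I_n -> nat) i :
  (forall i j, z i * z j = z j * z i) ->
  \prod_j z j ^+ ((i == j) + m j) = z i * \prod_j z j ^+ m j.
Proof.
move=> zC; have cz j e f : z j ^+ e * z i ^+ f = z i ^+ f * z j ^+ e.
  by apply: commrX; apply/commr_sym/commrX; exact: zC.
suff H (r : seq 'I_n) : uniq r ->
    \prod_(j <- r) z j ^+ ((i == j) + m j) = z i ^+ (i \in r) * \prod_(j <- r) z j ^+ m j.
  by rewrite H ?index_enum_uniq // mem_index_enum expr1.
elim: r => [|j r IH] /=; first by rewrite !big_nil mulr1.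
case/andP=> jr ur; rewrite !big_cons inE IH //.
have [E|ij] /= := eqVneq i j.
  by rewrite -E in jr *; rewrite (negPf jr) expr0 mul1r add1n exprS expr1 mulrA.
by rewrite add0n mulrA cz mulrA.
Qed.

Lemma normal_form_xM i P :
  normal_form (mpolyX C (mnm1 (lshift n i)) * P) = cx (delta_mx 0 i) * normal_form P.
Proof.
rewrite [P]mpolyE mulr_sumr /normal_form !eval_mon_sum mulr_sumr.
apply: eq_bigr => m _; rewrite -scalerAr -mpolyXD !eval_monX.
rewrite mulrA -(rel_sC rel) -mulrA; congr (_ * _).
rewrite !big_split_ord /= mulrA; congr (_ * _); last first.
  by apply: eq_bigr => j _; rewrite mnmDE mnm1E eq_lrshift.
under eq_bigr do rewrite gen_var_lshift mnmDE mnm1E (inj_eq (@lshift_inj _ _)).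
rewrite (comm_prod_incr (fun j => m (lshift n j))); last by move=> *; exact: (rel_xx rel).
by congr (_ * _); apply: eq_bigr => j _; rewrite gen_var_lshift.
Qed.

(** [normal_form] is not multiplicative. As the y's stand to the right, a y-variable becomes a right
    factor, whereas an x-variable becomes a left factor. *)
Lemma normal_form_yM i P :
  normal_form (mpolyX C (mnm1 (rshift n i)) * P) = normal_form P * cy (delta_mx i 0).
Proof.
rewrite [P]mpolyE mulr_sumr /normal_form !eval_mon_sum mulr_suml.
apply: eq_bigr => m _; rewrite -scalerAr -mpolyXD !eval_monX -mulrA; congr (_ * _).
rewrite !big_split_ord /= -mulrA; congr (_ * _).
  by apply: eq_bigr => j _; rewrite mnmDE mnm1E eq_rlshift.
under eq_bigr do rewrite gen_var_rshift mnmDE mnm1E (inj_eq (@rshift_inj _ _)).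
rewrite (comm_prod_incr (fun j => m (rshift n j))); last by move=> *; exact: (rel_yy rel).
under [in RHS]eq_bigr do rewrite gen_var_rshift.
elim/big_ind: _ => [|u v|j _]; first by rewrite mulr1 mul1r.
- by move=> uE vE; rewrite mulrA uE -mulrA vE mulrA.
- by apply/commrX; exact: (rel_yy rel).
Qed.

Lemma cx0 : cx 0 = 0.
Proof.
have := rel_xD rel 1 0 0; rewrite scale1r addr0 rmorph1 mul1r => /eqP.
by rewrite -subr_eq subrr => /eqP.
Qed.

Lemma cy0 : cy 0 = 0.
Proof.
have := rel_yD rel 1 0 0; rewrite scale1r addr0 rmorph1 mul1r => /eqP.
by rewrite -subr_eq subrr => /eqP.
Qed.

Lemma cx_coord x : cx x = \sum_i cs (x 0 i) * cx (delta_mx 0 i).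
Proof.
rewrite {1}[x]row_sum_delta; elim/big_rec2: _ => [|i u v _ <-]; first exact: cx0.
exact: (rel_xD rel).
Qed.

Lemma cy_coord y : cy y = \sum_i cs (y i 0) * cy (delta_mx i 0).
Proof.
have {1}-> : y = \sum_i y i 0 *: delta_mx i 0.
  by rewrite {1}[y]matrix_sum_delta; apply: eq_bigr => i _; rewrite big_ord1.
elim/big_rec2: _ => [|i u v _ <-]; first exact: cy0.
exact: (rel_yD rel).
Qed.

Lemma normal_form_lin_xM x P : normal_form (lin_x x * P) = cx x * normal_form P.
Proof.
rewrite /lin_x mulr_suml /normal_form eval_mon_sum cx_coord mulr_suml.
apply: eq_bigr => i _; rewrite -scalerAl eval_monZ -mulrA; congr (_ * _).
exact: normal_form_xM.
Qed.

Lemma normal_form_lin_yM y P : normal_form (lin_y y * P) = normal_form P * cy y.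
Proof.
rewrite /lin_y mulr_suml /normal_form eval_mon_sum cy_coord mulr_sumr.
apply: eq_bigr => i _; rewrite -scalerAl eval_monZ mulrA -(rel_sC rel) -mulrA.
by congr (_ * _); exact: normal_form_yM.
Qed.

Definition word_poly (t : word) : mpoly (n + n) C :=
  t.1.1.1 *: ((\prod_(x <- t.1.1.2) lin_x x) * \prod_(y <- t.1.2) lin_y y).

(** Up to its group element, a word depends only on its commutative symbol. A relation between
    symbols, detected by evaluation at points, thus lifts to a relation between words. *)
Lemma word_valE t : word_val t = normal_form (word_poly t) * cw t.2.
Proof.
case: t => [[[a l] l'] w]; rewrite /word_val /word_poly /= /normal_form eval_monZ.
rewrite -/(normal_form _) -!mulrA; congr (_ * _); rewrite mulrA; congr (_ * _).
elim: l => [|x l IH]; last by rewrite /xword !big_cons -!mulrA normal_form_lin_xM -IH.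
rewrite /xword !big_nil !mul1r; elim: l' => [|y l' IH].
  rewrite /yword !big_nil -(mpolyX0 _ C) -[mpolyX _ _]scale1r /normal_form eval_monX.
  rewrite rmorph1 mul1r.
  by rewrite big1 // => j _; rewrite mnm0E expr0.
rewrite /yword !big_cons normal_form_lin_yM -IH -/(yword l').
elim: l' {IH} => [|z l' IH]; first by rewrite /yword big_nil mulr1 mul1r.
by rewrite /yword big_cons -/(yword l') mulrA (rel_yy rel) -!mulrA IH.
Qed.

Lemma meval_word_poly v eta t : meval (coords v eta) (word_poly t) =
  t.1.1.1 * (\prod_(x <- t.1.1.2) dot v x) * \prod_(y <- t.1.2) dot y eta.
Proof.
rewrite /word_poly mevalZ mevalM !rmorph_prod /= -mulrA; congr (_ * (_ * _)).
  by apply: eq_bigr => x _; rewrite meval_lin_x.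
by apply: eq_bigr => y _; rewrite meval_lin_y.
Qed.

(** Only the multiplication part of a Dunkl operator contains ['X]. The reflection terms do not
    raise the degree, so the coefficient at the length of the word is the product of the symbols,
    and the higher ones vanish. *)
Lemma dunkl_yword_coef l w p j : (size l <= j)%N ->
  (cdunkl (yword l) w p)`_j =
  (\prod_(y <- l) dot y (cobase p)) *+ ((w == 1%g) && (j == size l)).
Proof.
elim: l w p j => [|y l IH] w p j lj /=.
  rewrite /yword !big_nil rmorph1 crossed1.
  by case: (w == 1%g) => /=; rewrite ?mulr0n ?coef0 // coef1.
case: j lj => // j lj; rewrite /yword !big_cons rmorphM cdunkl_y dunkl_yE -/(yword l).
rewrite coefD coef_sum big1 ?addr0 => [|s _]; last first.
  rewrite coefCM IH; last by apply: ltnW.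
  by rewrite [j.+1 == size l]gtn_eqF // andbF mulr0n mulr0.
by rewrite -scalerAl coefZ coefXM /= IH // eqSS mulrnAr.
Qed.

Lemma dunkl_xword l :
  cdunkl (xword l) = xfun _ (fun p => (\prod_(x <- l) dot (base p - cshift d) x)%:P).
Proof.
rewrite /xword; elim: l => [|x l IH].
  rewrite big_nil rmorph1 -[LHS](rmorph1 (@xfun _ _ (point_action h) {poly C})).
  by congr xfun; apply/funext => p; rewrite big_nil.
rewrite big_cons rmorphM IH cdunkl_x -rmorphM; congr xfun.
by apply/funext => p; rewrite big_cons polyCM.
Qed.

Lemma dunkl_word_coef t w p j : (size t.1.2 <= j)%N ->
  (cdunkl (word_val t) w p)`_j =
  meval (coords (base p - cshift d) (cobase p)) (word_poly t)
     *+ ((w == cincl t.2) && (j == size t.1.2)).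
Proof.
move=> tj; rewrite meval_word_poly; case: t tj => [[[a l] l'] u] /= tj.
rewrite /word_val /= !rmorphM cdunkl_w Mxgrp_coef cdunkl_s dunkl_xword -rmorphM.
rewrite xfunM_coef mulrfctE /= -polyCM coefCM dunkl_yword_coef // mulrnAr.
by congr (_ *+ (_ && _)); rewrite -eq_mulgV1.
Qed.

(* The part of highest degree in h of a sum of words is read off from the
   leading coefficients of its image, as a polynomial function on h_reg x h^*. *)
Lemma word_sum_eq0 j L : all (fun t : word => size t.1.2 < j)%N L ->
  cdunkl (\sum_(t <- L) word_val t) = 0 -> \sum_(t <- L) word_val t = 0.
Proof.
elim: j L => [|j IH] L.
  by case: L => [|//] _ _; rewrite big_nil.
move=> Lj L0; pose top (t : word) := size t.1.2 == j.
have topE : \sum_(t <- L | top t) word_val t = 0.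
  (* Longest words with different group elements contribute to different coefficients of the crossed
     product, so their symbols can be separated. *)
  rewrite (partition_big (fun t : word => t.2) predT) //=; apply: big1 => w _.
  have -> : \sum_(t <- L | top t && (t.2 == w)) word_val t =
     normal_form (\sum_(t <- L | top t && (t.2 == w)) word_poly t) * cw w.
    rewrite -big_filter -[in RHS]big_filter /normal_form eval_mon_sum mulr_suml.
    rewrite big_filter [RHS]big_filter; apply: eq_bigr => t /andP[_ /eqP <-].
    exact: word_valE.
  suff -> : \sum_(t <- L | top t && (t.2 == w)) word_poly t = 0.
    by rewrite /normal_form eval_mon0 mul0r.
  apply: (meval_points_eq0 hfaith (b0 := cshift d)) => p; rewrite raddf_sum /=.
  have := congr1 (fun u : crossed {poly C} (point_action h) => (u (cincl w) p)`_j) L0.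
  rewrite rmorph_sum crossed_sum coef_sum crossed0 coef0 => {2}<-.
  rewrite [RHS]big_seq [LHS]big_mkcond big_seq; apply: eq_bigr => t tL.
  have := allP Lj t tL; rewrite ltnS => tj; rewrite dunkl_word_coef // -mulrb.
  by rewrite (inj_eq (@cincl_inj _ _ _ _ _ d)) andbC [w == _]eq_sym [j == _]eq_sym.
move: L0; rewrite (bigID top) /= topE add0r -big_filter; apply: IH.
apply/allP => t; rewrite mem_filter => /andP[tj tL].
by have := allP Lj t tL; rewrite ltnS leq_eqVlt -/(top t) (negPf tj).
Qed.

Theorem cdunkl_inj : injective cdunkl.
Proof.
move=> u v /eqP; rewrite -subr_eq0 -rmorphB => /eqP uv0.
apply/eqP; rewrite -subr_eq0; apply/eqP.
have [L E] := spanned_all (u - v); rewrite E in uv0 *.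
apply: (@word_sum_eq0 (\max_(t <- L) (size t.1.2)).+1) => //.
by apply/allP => t tL; rewrite ltnS; exact: leq_bigmax_seq.
Qed.

End PBW.

(** * The centre and polynomial functions *)

Section IsPol.
Variables (C : numFieldType) (n : nat).
Local Notation V := 'cV[C]_n.

Definition pfun (p : mpoly n C) (v : V) : C := meval (fun i => v i 0) p.

Definition is_pol (f : V -> C) := exists p, forall v, pfun p v = f v.

Lemma eq_is_pol f g : f =1 g -> is_pol f -> is_pol g.
Proof. by move=> fg [p pf]; exists p => v; rewrite pf fg. Qed.

Lemma is_pol_cst a : is_pol (fun=> a).
Proof. by exists (mpolyC n a) => v; rewrite /pfun mevalC. Qed.

Lemma is_polD f g : is_pol f -> is_pol g -> is_pol (fun v => f v + g v).
Proof. by move=> [p pf] [q qg]; exists (p + q) => v; rewrite /pfun mevalD -pf -qg. Qed.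

Lemma is_polM f g : is_pol f -> is_pol g -> is_pol (fun v => f v * g v).
Proof. by move=> [p pf] [q qg]; exists (p * q) => v; rewrite /pfun mevalM -pf -qg. Qed.

Lemma is_polB f g : is_pol f -> is_pol g -> is_pol (fun v => f v - g v).
Proof. by move=> [p pf] [q qg]; exists (p - q) => v; rewrite /pfun mevalB -pf -qg. Qed.

Lemma is_polX f m : is_pol f -> is_pol (fun v => f v ^+ m).
Proof.
move=> pf; elim: m => [|m IH]; first exact: is_pol_cst.
by apply: eq_is_pol (is_polM pf IH) => v; rewrite exprS.
Qed.

Lemma is_pol_sum (I : Type) (r : seq I) (P : pred I) (F : I -> V -> C) :
  (forall i, P i -> is_pol (F i)) -> is_pol (fun v => \sum_(i <- r | P i) F i v).
Proof.
move=> pF; elim: r => [|i r IH].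
  by apply: eq_is_pol (is_pol_cst 0) => v; rewrite big_nil.
case Pi: (P i); last by apply: eq_is_pol IH => v; rewrite big_cons Pi.
by apply: eq_is_pol (is_polD (pF i Pi) IH) => v; rewrite big_cons Pi.
Qed.

Lemma is_pol_prod (I : Type) (r : seq I) (P : pred I) (F : I -> V -> C) :
  (forall i, P i -> is_pol (F i)) -> is_pol (fun v => \prod_(i <- r | P i) F i v).
Proof.
move=> pF; elim: r => [|i r IH].
  by apply: eq_is_pol (is_pol_cst 1) => v; rewrite big_nil.
case Pi: (P i); last by apply: eq_is_pol IH => v; rewrite big_cons Pi.
by apply: eq_is_pol (is_polM (pF i Pi) IH) => v; rewrite big_cons Pi.
Qed.

Lemma is_pol_dot x : is_pol (fun v => dot v x).
Proof.
exists (\sum_i x 0 i *: mpolyX C (mnm1 i)) => v.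
rewrite /pfun raddf_sum /dot mxE; apply: eq_bigr => i _ /=.
by rewrite mevalZ mevalXU.
Qed.

Lemma is_pol_comp f (F : V -> V) :
  is_pol f -> (forall i, is_pol (fun v => F v i 0)) -> is_pol (f \o F).
Proof.
move=> [p pf] pF; apply: (@eq_is_pol (fun v => pfun p (F v))) => [v|]; first exact: pf.
apply: (@eq_is_pol (fun v => \sum_(m <- msupp p) mcoeff m p * \prod_i F v i 0 ^+ m i)).
  by move=> v; rewrite /pfun mevalE.
apply: is_pol_sum => m _; apply: is_polM; first exact: is_pol_cst.
by apply: is_pol_prod => i _; exact: is_polX.
Qed.

Lemma is_pol_coord i : is_pol (fun v => v i 0).
Proof. by apply: eq_is_pol (is_pol_dot (delta_mx 0 i)) => v; rewrite dot_delta. Qed.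

Lemma is_pol_mulmx f (A : 'M_n) : is_pol f -> is_pol (fun v => f (A *m v)).
Proof.
move=> pf; apply: is_pol_comp => // i.
apply: eq_is_pol (is_pol_dot (row i A)) => v.
by rewrite /dot -row_mul mxE.
Qed.

Lemma is_pol_shift f (b : V) : is_pol f -> is_pol (fun v => f (v + b)).
Proof.
move=> pf; apply: is_pol_comp => // i.
by apply: eq_is_pol (is_polD (is_pol_coord i) (is_pol_cst (b i 0))) => v; rewrite mxE.
Qed.

End IsPol.

Section Image.
Variables (C : numFieldType) (gT : finGroupType) (W : {group gT}) (n : nat).
Variable h : mx_representation C W n.
Local Notation V := 'cV[C]_n.
Local Notation G := [subg W].
Local Notation k := {poly C}.
Local Notation D := (crossed k (point_action h)).
Local Notation xf := (@xfun G (hpoint h) (point_action h) k).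
Local Notation xg := (@xgrp G (hpoint h) (point_action h) k).

Definition plift (f : V -> C) : hpoint h -> k := fun p => (f (base p))%:P.

Lemma pliftM f g : plift (fun v => f v * g v) = plift f * plift g.
Proof. by apply/funext => p; rewrite /plift polyCM. Qed.
Lemma pliftB f g : plift (fun v => f v - g v) = plift f - plift g.
Proof. by apply/funext => p; rewrite /plift polyCB. Qed.
Lemma pliftX f m : plift (fun v => f v ^+ m) = plift f ^+ m.
Proof. by apply/funext => p; rewrite exprfctE /plift /= rmorphXn. Qed.

Variables (d : cherednik_datum h) (M : cherednik_model d).
Local Notation W0 := (cgrp d).
Local Notation h0 := (crep d).
Local Notation cs := (@cs _ _ _ _ _ _ M).
Local Notation cx := (@cx _ _ _ _ _ _ M).
Local Notation cy := (@cy _ _ _ _ _ _ M).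
Local Notation cw := (@cw _ _ _ _ _ _ M).
Local Notation cdunkl := (@cdunkl _ _ _ _ _ _ M).

Definition dunkl_img (u : D) := exists z : M, cdunkl z = u.

Lemma dunkl_img0 : dunkl_img 0. Proof. by exists 0; rewrite rmorph0. Qed.
Lemma dunkl_img1 : dunkl_img 1. Proof. by exists 1; rewrite rmorph1. Qed.
Lemma dunkl_imgD u v : dunkl_img u -> dunkl_img v -> dunkl_img (u + v).
Proof. by move=> [y <-] [z <-]; exists (y + z); rewrite rmorphD. Qed.
Lemma dunkl_imgB u v : dunkl_img u -> dunkl_img v -> dunkl_img (u - v).
Proof. by move=> [y <-] [z <-]; exists (y - z); rewrite rmorphB. Qed.
Lemma dunkl_imgM u v : dunkl_img u -> dunkl_img v -> dunkl_img (u * v).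
Proof. by move=> [y <-] [z <-]; exists (y * z); rewrite rmorphM. Qed.
Lemma dunkl_img_s a : dunkl_img (@dunkl_scalar _ _ _ _ h a).
Proof. by exists (cs a); rewrite cdunkl_s. Qed.
Lemma dunkl_img_y y : dunkl_img (dunkl_y d y).
Proof. by exists (cy y); rewrite cdunkl_y. Qed.
Lemma dunkl_img_w w : dunkl_img (dunkl_w (d := d) w).
Proof. by exists (cw w); rewrite cdunkl_w. Qed.
Lemma dunkl_img_sum (I : Type) (r : seq I) (P : pred I) (F : I -> D) :
  (forall i, P i -> dunkl_img (F i)) -> dunkl_img (\sum_(i <- r | P i) F i).
Proof. by move=> iF; elim/big_ind: _; [exact: dunkl_img0 | exact: dunkl_imgD | exact: iF]. Qed.

Definition cpoly (p : mpoly n C) : M :=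
  eval_mon cs (fun m => \prod_i cx (delta_mx 0 i) ^+ m i) p.

Lemma cdunkl_cpoly p : cdunkl (cpoly p) = xf (plift (fun v => pfun p (v - cshift d))).
Proof.
rewrite /cpoly /eval_mon rmorph_sum.
have -> : plift (fun v => pfun p (v - cshift d)) =
  \sum_(m <- msupp p) plift (fun v => mcoeff m p * \prod_i (v - cshift d) i 0 ^+ m i).
  apply/funext => q; rewrite fct_sumE /plift /pfun mevalE rmorph_sum.
  by apply: eq_bigr.
rewrite rmorph_sum; apply: eq_bigr => m _.
rewrite pliftM !rmorphM cdunkl_s; congr (_ * _).
rewrite rmorph_prod; have -> : plift (fun v => \prod_i (v - cshift d) i 0 ^+ m i) =
   \prod_i plift (fun v => (v - cshift d) i 0) ^+ m i.
  apply/funext => q; rewrite fct_prodE /plift rmorph_prod; apply: eq_bigr => i _.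
  by rewrite exprfctE rmorphXn.
rewrite rmorph_prod; apply: eq_bigr => i _; rewrite !rmorphXn cdunkl_x; congr (_ ^+ _).
by congr xf; apply/funext => q; rewrite /plift dot_delta.
Qed.

Lemma dunkl_img_pol f : is_pol f -> dunkl_img (xf (plift f)).
Proof.
move=> pf; have [p pE] := is_pol_shift (cshift d) pf.
exists (cpoly p); rewrite cdunkl_cpoly; congr xf; apply/funext => q.
by rewrite /plift pE subrK.
Qed.

Definition fun_invariant (f : hpoint h -> k) :=
  forall (w : G) p, sgval w \in W0 -> f (point_act w p) = f p.

(** Commuting with the x's leaves only the coefficient at 1; commuting with the group makes it
    invariant. *)
Lemma central_dunklP (z : M) : (forall u, z * u = u * z) ->
  exists2 f, cdunkl z = xf f & fun_invariant f.
Proof.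
move=> zC; exists (fun p => cdunkl z 1%g p).
  apply: crossed_ext => w p; rewrite /xfun; case: eqP => [->|/eqP w1]; first by rewrite mulr1n.
  rewrite mulr0n; apply: (@dunkl_x_comm_support _ _ _ _ _ d) w1 => x.
  by rewrite -(cdunkl_x M) -!rmorphM zC.
move=> w p W0w; have := congr1 (fun u : D => u w (point_act w p))
   (congr1 cdunkl (zC (cw (subg W0 (sgval w))))).
rewrite /= !rmorphM cdunkl_w Mxgrp_coef xgrpM_coef.
have -> : cincl (subg W0 (sgval w)) = w by apply: val_inj; rewrite /= sgval_cincl subgK.
by rewrite mulgV mulVg /= -point_actM mulVg point_act1.
Qed.

Hypothesis hfaith : forall w, w \in W -> h w = 1%:M -> w = 1%g.

Lemma xf_xg_comm f w : fun_invariant f -> sgval w \in W0 -> xg w * xf f = xf f * xg w.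
Proof.
move=> fi W0w; rewrite xgrp_xfun; congr (xf _ * _); apply/funext => p /=.
by rewrite fi // groupV.
Qed.

Lemma xf_dunkl_y_comm f y : fun_invariant f -> dunkl_y d y * xf f = xf f * dunkl_y d y.
Proof.
move=> fi; rewrite mulrDl mulrDr xfun_comm; congr (_ + _).
rewrite mulr_suml mulr_sumr; apply: eq_bigr => s rs; have W0s := refl_setW rs.
by rewrite -mulrA xf_xg_comm ?sgval_crefl // !mulrA [xf _ * xf f]xfun_comm.
Qed.

(** Injectivity of the Dunkl embedding transports the question to the crossed product, where an
    invariant function commutes with the image of each generator. *)
Lemma dunkl_central (z : M) f : cdunkl z = xf f -> fun_invariant f ->
  forall u, z * u = u * z.
Proof.
move=> zf fi u; apply: (cdunkl_inj hfaith); rewrite !rmorphM zf.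
move: u; apply: (cgen (c := M)).
- by rewrite rmorph1 mulr1 mul1r.
- by move=> u v uE vE; rewrite rmorphD mulrDl mulrDr uE vE.
- move=> a u uE; rewrite rmorphM cdunkl_s -mulrA -uE !mulrA; congr (_ * _).
  exact: xfun_comm.
- move=> x u uE; rewrite rmorphM cdunkl_x -mulrA -uE !mulrA; congr (_ * _).
  exact: xfun_comm.
- move=> y u uE; rewrite rmorphM cdunkl_y -mulrA -uE !mulrA; congr (_ * _).
  by rewrite xf_dunkl_y_comm.
- move=> w u uE; rewrite rmorphM cdunkl_w -mulrA -uE !mulrA; congr (_ * _).
  by rewrite [RHS]xf_xg_comm // sgval_cincl subgP.
Qed.

End Image.

(** * Comparison of W and its stabilizer near b *)

Section Comparison.
Variables (C : numFieldType) (gT : finGroupType) (W : {group gT}) (n : nat).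
Variable h : mx_representation C W n.
Local Notation V := 'cV[C]_n.
Local Notation G := [subg W].
Local Notation k := {poly C}.
Local Notation D := (crossed k (point_action h)).
Local Notation xf := (@xfun G (hpoint h) (point_action h) k).
Local Notation xg := (@xgrp G (hpoint h) (point_action h) k).
Local Notation polf := (@plift _ _ _ _ h).

Variables (d1 d0 : cherednik_datum h) (b : V).
Hypotheses (grp1 : cgrp d1 = W :> {set gT})
  (grp0 : forall w, (w \in cgrp d0) = (w \in W) && (h w *m b == b))
  (par01 : cpar d0 = cpar d1) (root01 : croot d0 = croot d1).
Variables (M1 : cherednik_model d1) (M0 : cherednik_model d0).
Local Notation W0 := (cgrp d0).
Local Notation im1 := (dunkl_img M1).
Local Notation im0 := (dunkl_img M0).
Local Notation refl1 := (refl_set (crep d1)).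
Local Notation refl0 := (refl_set (crep d0)).
Local Notation alpha := (croot d1).

Lemma grp1E w : (w \in cgrp d1) = (w \in W). Proof. by rewrite grp1. Qed.
Lemma stab_subW w : w \in W0 -> w \in W. Proof. by rewrite grp0 => /andP[]. Qed.
Lemma stab_fix w : w \in W0 -> h w *m b = b. Proof. by rewrite grp0 => /andP[_ /eqP]. Qed.

Lemma refl0E s : (s \in refl0) = (s \in refl1) && (s \in W0).
Proof.
rewrite !inE grp1E; have [W0s|] := boolP (s \in W0); rewrite ?andbF // andbT /=.
have Ws := stab_subW W0s; by rewrite Ws /= !crepE ?grp1E.
Qed.

Lemma refl1W s : s \in refl1 -> s \in W.
Proof. by move/refl_setW; rewrite grp1E. Qed.

Lemma creflE s : s \in W0 -> crefl d0 s = crefl d1 s.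
Proof.
by move=> W0s; apply: val_inj; rewrite /= !sgval_crefl // grp1E; exact: stab_subW.
Qed.

Lemma dunkl_coef01 s : s \in W0 -> dunkl_coef d0 s = dunkl_coef d1 s.
Proof.
move=> W0s; rewrite /dunkl_coef /refl_ratio /refl_coef par01 root01.
by rewrite !crepE ?grp1E ?groupV // ?grp1E stab_subW.
Qed.

Lemma dunkl_y_split y : dunkl_y d1 y = dunkl_y d0 y +
  \sum_(s in refl1 | s \notin W0) xf (polf (dunkl_coef d1 s y)) * xg (crefl d1 s).
Proof.
rewrite /dunkl_y -addrA; congr (_ + _); rewrite (bigID (mem W0)) /=; congr (_ + _).
apply: eq_big => s; first by rewrite refl0E.
by case/andP=> _ W0s; rewrite dunkl_coef01 // creflE.
Qed.

Lemma not_stab_root s : s \in refl1 -> s \notin W0 -> dot b (alpha s) != 0.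
Proof.
move=> rs; apply: contra => /eqP b0; have Ws := refl1W rs.
rewrite -groupV grp0 groupV Ws /= -(@crepE _ _ _ _ _ d1) ?grp1E ?groupV //.
by rewrite (refl_inv_fix (croots d1) rs b0).
Qed.

(* A W0-invariant polynomial which does not vanish at b and cancels the poles of
   the Dunkl operators of W along the reflection hyperplanes not through b. *)
Definition clearing (v : V) : C :=
  \prod_(t in W0) \prod_(s in refl1 | s \notin W0) dot (h t *m v) (alpha s).

Lemma prod_stab_inv (f : V -> C) t v : t \in W0 ->
  \prod_(u in W0) f (h u *m (h t *m v)) = \prod_(u in W0) f (h u *m v).
Proof.
move=> W0t; rewrite [RHS](reindex_inj (mulIg t)) /=.
apply: eq_big => u; first by rewrite groupMr.
by move=> W0u; rewrite mulmxA -repr_mxM // stab_subW.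
Qed.

Lemma clearing_inv t v : t \in W0 -> clearing (h t *m v) = clearing v.
Proof.
exact: (@prod_stab_inv (fun v => \prod_(s in refl1 | s \notin W0) dot v (alpha s))).
Qed.

Lemma clearing_pol : is_pol clearing.
Proof.
apply: is_pol_prod => t _; apply: is_pol_prod => s _.
exact: (is_pol_mulmx (h t) (is_pol_dot (alpha s))).
Qed.

Lemma clearing_b : clearing b != 0.
Proof.
apply/prodf_neq0 => t W0t; apply/prodf_neq0 => s /andP[rs W0s].
by rewrite stab_fix // not_stab_root.
Qed.

Lemma clearing_coef s y : s \in refl1 -> s \notin W0 -> exists2 g, is_pol g &
  forall p : hpoint h, clearing (base p) * dunkl_coef d1 s y (base p) = g (base p).
Proof.
move=> rs W0s.
(* [clearing] without the factor indexed by s and t = 1, which is the denominator of the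
   coefficient. *)
pose r v := (\prod_(s' in refl1 | (s' \notin W0) && (s' != s)) dot v (alpha s')) *
   (\prod_(t in W0 | t != 1%g) \prod_(s in refl1 | s \notin W0) dot (h t *m v) (alpha s)).
exists (fun v => cpar d1 s * (dot y (alpha s) / refl_coef (crep d1) s) * r v).
  apply: is_polM; first exact: is_pol_cst.
  apply: is_polM; apply: is_pol_prod => t _; first exact: is_pol_dot.
  by apply: is_pol_prod => s' _; exact: (is_pol_mulmx (h t) (is_pol_dot _)).
move=> p; have a0 := base_root_neq0 p rs.
rewrite /clearing (bigD1 1%g) //= repr_mx1 mul1mx (bigD1 s) /=; last by rewrite rs.
rewrite /dunkl_coef /refl_ratio /r.
under [in RHS]eq_bigl => s' do rewrite andbA.
have := refl_coef_neq0 (croots d1) rs.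
move: (\prod_(_ in _ | _) _) (\prod_(_ | _) _) a0 => A B.
move: (dot (base p) _) (dot y _) (refl_coef _ _) => a e m a0 m0.
by field; rewrite m0 a0.
Qed.

Definition fun_stable (N : V -> C) := forall t v, t \in W0 -> N (h t *m v) = N v.

Lemma plift_inv g : fun_stable g -> fun_invariant d0 (polf g).
Proof. by move=> gi w p W0w; rewrite /plift /= gi. Qed.

Lemma dunkl_w01 (w : [subg W0]) :
  dunkl_w (d := d0) w = dunkl_w (d := d1) (subg (cgrp d1) (sgval w)).
Proof.
congr xgrp; apply: val_inj; rewrite /= !sgval_cincl subgK // grp1E.
exact/stab_subW/subgP.
Qed.

Lemma img1_pol f : is_pol f -> im1 (xf (polf f)).
Proof. exact: dunkl_img_pol. Qed.

Lemma img1_clearing_coef s y : s \in refl1 -> s \notin W0 ->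
  im1 (xf (polf clearing) * xf (polf (dunkl_coef d1 s y))).
Proof.
move=> rs W0s; rewrite -rmorphM; have [g pg gE] := clearing_coef y rs W0s.
have -> : polf clearing * polf (dunkl_coef d1 s y) = polf g.
  by apply/funext => p; rewrite /plift -gE polyCM.
exact: img1_pol.
Qed.

(** Induction on generators of H(W_b). Being W_b-invariant, powers of [clearing] commute with all of
    them, so a generator can be treated separately from the rest; each y uses up one more power,
    against the poles along hyperplanes not through b. *)
Lemma img0_clearing u : im0 u ->
  exists N, im1 (xf (polf clearing) ^+ N * u) .
Proof.
case=> z <- {u}; set g := xf (polf clearing).
have gi : fun_invariant d0 (polf clearing).
  by apply: plift_inv => t v; exact: clearing_inv.
have g1 : im1 g by apply: img1_pol; exact: clearing_pol.
have gX1 N : im1 (g ^+ N).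
  by elim: N => [|N IH]; [exact: dunkl_img1 | rewrite exprS; exact: dunkl_imgM].
move: z; apply: (cgen (c := M0)).
- by exists 0; rewrite rmorph1 mulr1; exact: gX1.
- move=> u v [N uN] [N' vN]; exists (N + N')%N; rewrite rmorphD mulrDr; apply: dunkl_imgD.
    by rewrite addnC exprD -mulrA; exact: dunkl_imgM.
  by rewrite exprD -mulrA; exact: dunkl_imgM.
- move=> a u [N uN]; exists N; rewrite rmorphM cdunkl_s mulrA.
  by rewrite -(@dunkl_scalar_comm _ _ _ _ h) -mulrA; apply: dunkl_imgM => //; exact: dunkl_img_s.
- move=> x u [N uN]; exists N; rewrite rmorphM cdunkl_x mulrA.
  have -> : g ^+ N * dunkl_x d0 x = dunkl_x d0 x * g ^+ N.
    by apply: commr_sym; apply: commrX; exact: xfun_comm.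
  rewrite -mulrA; apply: dunkl_imgM => //.
  apply: (img1_pol (f := fun v => dot (v - cshift d0) x)).
  exact: (is_pol_shift (- cshift d0) (is_pol_dot x)).
- move=> y u [N uN]; exists N.+1; rewrite rmorphM cdunkl_y exprS.
  have -> : g * g ^+ N * (dunkl_y d0 y * cdunkl M0 u) =
            g * dunkl_y d0 y * (g ^+ N * cdunkl M0 u).
    rewrite !mulrA; congr (_ * _); rewrite -!mulrA; congr (_ * _).
    by apply: commr_sym; apply: commrX; exact: xf_dunkl_y_comm.
  apply: dunkl_imgM => //.
  have -> : dunkl_y d0 y = dunkl_y d1 y -
     \sum_(s in refl1 | s \notin W0) xf (polf (dunkl_coef d1 s y)) * xg (crefl d1 s).
    by rewrite dunkl_y_split addrK.
  rewrite mulrBr; apply: dunkl_imgB; first by apply: dunkl_imgM => //; exact: dunkl_img_y.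
  rewrite mulr_sumr; apply: dunkl_img_sum => s /andP[rs W0s]; rewrite mulrA.
  apply: dunkl_imgM; first exact: img1_clearing_coef.
  exact: (dunkl_img_w M1 (subg _ s)).
- move=> w u [N uN]; exists N; rewrite rmorphM cdunkl_w mulrA.
  have -> : g ^+ N * dunkl_w (d := d0) w = dunkl_w (d := d0) w * g ^+ N.
    apply: commr_sym; apply: commrX; apply: (xf_xg_comm (d := d0)) => //.
    by rewrite sgval_cincl subgP.
  by rewrite -mulrA; apply: dunkl_imgM => //; rewrite dunkl_w01; exact: dunkl_img_w.
Qed.

Definition twist (th : G -> V -> C) (u : D) : D := fun w p => (th w (base p))%:P * u w p.

Lemma twistM th th' u :
  twist (fun w v => th w v * th' w v) u = twist th (twist th' u).
Proof. by apply: crossed_ext => w p; rewrite /twist polyCM mulrA. Qed.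

Lemma twistD th u v : twist th (u + v) = twist th u + twist th v.
Proof. by apply: crossed_ext => w p; rewrite /twist !crossedD mulrDr. Qed.

Lemma twist_xfM th f u : twist th (xf f * u) = xf f * twist th u.
Proof. by apply: crossed_ext => w p; rewrite /twist !xfunM_coef mulrCA. Qed.

Definition twist_stable (th : G -> V -> C) := forall u, im0 u -> im0 (twist th u).

Lemma eq_twist_stable th th' : (forall w (p : hpoint h), th w (base p) = th' w (base p)) ->
  twist_stable th -> twist_stable th'.
Proof.
move=> E st u /st; congr (im0 _).
by apply: crossed_ext => w p; rewrite /twist E.
Qed.

Lemma twist_stableM th th' : twist_stable th -> twist_stable th' ->
  twist_stable (fun w v => th w v * th' w v).
Proof. by move=> s s' u iu; rewrite twistM; apply: s; exact: s'. Qed.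

Lemma twist_stable_pol f : is_pol f -> twist_stable (fun=> f).
Proof.
move=> pf u iu; have -> : twist (fun=> f) u = xf (polf f) * u.
  by apply: crossed_ext => w p; rewrite xfunM_coef.
by apply: dunkl_imgM => //; exact: dunkl_img_pol.
Qed.

Lemma twist_stableX th N : twist_stable th -> twist_stable (fun w v => th w v ^+ N).
Proof.
move=> st; elim: N => [|N IH].
  by apply: (eq_twist_stable _ (twist_stable_pol (is_pol_cst _ 1))) => w p; rewrite expr0.
by apply: (eq_twist_stable _ (twist_stableM st IH)) => w p; rewrite exprS.
Qed.

Lemma twist_stable_prod (I : Type) (r : seq I) (P : pred I) (F : I -> G -> V -> C) :
  (forall i, P i -> twist_stable (F i)) ->
  twist_stable (fun w v => \prod_(i <- r | P i) F i w v).
Proof.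
move=> sF; elim: r => [|i r IH].
  by apply: (eq_twist_stable _ (twist_stable_pol (is_pol_cst _ 1))) => w p; rewrite big_nil.
case Pi: (P i); last by apply: (eq_twist_stable _ IH) => w p; rewrite big_cons Pi.
by apply: (eq_twist_stable _ (twist_stableM (sF i Pi) IH)) => w p; rewrite big_cons Pi.
Qed.

(** Right multiplication by a function multiplies the coefficient at w by its value at w^-1 v. Hence
    this twist is a difference of a right and a left multiplication by polynomials. *)
Lemma twist_stable_factor l f : is_pol f ->
  twist_stable (fun w v => dot (h (sgval w)^-1%g *m v) l - f v).
Proof.
move=> pf u iu.
have -> : twist (fun w v => dot (h (sgval w)^-1%g *m v) l - f v) u =
    u * xf (polf (fun v => dot v l)) - xf (polf f) * u.
  apply: crossed_ext => w p; rewrite crossed_sub Mxfun_coef xfunM_coef /twist.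
  by rewrite polyCB mulrBl [u w p * _]mulrC.
by apply: dunkl_imgB; apply: dunkl_imgM => //; apply: dunkl_img_pol => //; exact: is_pol_dot.
Qed.

Lemma separating u : exists l : 'rV[C]_n,
  u \in W -> u \notin W0 -> dot b l != dot (h u^-1%g *m b) l.
Proof.
have [Wu|] := boolP (u \in W); last by exists 0.
have [|W0u] := boolP (u \in W0); first by exists 0.
have : h u^-1%g *m b != b by move: W0u; rewrite -groupV grp0 groupV Wu.
rewrite eq_sym => bu; have [i bui] : exists i, b i 0 != (h u^-1%g *m b) i 0.
  apply/existsP; rewrite -negb_forall; apply: contra bu => /forallP bu.
  by apply/eqP/matrixP => i j; rewrite (ord1 j); exact/eqP/bu.
by exists (delta_mx 0 i) => _ _; rewrite !dot_delta.
Qed.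

Definition sep_form : gT -> 'rV[C]_n := projT1 (choice separating).
Lemma sep_formP u : u \in W -> u \notin W0 -> dot b (sep_form u) != dot (h u^-1%g *m b) (sep_form u).
Proof. exact: (projT2 (choice separating)). Qed.

(* The factor indexed by u and t = 1 vanishes at the pairs (v, u^-1 v); the
   product over t in W0 makes it W0-invariant in the first variable v. *)
Definition separator (w : G) (v : V) : C :=
  \prod_(u in W | u \notin W0) \prod_(t in W0)
    (dot (h (sgval w)^-1%g *m v) (sep_form u) - dot (h (u^-1 * t)%g *m v) (sep_form u)).

(** The separator kills the coefficients outside W_b, while [clearing] removes the poles of the
    reflections outside W_b. *)
Definition localizer (w : G) (v : V) : C := clearing v * separator w v.

Lemma separator_stable : twist_stable separator.
Proof.
apply: twist_stable_prod => u _; apply: twist_stable_prod => t _.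
apply: twist_stable_factor; exact: (is_pol_mulmx _ (is_pol_dot _)).
Qed.

Lemma localizer_stable : twist_stable localizer.
Proof.
exact: (twist_stableM (twist_stable_pol clearing_pol) separator_stable).
Qed.

Lemma localizer_coef_stable s y : s \in refl1 -> s \notin W0 ->
  twist_stable (fun w v => localizer w v * dunkl_coef d1 s y v).
Proof.
move=> rs W0s; have [g pg gE] := clearing_coef y rs W0s.
apply: (eq_twist_stable _ (twist_stableM (twist_stable_pol pg) separator_stable)) => w p /=.
by rewrite /localizer -gE mulrAC.
Qed.

Lemma localizer_out w v : sgval w \notin W0 -> localizer w v = 0.
Proof.
move=> W0w; rewrite /localizer /separator (bigD1 (sgval w)) ?subgP //=.
by rewrite (bigD1 1%g) //= mulg1 subrr mul0r mul0r mulr0.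
Qed.

(** Replacing (w, v) by (t w, t v) does not change w^-1 v and permutes the factors indexed by W_b.
    This lets the twist by [localizer] commute with the Dunkl operators of W_b. *)
Lemma localizer_inv t w v : sgval t \in W0 ->
  localizer (t * w)%g (h (sgval t) *m v) = localizer w v.
Proof.
move=> W0t; rewrite /localizer clearing_inv //; congr (_ * _).
apply: eq_bigr => u /andP[Wu _].
rewrite [RHS](reindex_inj (mulIg (sgval t))) /=; apply: eq_big => t'.
  by rewrite groupMr.
move=> W0t'; rewrite !mulmxA -!repr_mxM ?groupM ?groupV ?subgP ?(stab_subW W0t') //.
  by rewrite invMg mulgKV mulgA.
by rewrite groupM ?subgP.
Qed.

Lemma localizer1_pol : is_pol (localizer 1%g).
Proof.
apply: is_polM; first exact: clearing_pol.
apply: is_pol_prod => u _; apply: is_pol_prod => t _.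
by apply: is_polB; exact: (is_pol_mulmx _ (is_pol_dot _)).
Qed.

Lemma localizer1_b : localizer 1%g b != 0.
Proof.
rewrite mulf_neq0 ?clearing_b //; apply/prodf_neq0 => u /andP[Wu W0u].
apply/prodf_neq0 => t W0t; rewrite subr_eq0 invg1 repr_mx1 mul1mx.
by rewrite repr_mxM ?groupV ?(stab_subW W0t) // -mulmxA stab_fix // sep_formP.
Qed.

Definition eventually_im0 (u : D) :=
  exists N, im0 (twist (fun w v => localizer w v ^+ N) u).

Lemma eventually_im0_ge N u : im0 (twist (fun w v => localizer w v ^+ N) u) ->
  forall N', (N <= N')%N -> im0 (twist (fun w v => localizer w v ^+ N') u).
Proof.
move=> iu N' NN'.
have -> : twist (fun w v => localizer w v ^+ N') u =
   twist (fun w v => localizer w v ^+ (N' - N)) (twist (fun w v => localizer w v ^+ N) u).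
  rewrite -twistM; apply: crossed_ext => w p.
  by rewrite /twist -exprD subnK.
by apply: twist_stableX iu; exact: localizer_stable.
Qed.

Lemma eventually_im0D u v : eventually_im0 u -> eventually_im0 v -> eventually_im0 (u + v).
Proof.
move=> [N iu] [N' iv]; exists (maxn N N'); rewrite twistD; apply: dunkl_imgD.
  by apply: eventually_im0_ge iu _ _; exact: leq_maxl.
by apply: eventually_im0_ge iv _ _; exact: leq_maxr.
Qed.

Lemma eventually_im0_imM f u : im0 (xf f) -> eventually_im0 u -> eventually_im0 (xf f * u).
Proof. by move=> imf [N iu]; exists N; rewrite twist_xfM; exact: dunkl_imgM. Qed.

Lemma twist_dunkl_y0 N y u : twist (fun w v => localizer w v ^+ N) (dunkl_y d0 y * u) =
  dunkl_y d0 y * twist (fun w v => localizer w v ^+ N) u.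
Proof.
apply: crossed_ext => w p; rewrite /twist !dunkl_yE mulrDr mulr_sumr mulrCA.
congr (_ + _); apply: eq_bigr => s rs; have W0s := refl_setW rs.
rewrite mulrCA /=; congr (_ * (_ * _)); congr (_ ^+ _)%:P.
by rewrite -[in RHS]sgvalV localizer_inv // sgvalV groupV sgval_crefl.
Qed.

Lemma eventually_im0_y y u : (forall s : G, eventually_im0 (xg s * u)) ->
  eventually_im0 (dunkl_y d1 y * u).
Proof.
move=> ev; rewrite dunkl_y_split mulrDl; apply: eventually_im0D.
  have [N iu] := ev 1%g; exists N; rewrite twist_dunkl_y0.
  by apply: dunkl_imgM; [exact: dunkl_img_y | move: iu; rewrite mul1r].
rewrite mulr_suml; elim/big_ind: _ => [|? ?|s /andP[rs W0s]].
- exists 0; rewrite (_ : twist _ 0 = 0); first exact: dunkl_img0.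
  by apply: crossed_ext => w p; rewrite /twist crossed0 mulr0.
- exact: eventually_im0D.
(* Of the N+1 powers, one absorbs the pole of the coefficient and the other N bring s u into the
   image. *)
have [N iu] := ev (crefl d1 s); exists N.+1.
have -> : twist (fun w v => localizer w v ^+ N.+1)
      (xf (polf (dunkl_coef d1 s y)) * xg (crefl d1 s) * u) =
   twist (fun w v => localizer w v * dunkl_coef d1 s y v)
     (twist (fun w v => localizer w v ^+ N) (xg (crefl d1 s) * u)).
  apply: crossed_ext => w p; rewrite -mulrA /twist xfunM_coef /plift exprS.
  rewrite (polyCM (localizer w _) (_ ^+ N)) (polyCM (localizer w _) (dunkl_coef _ _ _ _)).
  by rewrite -!mulrA; congr (_ * _); rewrite mulrCA.
exact: localizer_coef_stable.
Qed.

(** The quantifier over w strengthens the induction: a y of H(W) produces terms s u with s outside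
    W_b, and such s cannot be split off inside H(W_b). *)
Lemma im1_eventually z : forall w : G, eventually_im0 (xg w * cdunkl M1 z).
Proof.
move: z; apply: (cgen (c := M1)).
- move=> w; rewrite rmorph1 mulr1; have [W0w|W0w] := boolP (sgval w \in W0).
    exists 0; have -> : twist (fun w v => localizer w v ^+ 0) (xg w) = xg w.
      by apply: crossed_ext => w' p; rewrite /twist mul1r.
    have -> : w = cincl (subg W0 (sgval w)).
      by apply: val_inj; rewrite /= sgval_cincl subgK.
    exact: dunkl_img_w.
  (* One power suffices: [localizer] vanishes at group elements outside W_b. *)
  exists 1%N; have -> : twist (fun w v => localizer w v ^+ 1) (xg w) = 0.
    apply: crossed_ext => w' p; rewrite /twist /xgrp expr1.
    by case: eqP => [->|_]; rewrite ?mulr0 // localizer_out // mul0r.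
  exact: dunkl_img0.
- by move=> u v uE vE w; rewrite rmorphD mulrDr; exact: eventually_im0D.
- move=> a u uE w; rewrite rmorphM cdunkl_s mulrA -dunkl_scalar_comm -mulrA.
  by apply: eventually_im0_imM; [exact: dunkl_img_s | exact: uE].
- move=> x u uE w; rewrite rmorphM cdunkl_x mulrA xgrp_xfun -mulrA.
  apply: eventually_im0_imM; last exact: uE.
  have pf := is_pol_mulmx (h (sgval w)^-1%g) (is_pol_shift (- cshift d1) (is_pol_dot x)).
  exact: (dunkl_img_pol M0 pf).
- move=> y u uE w; rewrite rmorphM cdunkl_y mulrA.
  have wE : w = cincl (subg (cgrp d1) (sgval w)).
    by apply: val_inj; rewrite /= sgval_cincl subgK // grp1E subgP.
  rewrite wE -/(dunkl_w _) dunkl_wy -mulrA; apply: eventually_im0_y => s.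
  by rewrite mulrA -xgrpM; exact: uE.
- move=> w' u uE w; rewrite rmorphM cdunkl_w mulrA -xgrpM; exact: uE.
Qed.

(** The phi of the comparison. [localizer_inv] moves the group argument too and so gives no
    invariance of [localizer 1%g]; the product over W_b provides it. *)
Definition comparison_fun (v : V) : C := \prod_(t in W0) localizer 1%g (h t *m v).

Lemma comparison_fun_pol : is_pol comparison_fun.
Proof. by apply: is_pol_prod => t _; exact: (is_pol_mulmx _ localizer1_pol). Qed.

Lemma comparison_fun_inv : fun_stable comparison_fun.
Proof. by move=> t v; exact: (@prod_stab_inv (localizer 1%g)). Qed.

Lemma comparison_fun_b : comparison_fun b != 0.
Proof. by apply/prodf_neq0 => t W0t; rewrite stab_fix // localizer1_b. Qed.

Lemma comparison_fun_localizer :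
  exists2 g, is_pol g & forall v, comparison_fun v = localizer 1%g v * g v.
Proof.
exists (fun v => \prod_(t in W0 | t != 1%g) localizer 1%g (h t *m v)).
  by apply: is_pol_prod => t _; exact: (is_pol_mulmx _ localizer1_pol).
by move=> v; rewrite /comparison_fun (bigD1 1%g) //= repr_mx1 mul1mx.
Qed.

Lemma dunkl_img_powM d (M : cherednik_model d) f N u : is_pol f ->
  dunkl_img M u -> dunkl_img M (xf (polf f) ^+ N * u).
Proof.
move=> pf iu; apply: dunkl_imgM => //; elim: N => [|N IH]; first exact: dunkl_img1.
by rewrite exprS; apply: dunkl_imgM => //; exact: dunkl_img_pol.
Qed.

Lemma im0_im1_localized f : im0 (xf f) ->
  exists N, im1 (xf (polf comparison_fun ^+ N * f)).
Proof.
case/img0_clearing => N iN; exists N.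
have [g pg gE] := comparison_fun_localizer.
have -> : polf comparison_fun = polf clearing * (polf (separator 1%g) * polf g).
  by rewrite -!pliftM; apply/funext => p; rewrite /plift gE /localizer mulrA.
rewrite exprMn [X in X * f]mulrC -mulrA -pliftM rmorphM rmorphXn.
apply: dunkl_img_powM; last by rewrite rmorphM rmorphXn.
apply: is_polM => //; apply: is_pol_prod => u _; apply: is_pol_prod => t _.
by apply: is_polB; exact: (is_pol_mulmx _ (is_pol_dot _)).
Qed.

Lemma im1_im0_localized f : im1 (xf f) ->
  exists N, im0 (xf (polf comparison_fun ^+ N * f)).
Proof.
case=> z zf; have [N iN] := im1_eventually z 1%g; exists N.
have [g pg gE] := comparison_fun_localizer.
have E : twist (fun w v => localizer w v ^+ N) (xg 1%g * cdunkl M1 z) =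
         xf (polf (localizer 1%g) ^+ N * f).
  rewrite zf xgrp1 mul1r; apply: crossed_ext => w p; rewrite /twist /xfun.
  case: eqP => [->|_]; last by rewrite !mulr0n mulr0.
  by rewrite !mulr1n mulrfctE exprfctE /= polyC_exp.
rewrite E in iN.
have -> : polf comparison_fun = polf g * polf (localizer 1%g).
  by rewrite -!pliftM; apply/funext => p; rewrite /plift gE mulrC.
by rewrite exprMn -mulrA rmorphM rmorphXn; exact: dunkl_img_powM.
Qed.

Lemma exists_bump : exists q : V -> C, [/\ is_pol q, fun_stable q, q b != 0
  & forall w, w \in W -> w \notin W0 -> q (h w *m b) = 0].
Proof.
(* The form is taken at u^-1 because [sep_form u] separates b from u^-1 b, whereas the zeros wanted
   here are the points u b. *)
pose r v := \prod_(u in W | u \notin W0) (dot v (sep_form u^-1%g) - dot (h u *m b) (sep_form u^-1%g)).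
have pr : is_pol r.
  apply: is_pol_prod => u _; apply: is_polB; [exact: is_pol_dot | exact: is_pol_cst].
exists (fun v => \prod_(t in W0) r (h t *m v)); split.
- by apply: is_pol_prod => t _; exact: is_pol_mulmx.
- by move=> t v; exact: prod_stab_inv.
- apply/prodf_neq0 => t W0t; rewrite stab_fix //; apply/prodf_neq0 => u /andP[Wu W0u].
  by have := @sep_formP u^-1%g; rewrite !groupV invgK subr_eq0; apply.
- move=> w Ww W0w; rewrite (bigD1 1%g) //= repr_mx1 mul1mx /r (bigD1 w) /=.
    by rewrite subrr !mul0r.
  by rewrite Ww.
Qed.

End Comparison.

(** * Fibres of the centres *)

Section Fibres.
Variables (C : numFieldType) (gT : finGroupType) (W : {group gT}) (n : nat).
Variable h : mx_representation C W n.
Local Notation V := 'cV[C]_n.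
Local Notation G := [subg W].
Local Notation k := {poly C}.
Local Notation F := (hpoint h -> k).
Local Notation D := (crossed k (point_action h)).
Local Notation xf := (@xfun G (hpoint h) (point_action h) k).
Local Notation xg := (@xgrp G (hpoint h) (point_action h) k).
Local Notation polf := (@plift _ _ _ _ h).

Variables (d1 d0 : cherednik_datum h) (b : V).
Hypotheses (grp1 : cgrp d1 = W :> {set gT})
  (grp0 : forall w, (w \in cgrp d0) = (w \in W) && (h w *m b == b)).
Variables (M1 : cherednik_model d1) (M0 : cherednik_model d0).
Local Notation W0 := (cgrp d0).
Local Notation Q1 f := (dunkl_img M1 (xf f)).
Local Notation Q0 f := (dunkl_img M0 (xf f)).

Definition mx_stable (A : {set gT}) (q : V -> C) :=
  forall w v, w \in A -> q (h w *m v) = q v.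

Definition inv_fun (A : {set gT}) (f : F) :=
  forall (w : G) p, sgval w \in A -> f (point_act w p) = f p.

Lemma plift_inv_fun A q : mx_stable A q -> inv_fun A (polf q).
Proof. by move=> qs w p Aw; rewrite /plift /= qs. Qed.

(** The coefficients [S] are kept apart from the generators [m], so that additive maps such as
    traces or multiplications can be pushed through a sum while either of them changes. *)
Inductive ideal_span (m : (V -> C) -> Prop) (S : F -> Prop) : F -> Prop :=
| ideal_span0 : ideal_span m S 0
| ideal_spanMD q s x : m q -> S s -> ideal_span m S x -> ideal_span m S (polf q * s + x).

Lemma ideal_spanM m (S : F -> Prop) q s : m q -> S s -> ideal_span m S (polf q * s).
Proof. by move=> mq Ss; rewrite -[_ * _]addr0; apply: ideal_spanMD => //; exact: ideal_span0. Qed.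

Lemma ideal_spanD m S x y : ideal_span m S x -> ideal_span m S y -> ideal_span m S (x + y).
Proof.
move=> Ix Iy; elim: Ix => [|q s x' mq Ss _ IH]; first by rewrite add0r.
by rewrite -addrA; exact: ideal_spanMD.
Qed.

Lemma ideal_span_sum m S (I : Type) (r : seq I) (P : pred I) (E : I -> F) :
  (forall i, P i -> ideal_span m S (E i)) -> ideal_span m S (\sum_(i <- r | P i) E i).
Proof. by move=> SE; elim/big_ind: _; [exact: ideal_span0 | exact: ideal_spanD | exact: SE]. Qed.

Lemma ideal_span_mono m m' (S S' : F -> Prop) (T : F -> F) :
  T 0 = 0 -> (forall x y, T (x + y) = T x + T y) ->
  (forall q s, m q -> S s -> ideal_span m' S' (T (polf q * s))) ->
  forall x, ideal_span m S x -> ideal_span m' S' (T x).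
Proof.
move=> T0 TD Tms x; elim=> [|q s x' mq Ss _ IH]; first by rewrite T0; exact: ideal_span0.
by rewrite TD; apply: ideal_spanD => //; exact: Tms.
Qed.

Lemma ideal_span_mul m (S S' : F -> Prop) t x : (forall s, S s -> S' (t * s)) ->
  ideal_span m S x -> ideal_span m S' (t * x).
Proof.
move=> tS; apply: (@ideal_span_mono _ _ _ _ (fun x => t * x)) => [|y z|q s mq Ss].
- by rewrite mulr0.
- by rewrite mulrDr.
- by rewrite mulrCA; apply: ideal_spanM => //; exact: tS.
Qed.

(** As rings of functions: Z(W), the W_b-invariants of Q(W), and Z(W_b). The middle ring separates
    the two comparisons: inverting phi relates it to Z(W_b), traces relate it to Z(W). *)
Definition inv_img1 f := Q1 f /\ inv_fun W f.
Definition stab_inv_img1 f := Q1 f /\ inv_fun W0 f.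
Definition inv_img0 f := Q0 f /\ inv_fun W0 f.

Definition orbit_ideal_fun q := [/\ is_pol q, mx_stable W q & q b = 0].
Definition point_ideal_fun q := [/\ is_pol q, mx_stable W0 q & q b = 0].

Lemma inv_funM A f g : inv_fun A f -> inv_fun A g -> inv_fun A (f * g).
Proof. by move=> fi gi w p Aw; rewrite mulrfctE fi // gi. Qed.
Lemma inv_funB A f g : inv_fun A f -> inv_fun A g -> inv_fun A (f - g).
Proof. by move=> fi gi w p Aw; rewrite addrfctE opprfctE fi // gi. Qed.

Lemma dunkl_img_xfunM d (M : cherednik_model d) f g :
  dunkl_img M (xf f) -> dunkl_img M (xf g) -> dunkl_img M (xf (f * g)).
Proof. by rewrite rmorphM; exact: dunkl_imgM. Qed.
Lemma dunkl_img_xfunB d (M : cherednik_model d) f g :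
  dunkl_img M (xf f) -> dunkl_img M (xf g) -> dunkl_img M (xf (f - g)).
Proof. by rewrite rmorphB; exact: dunkl_imgB. Qed.

Lemma inv_img0M f g : inv_img0 f -> inv_img0 g -> inv_img0 (f * g).
Proof. by move=> [qf fi] [qg gi]; split; [exact: dunkl_img_xfunM | exact: inv_funM]. Qed.
Lemma inv_img0B f g : inv_img0 f -> inv_img0 g -> inv_img0 (f - g).
Proof. by move=> [qf fi] [qg gi]; split; [exact: dunkl_img_xfunB | exact: inv_funB]. Qed.
Lemma inv_img1M f g : inv_img1 f -> inv_img1 g -> inv_img1 (f * g).
Proof. by move=> [qf fi] [qg gi]; split; [exact: dunkl_img_xfunM | exact: inv_funM]. Qed.
Lemma stab_inv_img1M f g : stab_inv_img1 f -> stab_inv_img1 g -> stab_inv_img1 (f * g).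
Proof. by move=> [qf fi] [qg gi]; split; [exact: dunkl_img_xfunM | exact: inv_funM]. Qed.

Lemma inv_img0_pol q : is_pol q -> mx_stable W0 q -> inv_img0 (polf q).
Proof. by move=> pq qs; split; [exact: dunkl_img_pol | exact: plift_inv_fun]. Qed.
Lemma stab_inv_img1_pol q : is_pol q -> mx_stable W0 q -> stab_inv_img1 (polf q).
Proof. by move=> pq qs; split; [exact: dunkl_img_pol | exact: plift_inv_fun]. Qed.
Lemma inv_img1_pol q : is_pol q -> mx_stable W q -> inv_img1 (polf q).
Proof. by move=> pq qs; split; [exact: dunkl_img_pol | exact: plift_inv_fun]. Qed.

Definition const_fun (a : C) : F := polf (fun=> a).
Lemma const_funM a c : const_fun (a * c) = const_fun a * const_fun c. Proof. exact: pliftM. Qed.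
Lemma const_fun1 : const_fun 1 = 1. Proof. by []. Qed.
Lemma const_funV a : a != 0 -> const_fun a^-1 * const_fun a = 1.
Proof. by move=> a0; rewrite -const_funM mulVf // const_fun1. Qed.
Lemma inv_img0_const a : inv_img0 (const_fun a). Proof. by apply: inv_img0_pol => //; exact: is_pol_cst. Qed.
Lemma inv_img1_const a : inv_img1 (const_fun a). Proof. by apply: inv_img1_pol => //; exact: is_pol_cst. Qed.

Lemma ideal_span_img0M q x : inv_img0 q -> ideal_span point_ideal_fun inv_img0 x -> ideal_span point_ideal_fun inv_img0 (q * x).
Proof. by move=> Iq; apply: ideal_span_mul => s; exact: inv_img0M. Qed.
Lemma ideal_span_img1M q x : inv_img1 q -> ideal_span orbit_ideal_fun inv_img1 x -> ideal_span orbit_ideal_fun inv_img1 (q * x).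
Proof. by move=> Iq; apply: ideal_span_mul => s; exact: inv_img1M. Qed.
Lemma ideal_span_stab1M m q x : stab_inv_img1 q -> ideal_span m stab_inv_img1 x -> ideal_span m stab_inv_img1 (q * x).
Proof. by move=> Iq; apply: ideal_span_mul => s; exact: stab_inv_img1M. Qed.

Lemma ideal_spanN0 x : ideal_span point_ideal_fun inv_img0 x -> ideal_span point_ideal_fun inv_img0 (- x).
Proof.
move=> Ix; rewrite -mulN1r; apply: ideal_span_img0M => //.
have -> : -1 = const_fun (-1) by rewrite -[in RHS](sub0r 1); apply/funext => p; rewrite /const_fun /plift polyCB sub0r.
exact: inv_img0_const.
Qed.

Lemma ideal_spanB0 x y : ideal_span point_ideal_fun inv_img0 x -> ideal_span point_ideal_fun inv_img0 y -> ideal_span point_ideal_fun inv_img0 (x - y).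
Proof. by move=> Ix /ideal_spanN0; exact: ideal_spanD. Qed.

(** In the fibre, an invariant polynomial acts through its value at b; those not vanishing at b
    become invertible scalars. *)
Lemma ideal_span_eval q x : is_pol q -> mx_stable W0 q -> inv_img0 x ->
  ideal_span point_ideal_fun inv_img0 (polf q * x - const_fun (q b) * x).
Proof.
move=> pq qs Ix; rewrite -mulrBl.
have -> : polf q - const_fun (q b) = polf (fun v => q v - q b) by rewrite pliftB.
apply: ideal_spanM => //; split; [|by move=> w v W0w; rewrite qs |by rewrite subrr].
by apply: is_polB => //; exact: is_pol_cst.
Qed.

Lemma mx_stableS (A B : {set gT}) q : A \subset B -> mx_stable B q -> mx_stable A q.
Proof. by move=> AB qs w v Aw; apply: qs; exact: (fintype.subsetP AB). Qed.

Lemma W0_sub : W0 \subset W.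
Proof. by apply/fintype.subsetP => w; rewrite grp0 => /andP[]. Qed.

Lemma orbit_ideal_fun_point q : orbit_ideal_fun q -> point_ideal_fun q.
Proof. by move=> [pq qs qb]; split=> //; exact: mx_stableS W0_sub qs. Qed.

Variable phi : V -> C.
Hypotheses (phi_pol : is_pol phi) (phi_inv : mx_stable W0 phi) (phi_b : phi b != 0).
Hypothesis loc01 : forall f, Q0 f -> exists N, Q1 (polf phi ^+ N * f).
Hypothesis loc10 : forall f, Q1 f -> exists N, Q0 (polf phi ^+ N * f).

Lemma inv_img0_phi N : inv_img0 (polf phi ^+ N).
Proof.
rewrite -pliftX; apply: inv_img0_pol; first exact: is_polX.
by move=> w v W0w; rewrite phi_inv.
Qed.

Lemma stab_inv_img1_phi N : stab_inv_img1 (polf phi ^+ N).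
Proof.
rewrite -pliftX; apply: stab_inv_img1_pol; first exact: is_polX.
by move=> w v W0w; rewrite phi_inv.
Qed.

Lemma stab_inv_img1_loc0 f : stab_inv_img1 f -> exists N, inv_img0 (polf phi ^+ N * f).
Proof.
move=> [qf fi]; have [N qN] := loc10 qf; exists N; split=> //.
by apply: inv_funM => //; case: (inv_img0_phi N).
Qed.

Lemma inv_img0_loc1 f : inv_img0 f -> exists N, stab_inv_img1 (polf phi ^+ N * f).
Proof.
move=> [qf fi]; have [N qN] := loc01 qf; exists N; split=> //.
by apply: inv_funM => //; case: (inv_img0_phi N).
Qed.

Lemma inv_img1_stab f : inv_img1 f -> stab_inv_img1 f.
Proof.
move=> [qf fi]; split=> // w p W0w; apply: fi.
exact: (fintype.subsetP W0_sub).
Qed.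

Lemma ideal_span_loc10 x : ideal_span orbit_ideal_fun stab_inv_img1 x ->
  exists N, ideal_span point_ideal_fun inv_img0 (polf phi ^+ N * x).
Proof.
elim=> [|q s x' mq Is _ [N IN]]; first by exists 0; rewrite mulr0; exact: ideal_span0.
have [N' sN'] := stab_inv_img1_loc0 Is; exists (N + N')%N; rewrite mulrDr; apply: ideal_spanD.
  rewrite exprD -mulrA [_ * (polf q * s)]mulrCA; apply: ideal_span_img0M (inv_img0_phi _) _.
  by apply: ideal_spanM => //; exact: orbit_ideal_fun_point.
by rewrite addnC exprD -mulrA; apply: ideal_span_img0M (inv_img0_phi _) _.
Qed.

Lemma ideal_span_loc01 x : ideal_span point_ideal_fun inv_img0 x ->
  exists N, ideal_span point_ideal_fun stab_inv_img1 (polf phi ^+ N * x).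
Proof.
elim=> [|q s x' mq Is _ [N IN]]; first by exists 0; rewrite mulr0; exact: ideal_span0.
have [N' sN'] := inv_img0_loc1 Is; exists (N + N')%N; rewrite mulrDr; apply: ideal_spanD.
  rewrite exprD -mulrA [_ * (polf q * s)]mulrCA; apply: ideal_span_stab1M (stab_inv_img1_phi _) _.
  exact: ideal_spanM.
by rewrite addnC exprD -mulrA; apply: ideal_span_stab1M (stab_inv_img1_phi _) _.
Qed.

Lemma ideal_span_phiE N x : inv_img0 x ->
  ideal_span point_ideal_fun inv_img0 (polf phi ^+ N * x - const_fun (phi b ^+ N) * x).
Proof.
move=> Ix; rewrite -pliftX; apply: (ideal_span_eval (q := fun v => phi v ^+ N)) => //.
  exact: is_polX.
by move=> w v W0w; rewrite phi_inv.
Qed.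

Lemma ideal_span_const_cancel a x : a != 0 -> ideal_span point_ideal_fun inv_img0 (const_fun a * x) -> ideal_span point_ideal_fun inv_img0 x.
Proof.
move=> a0 Iax; rewrite -[x]mul1r -(const_funV a0) -mulrA.
by apply: ideal_span_img0M => //; exact: inv_img0_const.
Qed.

(* The graph of reduction at b: a power of phi brings z into the invariants for
   W0, where phi is congruent to the nonzero constant phi b. *)
Definition local_class z x := exists N, inv_img0 (polf phi ^+ N * z) /\
  ideal_span point_ideal_fun inv_img0 (polf phi ^+ N * z - const_fun (phi b ^+ N) * x).

Lemma local_class_ge z x N N' : inv_img0 x -> (N <= N')%N -> inv_img0 (polf phi ^+ N * z) ->
  ideal_span point_ideal_fun inv_img0 (polf phi ^+ N * z - const_fun (phi b ^+ N) * x) ->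
  inv_img0 (polf phi ^+ N' * z) /\
  ideal_span point_ideal_fun inv_img0 (polf phi ^+ N' * z - const_fun (phi b ^+ N') * x).
Proof.
move=> Ix NN' Iz IN.
have E : polf phi ^+ N' = polf phi ^+ (N' - N) * polf phi ^+ N.
  by rewrite -exprD subnK.
split; first by rewrite E -mulrA; exact: inv_img0M (inv_img0_phi _) Iz.
have E' : const_fun (phi b ^+ N') = const_fun (phi b ^+ (N' - N)) * const_fun (phi b ^+ N).
  by rewrite -const_funM -exprD subnK.
have -> : polf phi ^+ N' * z - const_fun (phi b ^+ N') * x =
  polf phi ^+ (N' - N) * (polf phi ^+ N * z - const_fun (phi b ^+ N) * x)
  + (polf phi ^+ (N' - N) * (const_fun (phi b ^+ N) * x) -
     const_fun (phi b ^+ (N' - N)) * (const_fun (phi b ^+ N) * x)).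
  by rewrite E E'; ring.
apply: ideal_spanD; first exact: ideal_span_img0M (inv_img0_phi _) _.
by apply: ideal_span_phiE; exact: inv_img0M (inv_img0_const _) Ix.
Qed.

Lemma local_class_total z : inv_img1 z -> exists2 x, inv_img0 x & local_class z x.
Proof.
move=> Iz; have [N IN] := stab_inv_img1_loc0 (inv_img1_stab Iz).
exists (const_fun (phi b ^+ N)^-1 * (polf phi ^+ N * z)); first exact: inv_img0M (inv_img0_const _) IN.
exists N; split=> //; rewrite mulrA -const_funM mulfV ?expf_neq0 // const_fun1 mul1r subrr.
exact: ideal_span0.
Qed.

Lemma local_classB z x z' x' : inv_img0 x -> inv_img0 x' -> local_class z x -> local_class z' x' ->
  local_class (z - z') (x - x').
Proof.
move=> Ix Ix' [N [iN jN]] [N' [iN' jN']]; exists (maxn N N').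
have [i j] := local_class_ge Ix (leq_maxl N N') iN jN.
have [i' j'] := local_class_ge Ix' (leq_maxr N N') iN' jN'.
split; first by rewrite mulrBr; exact: inv_img0B.
by have := ideal_spanB0 j j'; congr (ideal_span _ _ _); ring.
Qed.

Lemma local_classM z x z' x' : inv_img0 x -> inv_img0 x' -> local_class z x -> local_class z' x' ->
  local_class (z * z') (x * x').
Proof.
move=> Ix Ix' [N [iN jN]] [N' [iN' jN']]; exists (N + N')%N.
have E : polf phi ^+ (N + N') * (z * z') = (polf phi ^+ N * z) * (polf phi ^+ N' * z').
  by rewrite exprD; ring.
split; first by rewrite E; exact: inv_img0M.
have -> : polf phi ^+ (N + N') * (z * z') - const_fun (phi b ^+ (N + N')) * (x * x') =
   (polf phi ^+ N' * z') * (polf phi ^+ N * z - const_fun (phi b ^+ N) * x)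
   + (const_fun (phi b ^+ N) * x) * (polf phi ^+ N' * z' - const_fun (phi b ^+ N') * x').
  by rewrite E exprD const_funM; ring.
apply: ideal_spanD; apply: ideal_span_img0M => //; exact: inv_img0M (inv_img0_const _) Ix.
Qed.

Lemma local_class_const a : local_class (const_fun a) (const_fun a).
Proof.
by exists 0; rewrite !expr0 !mul1r subrr; split; [exact: inv_img0_const | exact: ideal_span0].
Qed.

(** Since m(b) lies in the ideal of b for W_b, some phi^N z lies in the latter; it is congruent
    there to a nonzero multiple of x. *)
Lemma local_class_ideal z x : inv_img0 x -> local_class z x -> ideal_span orbit_ideal_fun inv_img1 z ->
  ideal_span point_ideal_fun inv_img0 x.
Proof.
move=> Ix [N [iN jN]] Iz.
have [N' jN'] : exists N, ideal_span point_ideal_fun inv_img0 (polf phi ^+ N * z).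
  apply: ideal_span_loc10; rewrite -[z]mul1r.
  by apply: ideal_span_mul Iz => s Is; rewrite mul1r; exact: inv_img1_stab.
have [_ j] := local_class_ge Ix (leq_addr N' N) iN jN.
have j' : ideal_span point_ideal_fun inv_img0 (polf phi ^+ (N + N') * z).
  by rewrite exprD -mulrA; exact: ideal_span_img0M (inv_img0_phi _) _.
apply: (@ideal_span_const_cancel (phi b ^+ (N + N'))); first exact: expf_neq0.
by have := ideal_spanB0 j' j; rewrite opprB addrC subrK.
Qed.

(** * Traces, and the descent from the stabilizer to W *)

Definition shift_fun (w : G) (f : F) : F := f \o point_act w.

Lemma shift_funM w f g : shift_fun w (f * g) = shift_fun w f * shift_fun w g.
Proof. by []. Qed.
Lemma shift_plift w q : shift_fun w (polf q) = polf (fun v => q (h (sgval w) *m v)).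
Proof. by []. Qed.
Lemma shift_inv A w f : inv_fun A f -> sgval w \in A -> shift_fun w f = f.
Proof. by move=> fi Aw; apply/funext => p; rewrite /shift_fun /= fi. Qed.

Lemma dunkl_img_shift w f : Q1 f -> Q1 (shift_fun w f).
Proof.
have gw (u : G) : dunkl_img M1 (xg u).
  have -> : u = cincl (subg (cgrp d1) (sgval u)).
    by apply: val_inj; rewrite /= sgval_cincl subgK // grp1 subgP.
  exact: dunkl_img_w.
move=> qf; have -> : xf (shift_fun w f) = xg w^-1%g * xf f * xg w.
  by rewrite xgrp_xfun -mulrA -xgrpM mulVg xgrp1 mulr1 invgK.
by apply: dunkl_imgM => //; apply: dunkl_imgM.
Qed.

Definition trace_over (A : {set gT}) (f : F) : F := \sum_(w : G | sgval w \in A) shift_fun w f.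

Lemma trace_overD A f g : trace_over A (f + g) = trace_over A f + trace_over A g.
Proof. by rewrite -big_split. Qed.
Lemma trace_over0 A : trace_over A 0 = 0.
Proof. by apply: big1. Qed.

Lemma trace_over_mull A f g : inv_fun A f -> trace_over A (f * g) = f * trace_over A g.
Proof.
move=> fi; rewrite mulr_sumr; apply: eq_bigr => w Aw.
by rewrite shift_funM (shift_inv fi).
Qed.

Lemma trace_over_inv (A : {group gT}) f : inv_fun A (trace_over A f).
Proof.
move=> u p Au; rewrite /trace_over !fct_sumE [RHS](reindex_inj (mulIg u)) /=.
apply: eq_big => w; first by rewrite groupMr.
by move=> _; rewrite /shift_fun /= point_actM.
Qed.

Lemma dunkl_img_trace A f : Q1 f -> Q1 (trace_over A f).
Proof.
move=> qf; rewrite /trace_over rmorph_sum; apply: dunkl_img_sum => w _; exact: dunkl_img_shift.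
Qed.

Lemma inv_funS (A B : {set gT}) f : A \subset B -> inv_fun B f -> inv_fun A f.
Proof. by move=> AB fi w p Aw; apply: fi; exact: (fintype.subsetP AB). Qed.

Local Notation tr := (trace_over W).
Local Notation tr0 := (trace_over W0).

(** The trace is linear over W-invariants, hence passes through the generators of m(b) and acts on
    the coefficients alone. *)
Lemma ideal_span_trace x : ideal_span orbit_ideal_fun (fun f => Q1 f) x -> ideal_span orbit_ideal_fun inv_img1 (tr x).
Proof.
apply: ideal_span_mono => [|y z|q s mq Qs]; [exact: trace_over0 | exact: trace_overD |].
have [_ qs _] := mq; rewrite trace_over_mull; last exact: plift_inv_fun.
by apply: ideal_spanM => //; split; [exact: dunkl_img_trace | exact: trace_over_inv].
Qed.

Lemma ideal_span_trace0 x : ideal_span orbit_ideal_fun (fun f => Q1 f) x -> ideal_span orbit_ideal_fun stab_inv_img1 (tr0 x).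
Proof.
apply: ideal_span_mono => [|y z|q s mq Qs]; [exact: trace_over0 | exact: trace_overD |].
have [_ qs _] := mq; rewrite trace_over_mull.
  by apply: ideal_spanM => //; split; [exact: dunkl_img_trace | exact: trace_over_inv].
by apply: plift_inv_fun; exact: mx_stableS W0_sub qs.
Qed.

Definition stab_card : nat := #|[pred w : G | sgval w \in W0]|.

Lemma stab_card_neq0 : stab_card%:R != 0 :> C.
Proof.
rewrite pnatr_eq0 -lt0n; apply/card_gt0P; exists 1%g.
by rewrite inE; exact: group1.
Qed.

Lemma trace_over_const f : inv_fun W0 f -> tr0 f = const_fun stab_card%:R * f.
Proof.
move=> fi; rewrite /trace_over (eq_bigr (fun=> f)); last first.
  by move=> w W0w; rewrite (shift_inv fi).
rewrite sumr_const; apply/funext => p; rewrite natmulfctE mulrfctE /const_fun /plift.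
by rewrite polyC_natr mulr_natl.
Qed.

(* Cayley-Hamilton: l is a root of \prod_u (X - l \o u), whose coefficients are
   W-invariant and, but for the leading one, vanish at b. *)
Lemma ideal_span_nilpotent l : is_pol l -> (forall u : G, l (h (sgval u) *m b) = 0) ->
  ideal_span orbit_ideal_fun (fun f => Q1 f) (polf (fun v => l v ^+ #|G|)).
Proof.
move=> pl lb; pose chi v : {poly C} := \prod_(u : G) ('X - (l (h (sgval u) *m v))%:P).
have chi_pol i : is_pol (fun v => (chi v)`_i).
  rewrite /chi; elim: (index_enum _) i => [|u r IH] i.
    by apply: eq_is_pol (is_pol_cst _ (1 : {poly C})`_i) => v; rewrite big_nil.
  (* The coefficients of (X - a) Q are Q_(i-1) - a Q_i, with 0 for the absent Q_(-1). *)
  apply: (@eq_is_pol _ _ (fun v => (if i == 0 then 0 else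
      (\prod_(u <- r) ('X - (l (h (sgval u) *m v))%:P))`_i.-1)
    - l (h (sgval u) *m v) * (\prod_(u <- r) ('X - (l (h (sgval u) *m v))%:P))`_i)).
    by move=> v; rewrite big_cons mulrBl coefB coefXM coefCM.
  apply: is_polB; last by apply: is_polM; [exact: is_pol_mulmx pl | exact: IH].
  by case: (i == 0); [exact: is_pol_cst | exact: IH].
have chi_inv i : mx_stable W (fun v => (chi v)`_i).
  move=> w v Ww; suff -> : chi (h w *m v) = chi v by [].
  rewrite /chi [RHS](reindex_inj (mulIg (subg W w))) /=.
  by apply: eq_bigr => u _; rewrite mulmxA -repr_mxM ?subgP // subgK.
have chi_size v : size (chi v) = #|G|.+1.
  by rewrite /chi size_prod_XsubC cardE enumT.
have chi_b i : (i < #|G|)%N -> (chi b)`_i = 0.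
  move=> iG; have -> : chi b = 'X^#|G|.
    rewrite /chi (eq_bigr (fun=> 'X)); first by rewrite prodr_const.
    by move=> u _; rewrite lb subr0.
  by rewrite coefXn ltn_eqF.
have -> : polf (fun v => l v ^+ #|G|) =
    \sum_(i < #|G|) polf (fun v => (chi v)`_i) * polf (fun v => - l v ^+ i).
  apply/funext => p; rewrite fct_sumE.
  have chi0 : (chi (base p)).[l (base p)] = 0.
    rewrite /chi horner_prod (bigD1 1%g) //= !hornerE repr_mx1 mul1mx subrr.
    by rewrite mul0r.
  have chiN : (chi (base p))`_#|G| = 1.
    have : lead_coef (chi (base p)) = 1.
      by apply/eqP; rewrite -[_ == _]/(_ \is monic) monic_prod_XsubC.
    by rewrite /lead_coef chi_size.
  move: chi0; rewrite horner_coef chi_size big_ord_recr /= chiN mul1r => /eqP.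
  rewrite addrC addr_eq0 => /eqP E; rewrite /plift E -sumrN rmorph_sum.
  by apply: eq_bigr => i _; rewrite mulrfctE -polyCM mulrN.
apply: ideal_span_sum => i _; apply: ideal_spanM.
  by split; [exact: chi_pol | exact: chi_inv | exact: chi_b].
apply: dunkl_img_pol; apply: (@eq_is_pol _ _ (fun v => 0 - l v ^+ i)); first by move=> v; rewrite sub0r.
by apply: is_polB; [exact: is_pol_cst | exact: is_polX].
Qed.

Variable bump : V -> C.
Hypotheses (bump_pol : is_pol bump) (bump_inv : mx_stable W0 bump) (bump_b : bump b != 0).
Hypothesis bump_orbit : forall w, w \in W -> w \notin W0 -> bump (h w *m b) = 0.

Definition sharp (v : V) : C := bump v ^+ #|G|.

Lemma sharp_pol : is_pol sharp. Proof. exact: is_polX. Qed.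
Lemma sharp_inv : mx_stable W0 sharp.
Proof. by move=> w v W0w; rewrite /sharp bump_inv. Qed.
Lemma sharp_b : sharp b != 0. Proof. exact: expf_neq0. Qed.
Lemma sharp_orbit w : w \in W -> w \notin W0 -> sharp (h w *m b) = 0.
Proof.
move=> Ww W0w; have G0 : (0 < #|G|)%N by apply/card_gt0P; exists 1%g.
by rewrite /sharp bump_orbit // expr0n gtn_eqF.
Qed.

(** The product of [bump] and its translate by w vanishes on the whole orbit: at u b the first
    factor does so if u is not in W_b, and otherwise the second, because w u is not in W_b. *)
Lemma sharp_shift w : sgval w \notin W0 ->
  ideal_span orbit_ideal_fun (fun f => Q1 f) (polf sharp * shift_fun w (polf sharp)).
Proof.
move=> W0w; rewrite shift_plift -pliftM.
have -> : (fun v => sharp v * sharp (h (sgval w) *m v)) =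
          (fun v => (bump v * bump (h (sgval w) *m v)) ^+ #|G|).
  by apply/funext => v; rewrite exprMn.
apply: ideal_span_nilpotent => [|u].
  by apply: is_polM => //; exact: is_pol_mulmx.
have [W0u|W0u] := boolP (sgval u \in W0); last by rewrite bump_orbit ?subgP // mul0r.
have -> : bump (h (sgval w) *m (h (sgval u) *m b)) = 0; last by rewrite mulr0.
rewrite mulmxA -repr_mxM ?subgP //; apply: bump_orbit; first by rewrite groupM ?subgP.
by apply: contra W0w => W0wu; rewrite -(mulgK (sgval u) (sgval w)) groupM ?groupV.
Qed.

(** In the trace, the terms from W_b all equal [sharp] times s. Every other term, once multiplied by
    [sharp], contains a product of [sharp] with a translate, which [sharp_shift] controls. *)
Lemma sharp_trace s : stab_inv_img1 s -> ideal_span orbit_ideal_fun stab_inv_img1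
  (polf sharp * tr (polf sharp * s) - const_fun stab_card%:R * (polf sharp * (polf sharp * s))).
Proof.
move=> Is; have [Qs si] := Is; have V1 := stab_inv_img1_pol sharp_pol sharp_inv.
have [_ Vsi] := stab_inv_img1M V1 Is.
set Y := _ - _.
have YE : Y = \sum_(w : G | sgval w \notin W0)
     (polf sharp * shift_fun w (polf sharp)) * shift_fun w s.
  rewrite /Y {1}/trace_over (bigID (fun w : G => sgval w \in W0)) /= mulrDr.
  rewrite (eq_bigl (fun w : G => sgval w \in W0)); last first.
    by move=> w; rewrite subgP.
  rewrite -/(trace_over W0 _) trace_over_const // mulrCA addrAC subrr add0r mulr_sumr.
  by apply: eq_big => w; [rewrite subgP | rewrite shift_funM mulrA].
have YQ : ideal_span orbit_ideal_fun (fun f => Q1 f) Y.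
  rewrite YE; apply: ideal_span_sum => w W0w; rewrite mulrC.
  apply: ideal_span_mul (sharp_shift W0w) => t Qt; apply: dunkl_img_xfunM => //.
  exact: dunkl_img_shift.
have Yi : inv_fun W0 Y.
  apply: inv_funB; apply: inv_funM.
  - exact: plift_inv_fun sharp_inv.
  - by apply: inv_funS W0_sub _; exact: trace_over_inv.
  - exact: plift_inv_fun.
  - by apply: inv_funM => //; exact: plift_inv_fun sharp_inv.
(* Averaging over W_b does not change Y, but makes the coefficients in its expression
   W_b-invariant. *)
have -> : Y = const_fun stab_card%:R^-1 * tr0 Y.
  by rewrite trace_over_const // mulrA const_funV ?mul1r // stab_card_neq0.
apply: ideal_span_stab1M; last exact: ideal_span_trace0.
by apply: inv_img1_stab; exact: inv_img1_const.
Qed.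

(* This expresses that h/W0 -> h/W is unramified at b. *)
Lemma sharp_m0 q : point_ideal_fun q -> ideal_span orbit_ideal_fun stab_inv_img1 (polf sharp * (polf sharp * polf q)).
Proof.
move=> [pq qs qb].
have Iq := stab_inv_img1_pol pq qs; have V1 := stab_inv_img1_pol sharp_pol sharp_inv.
(* The trace of [sharp] times q lies in m(b): on W_b q(b) = 0 applies, and elsewhere [sharp]
   vanishes at w b. [sharp_trace] then compares it with q itself. *)
pose T v := \sum_(w : G) sharp (h (sgval w) *m v) * q (h (sgval w) *m v).
have TE : tr (polf sharp * polf q) = polf T.
  apply/funext => p; rewrite /trace_over fct_sumE /plift /T rmorph_sum.
  by apply: eq_big => w; [exact: subgP | rewrite /= polyCM].
have mT : orbit_ideal_fun T.
  split.
  - apply: is_pol_sum => w _; apply: is_polM; apply: is_pol_mulmx => //.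
    exact: sharp_pol.
  - move=> w v Ww; rewrite /T [RHS](reindex_inj (mulIg (subg W w))) /=.
    by apply: eq_bigr => u _; rewrite mulmxA -repr_mxM ?subgP // subgK.
  - apply: big1 => w _; have [W0w|W0w] := boolP (sgval w \in W0).
      by rewrite qs // qb mulr0.
    by rewrite sharp_orbit ?subgP // mul0r.
have K := sharp_trace Iq; rewrite TE in K.
rewrite -[_ * _]mul1r -(const_funV stab_card_neq0) -mulrA.
apply: ideal_span_stab1M; first by apply: inv_img1_stab; exact: inv_img1_const.
have -> : const_fun stab_card%:R * (polf sharp * (polf sharp * polf q)) =
    polf T * polf sharp +
    const_fun (-1) * (polf sharp * polf T - const_fun stab_card%:R * (polf sharp * (polf sharp * polf q))).
  have -> : const_fun (-1) = -1.
    by apply/funext => p; rewrite /const_fun /plift polyCN.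
  by ring.
apply: ideal_spanD; first exact: ideal_spanM.
by apply: ideal_span_stab1M => //; apply: inv_img1_stab; exact: inv_img1_const.
Qed.

(** A power of phi moves the hypothesis into the W_b-invariants of Q(W), and two factors [sharp]
    turn generators vanishing at b into elements of m(b) times coefficients. As z is W-invariant,
    the trace over W then gives a z in m(b) Z(W) with a(b) nonzero, and a is congruent to a(b)
    modulo m(b). *)
Lemma local_class_ideal_inv z x : inv_img0 x -> inv_img1 z -> local_class z x ->
  ideal_span point_ideal_fun inv_img0 x -> ideal_span orbit_ideal_fun inv_img1 z.
Proof.
move=> Ix Iz [N [iN jN]] Jx.
have [K jK] : exists K, ideal_span point_ideal_fun stab_inv_img1 (polf phi ^+ K * z).
  have [|N' jN'] := @ideal_span_loc01 (polf phi ^+ N * z).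
    rewrite -[_ * z](subrK (const_fun (phi b ^+ N) * x)); apply: ideal_spanD => //.
    by apply: ideal_span_img0M => //; exact: inv_img0_const.
  by exists (N' + N)%N; rewrite exprD -mulrA.
have jV : ideal_span orbit_ideal_fun stab_inv_img1 (polf sharp * (polf sharp * (polf phi ^+ K * z))).
  apply: (@ideal_span_mono _ _ _ _ (fun x => polf sharp * (polf sharp * x))) jK.
  - by rewrite !mulr0.
  - by move=> u v; rewrite !mulrDr.
  - move=> q s mq Is; have -> : polf sharp * (polf sharp * (polf q * s)) =
      s * (polf sharp * (polf sharp * polf q)) by ring.
    by apply: ideal_span_stab1M => //; exact: sharp_m0.
pose kappa v := sharp v * (sharp v * phi v ^+ K).
have kappa_pol : is_pol kappa.
  by apply: is_polM; [exact: sharp_pol | apply: is_polM; [exact: sharp_pol | exact: is_polX]].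
pose a v := \sum_(w : G) kappa (h (sgval w) *m v).
have a_pol : is_pol a by apply: is_pol_sum => w _; exact: is_pol_mulmx.
have a_inv : mx_stable W a.
  move=> w v Ww; rewrite /a [RHS](reindex_inj (mulIg (subg W w))) /=.
  by apply: eq_bigr => u _; rewrite mulmxA -repr_mxM ?subgP // subgK.
have ab : a b = stab_card%:R * kappa b.
  rewrite /a (bigID (fun w : G => sgval w \in W0)) /= [X in _ + X]big1 ?addr0.
    rewrite (eq_bigr (fun=> kappa b)) ?sumr_const ?mulr_natl // => w W0w.
    by rewrite /kappa sharp_inv // phi_inv.
  by move=> w W0w; rewrite /kappa sharp_orbit ?subgP // mul0r.
have ab0 : a b != 0.
  by rewrite ab !mulf_neq0 ?stab_card_neq0 ?sharp_b ?expf_neq0.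
have ja : ideal_span orbit_ideal_fun inv_img1 (polf a * z).
  have -> : polf a * z = tr (polf sharp * (polf sharp * (polf phi ^+ K * z))).
    have -> : polf sharp * (polf sharp * (polf phi ^+ K * z)) = z * polf kappa.
      by rewrite !pliftM pliftX; ring.
    rewrite trace_over_mull; last by case: Iz.
    rewrite mulrC; congr (_ * _); apply/funext => p.
    rewrite /trace_over fct_sumE /plift /a rmorph_sum.
    by apply: eq_bigl => w; rewrite subgP.
  apply: ideal_span_trace.
  have -> : polf sharp * (polf sharp * (polf phi ^+ K * z)) =
     1 * (polf sharp * (polf sharp * (polf phi ^+ K * z))) by rewrite mul1r.
  by apply: ideal_span_mul jV => s [Qs _]; rewrite mul1r.
have jb : ideal_span orbit_ideal_fun inv_img1 (const_fun (a b) * z).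
  have -> : const_fun (a b) * z = polf a * z + polf (fun v => a b - a v) * z.
    by rewrite pliftB /const_fun; ring.
  apply: ideal_spanD => //; apply: ideal_spanM => //; split; last by rewrite subrr.
    by apply: is_polB => //; exact: is_pol_cst.
  by move=> w v Ww; rewrite a_inv.
rewrite -[z]mul1r -(const_funV ab0) -mulrA; apply: ideal_span_img1M => //; exact: inv_img1_const.
Qed.

(** With s = phi^N x, [sharp_trace] shows that the trace of [sharp] times s is, in the fibre, the
    multiple of x by |W_b| sharp(b) phi(b)^N; z is this trace divided by that constant. *)
Lemma local_class_surj x : inv_img0 x -> exists2 z, inv_img1 z & local_class z x.
Proof.
move=> Ix; have [N Is] := inv_img0_loc1 Ix; set s := _ * x in Is.
have V1 := stab_inv_img1_pol sharp_pol sharp_inv; have V0 := inv_img0_pol sharp_pol sharp_inv.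
pose Z := tr (polf sharp * s).
have IZ : inv_img1 Z.
  split; last exact: trace_over_inv.
  by apply: dunkl_img_trace; apply: dunkl_img_xfunM; [case: V1 | case: Is].
have [K jK] := ideal_span_loc10 (sharp_trace Is).
have [K' iK'] := stab_inv_img1_loc0 (inv_img1_stab IZ).
(* K' brings the trace into Z(W_b), and K brings the error term of [sharp_trace] into the ideal
   there. *)
pose T := (K' + K)%N.
have IT : inv_img0 (polf phi ^+ T * Z).
  by rewrite /T addnC exprD -mulrA; apply: inv_img0M iK'; exact: inv_img0_phi.
have a0 : stab_card%:R * sharp b * phi b ^+ N != 0 :> C.
  by rewrite !mulf_neq0 ?stab_card_neq0 ?sharp_b ?expf_neq0.
set a := _ * phi b ^+ N in a0; pose z := const_fun a^-1 * Z.
exists z; first exact: inv_img1M (inv_img1_const _) IZ.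
exists T; split; first by rewrite mulrCA; exact: inv_img0M (inv_img0_const _) IT.
(* The extra factor sharp(b) matches the [sharp] that multiplies the trace in [sharp_trace]. The
   congruences below replace each [sharp] and phi by its value at b. *)
apply: (@ideal_span_const_cancel (sharp b * a)); first by rewrite mulf_neq0 ?sharp_b.
have IX : inv_img0 (polf phi ^+ (T + N) * x) by exact: inv_img0M (inv_img0_phi _) Ix.
have j1 := ideal_span_eval sharp_pol sharp_inv IT.
have j2 : ideal_span point_ideal_fun inv_img0 (polf phi ^+ T *
   (polf sharp * Z - const_fun stab_card%:R * (polf sharp * (polf sharp * s)))).
  by rewrite /T exprD -mulrA; exact: ideal_span_img0M (inv_img0_phi _) jK.
have j3 : ideal_span point_ideal_fun inv_img0 (polf sharp * (polf sharp * (polf phi ^+ (T + N) * x))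
      - const_fun (sharp b) * (const_fun (sharp b) * (polf phi ^+ (T + N) * x))).
  have -> : forall t : F, polf sharp * (polf sharp * t) - const_fun (sharp b) * (const_fun (sharp b) * t)
    = polf sharp * (polf sharp * t - const_fun (sharp b) * t)
      + const_fun (sharp b) * (polf sharp * t - const_fun (sharp b) * t) by move=> t; ring.
  by apply: ideal_spanD; apply: ideal_span_img0M (ideal_span_eval sharp_pol sharp_inv IX) => //;
    exact: inv_img0_const.
have j4 := ideal_span_phiE (T + N) Ix.
have aK : const_fun (sharp b * a) * (polf phi ^+ T * z) = const_fun (sharp b) * (polf phi ^+ T * Z).
  rewrite /z [polf phi ^+ T * (_ * _)]mulrCA const_funM -mulrA [const_fun a * _]mulrA.
  by rewrite [const_fun a * _]mulrC const_funV // mul1r.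
rewrite mulrBr aK.
have -> : const_fun (sharp b * a) * (const_fun (phi b ^+ T) * x) =
   const_fun stab_card%:R * (const_fun (sharp b) * (const_fun (sharp b) * (const_fun (phi b ^+ (T + N)) * x))).
  by rewrite /a exprD !const_funM; ring.
have j5 := ideal_span_img0M (inv_img0_const stab_card%:R) j3.
have j6 := ideal_span_img0M (inv_img0_const stab_card%:R)
   (ideal_span_img0M (inv_img0_const (sharp b)) (ideal_span_img0M (inv_img0_const (sharp b)) j4)).
have := ideal_spanD (ideal_spanD (ideal_spanB0 j2 j1) j5) j6.
congr (ideal_span _ _ _); rewrite /s [polf phi ^+ (T + N)]exprD; ring.
Qed.

End Fibres.

(** * Quotient rings matched by a relation between representatives *)

Section RelationIso.
Variables (A B : comPzRingType) (rA : set A) (rB : set B) (L : A -> B -> Prop).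
Hypotheses (L_total : forall x, exists y, L x y) (L_surj : forall y, exists x, L x y)
  (L1 : L 1 1) (LB : forall x y x' y', L x y -> L x' y' -> L (x - x') (y - y'))
  (LM : forall x y x' y', L x y -> L x' y' -> L (x * x') (y * y'))
  (L_ideal : forall x y, L x y -> ideal_gen rA x <-> ideal_gen rB y).

Lemma rel_eq x y x' y' : L x y -> L x' y' -> rpi rA x = rpi rA x' <-> rpi rB y = rpi rB y'.
Proof. by move=> Lxy Lxy'; rewrite !rpiE; apply: L_ideal; exact: LB. Qed.

Definition rel_fun (u : rquot rA) : rquot rB :=
  rpi rB (sval (cid (L_total (sval (cid (rpi_surj u)))))).

Definition rel_inv (v : rquot rB) : rquot rA :=
  rpi rA (sval (cid (L_surj (sval (cid (rpi_surj v)))))).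

Lemma rel_funE x y : L x y -> rel_fun (rpi rA x) = rpi rB y.
Proof.
rewrite /rel_fun; case: (cid (rpi_surj _)) => x' /= E.
by case: cid => y' /= L' Lxy; apply/(rel_eq L' Lxy).
Qed.

Lemma rel_invE x y : L x y -> rel_inv (rpi rB y) = rpi rA x.
Proof.
rewrite /rel_inv; case: (cid (rpi_surj _)) => y' /= E.
by case: cid => x' /= L' Lxy; apply/(rel_eq L' Lxy).
Qed.

Lemma rel_funK : cancel rel_fun rel_inv.
Proof.
move=> u; have [x ->] := rpi_surj u; have [y Lxy] := L_total x.
by rewrite (rel_funE Lxy) (rel_invE Lxy).
Qed.

Lemma rel_invK : cancel rel_inv rel_fun.
Proof.
move=> v; have [y ->] := rpi_surj v; have [x Lxy] := L_surj y.
by rewrite (rel_invE Lxy) (rel_funE Lxy).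
Qed.

Lemma rel_fun_zmod_morphism : zmod_morphism rel_fun.
Proof.
move=> u u'; have [x ->] := rpi_surj u; have [x' ->] := rpi_surj u'.
have [y Lxy] := L_total x; have [y' Lxy'] := L_total x'.
by rewrite -rmorphB (rel_funE (LB Lxy Lxy')) (rel_funE Lxy) (rel_funE Lxy') rmorphB.
Qed.

Lemma rel_fun_monoid_morphism : monoid_morphism rel_fun.
Proof.
split=> [|u u']; first exact: (rel_funE L1).
have [x ->] := rpi_surj u; have [x' ->] := rpi_surj u'.
have [y Lxy] := L_total x; have [y' Lxy'] := L_total x'.
by rewrite -rmorphM (rel_funE (LM Lxy Lxy')) (rel_funE Lxy) (rel_funE Lxy') rmorphM.
Qed.

HB.instance Definition _ := GRing.isZmodMorphism.Build
  (rquot rA) (rquot rB) rel_fun rel_fun_zmod_morphism.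
HB.instance Definition _ := GRing.isMonoidMorphism.Build
  (rquot rA) (rquot rB) rel_fun rel_fun_monoid_morphism.

Lemma rel_inv_zmod_morphism : zmod_morphism rel_inv.
Proof. by move=> u v; apply: (can_inj rel_funK); rewrite rmorphB /= !rel_invK. Qed.

Lemma rel_inv_monoid_morphism : monoid_morphism rel_inv.
Proof.
split=> [|u v]; apply: (can_inj rel_funK); first by rewrite rmorph1 rel_invK.
by rewrite rmorphM /= !rel_invK.
Qed.

HB.instance Definition _ := GRing.isZmodMorphism.Build
  (rquot rB) (rquot rA) rel_inv rel_inv_zmod_morphism.
HB.instance Definition _ := GRing.isMonoidMorphism.Build
  (rquot rB) (rquot rA) rel_inv rel_inv_monoid_morphism.

Lemma rel_iso : exists (f : {rmorphism rquot rA -> rquot rB})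
    (g : {rmorphism rquot rB -> rquot rA}),
  [/\ cancel f g, cancel g f & forall x y, L x y -> f (rpi rA x) = rpi rB y].
Proof.
exists (rel_fun : {rmorphism _ -> _}), (rel_inv : {rmorphism _ -> _}).
split; [exact: rel_funK | exact: rel_invK | exact: rel_funE].
Qed.

End RelationIso.

(** * The centre as a ring of invariant functions *)

Section CentreFunctions.
Variables (C : numFieldType) (gT : finGroupType) (W : {group gT}) (n : nat).
Variable h : mx_representation C W n.
Hypothesis hfaith : forall w, w \in W -> h w = 1%:M -> w = 1%g.
Local Notation V := 'cV[C]_n.
Local Notation k := {poly C}.
Local Notation F := (hpoint h -> k).
Local Notation xf := (@xfun [subg W] (hpoint h) (point_action h) k).
Local Notation polf := (@plift _ _ _ _ h).
Variables (d : cherednik_datum h) (M : cherednik_model d) (b b' : V).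
Hypothesis bE : b' = b - cshift d.
Local Notation W0 := (cgrp d).
Local Notation cdunkl := (@cdunkl _ _ _ _ _ _ M).

Definition centre_fun (z : center M) : F := fun p => cdunkl (val z) 1%g p.

Definition inv_ring (f : F) := dunkl_img M (xf f) /\ inv_fun W0 f.

Definition point_ideal_pol (q : V -> C) := [/\ is_pol q, mx_stable h W0 q & q b = 0].

(** The polynomials are in the variable v - shift, so that the point is b' = b - shift: it is b for
    W and 0 for W_b. *)
Definition orbit_pol (p : mpoly n C) :=
  (forall w v, w \in W0 -> pfun p (crep d w *m v) = pfun p v) /\
  (forall w, w \in W0 -> pfun p (crep d w *m b') = 0).

Definition fibre_rel : set (center M) := [set z | exists2 p, orbit_pol p & val z = cpoly M p].

Lemma centre_funP z : cdunkl (val z) = xf (centre_fun z) /\ inv_fun W0 (centre_fun z).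
Proof.
case: z => z zC /=; have /asboolP zC' := zC; have [f E fi] := central_dunklP zC'.
have fE : centre_fun (Center zC) = f.
  by apply: (@xfun_inj _ _ (point_action h)); rewrite /centre_fun /= E;
   apply: crossed_ext => w p; rewrite /xfun eqxx mulr1n.
by rewrite fE.
Qed.

Lemma centre_fun_inv_ring z : inv_ring (centre_fun z).
Proof. by have [E fi] := centre_funP z; split=> //; exists (val z). Qed.

Lemma centre_fun_surj f : inv_ring f -> exists z, centre_fun z = f.
Proof.
move=> [[z E] fi]; have zC : z \in @central M by apply/asboolP; exact: (dunkl_central hfaith E fi).
exists (Center zC); apply/funext => p; rewrite /centre_fun /= E.
by rewrite /xfun eqxx mulr1n.
Qed.

Lemma centre_fun_inj : injective centre_fun.
Proof.
move=> z z' E; apply/val_inj/(cdunkl_inj hfaith).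
by rewrite (centre_funP z).1 (centre_funP z').1 E.
Qed.

Lemma centre_funB z z' : centre_fun (z - z') = centre_fun z - centre_fun z'.
Proof. by apply/funext => p; rewrite /centre_fun !rmorphB. Qed.

Lemma centre_funD z z' : centre_fun (z + z') = centre_fun z + centre_fun z'.
Proof. by apply/funext => p; rewrite /centre_fun !rmorphD. Qed.

Lemma centre_funM z z' : centre_fun (z * z') = centre_fun z * centre_fun z'.
Proof.
apply: (@xfun_inj _ _ (point_action h)); rewrite [RHS]rmorphM /=.
have [<- _] := centre_funP (z * z'); have [<- _] := centre_funP z.
by have [<- _] := centre_funP z'; rewrite !rmorphM.
Qed.

Lemma centre_fun0 : centre_fun 0 = 0.
Proof. by rewrite -(subrr 0) centre_funB subrr. Qed.

Lemma centre_fun1 : centre_fun 1 = 1.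
Proof. by apply/funext => p; rewrite /centre_fun !rmorph1 crossed1 eqxx. Qed.

Lemma centre_fun_cs z a : val z = cs M a -> centre_fun z = @const_fun _ _ _ _ h a.
Proof.
move=> E; apply/funext => p; rewrite /centre_fun E cdunkl_s /dunkl_scalar /xfun.
by rewrite eqxx mulr1n.
Qed.

Lemma centre_fun_cpoly z p : val z = cpoly M p ->
  centre_fun z = polf (fun v => pfun p (v - cshift d)).
Proof.
move=> E; apply/funext => q; rewrite /centre_fun E cdunkl_cpoly.
by rewrite /xfun eqxx mulr1n.
Qed.

Lemma orbit_pol_point_ideal p : orbit_pol p ->
  point_ideal_pol (fun v => pfun p (v - cshift d)).
Proof.
move=> [pi pb]; split.
- by apply: is_pol_shift; exists p.
- move=> w v W0w /=; rewrite -{1}(cshift_fix W0w) -(crepE W0w) -mulmxBr.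
  exact: pi.
- by have := pb 1%g (group1 _); rewrite repr_mx1 mul1mx bE.
Qed.

Lemma point_ideal_orbit_pol q : point_ideal_pol q ->
  exists2 p, orbit_pol p & forall v, pfun p (v - cshift d) = q v.
Proof.
move=> [pq qi qb]; have [p pE] := is_pol_shift (cshift d) pq.
exists p => [|v]; last by rewrite pE subrK.
split=> [w v W0w|w W0w]; rewrite !pE.
  by rewrite -{1}(cshift_fix W0w) -mulmxDr crepE // qi.
by rewrite -{1}(cshift_fix W0w) -mulmxDr bE subrK crepE // qi.
Qed.

Lemma inv_ring_M f g : inv_ring f -> inv_ring g -> inv_ring (f * g).
Proof. by move=> [qf fi] [qg gi]; split; [exact: dunkl_img_xfunM | exact: inv_funM]. Qed.

(** One direction tests the intersection defining [ideal_gen] on the preimage of the span. The other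
    is an induction on the span, in which coefficients and generators are lifted back to central
    elements. *)
Lemma ideal_gen_centre z :
  ideal_gen fibre_rel z <-> ideal_span point_ideal_pol inv_ring (centre_fun z).
Proof.
have [I0 IB IM] := ideal_genP fibre_rel; split=> [|Iz].
  move=> /(_ [set z | ideal_span point_ideal_pol inv_ring (centre_fun z)]); apply; split.
    split=> [|x y Ix Iy|a x c Ix] /=.
    - by rewrite centre_fun0; exact: ideal_span0.
    - rewrite centre_funB; apply: ideal_spanD => //.
      rewrite -[- _]mulN1r; apply: ideal_span_mul Iy => s Is.
      have -> : -1 = centre_fun (-1) :> F.
        by rewrite -[X in centre_fun X]sub0r centre_funB centre_fun0 centre_fun1 sub0r.
      by apply: inv_ring_M => //; exact: centre_fun_inv_ring.
    - rewrite !centre_funM mulrAC; apply: ideal_span_mul Ix => s Is.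
      by do 2?apply: inv_ring_M => //; exact: centre_fun_inv_ring.
  move=> x [p op E] /=; rewrite (centre_fun_cpoly E) -[X in ideal_span _ _ X]mulr1.
  apply: ideal_spanM; first exact: orbit_pol_point_ideal.
  rewrite -centre_fun1; exact: centre_fun_inv_ring.
suff [z' Iz' E] : exists2 z', ideal_gen fibre_rel z' & centre_fun z' = centre_fun z.
  by rewrite -(centre_fun_inj E).
move: (centre_fun z) Iz => f; elim=> [|q s x mq Is _ [z' Iz' <-]]; first by exists 0 => //; exact: centre_fun0.
have [p op pE] := point_ideal_orbit_pol mq; have [zs <-] := centre_fun_surj Is.
have [zq zqE] : exists zq : center M, val zq = cpoly M p.
  have zC : cpoly M p \in @central M.
    apply/asboolP; apply: (dunkl_central hfaith (cdunkl_cpoly M p)).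
    by move=> w v W0w; have [_ qi _] := mq; rewrite /plift /= !pE qi.
  by exists (Center zC).
have Izq : ideal_gen fibre_rel (zq * zs).
  by rewrite -[zq]mul1r; apply: IM => I [_ rI]; apply: rI; exists p.
exists (zq * zs + z').
  by rewrite -[z']opprK; apply: (IB) => //; rewrite -sub0r; exact: IB.
rewrite centre_funD centre_funM (centre_fun_cpoly zqE); congr (polf _ * _ + _).
exact/funext.
Qed.

End CentreFunctions.

Arguments fibre_rel {C gT W n h d} M b' z.

Theorem fibre_models_iso (C : numFieldType) (gT : finGroupType) (W : {group gT}) (n : nat)
    (h : mx_representation C W n) (d1 d0 : cherednik_datum h) (b : 'cV[C]_n)
    (M1 : cherednik_model d1) (M0 : cherednik_model d0) :
  (forall w, w \in W -> h w = 1%:M -> w = 1%g) ->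
  cgrp d1 = W :> {set gT} ->
  (forall w, (w \in cgrp d0) = (w \in W) && (h w *m b == b)) ->
  cpar d0 = cpar d1 -> croot d0 = croot d1 -> cshift d1 = 0 -> cshift d0 = b ->
  exists (f : {rmorphism rquot (fibre_rel M1 b) -> rquot (fibre_rel M0 0)})
         (g : {rmorphism rquot (fibre_rel M0 0) -> rquot (fibre_rel M1 b)}),
  [/\ cancel f g, cancel g f &
    forall a (z1 : center M1) (z0 : center M0), val z1 = cs M1 a -> val z0 = cs M0 a ->
      f (rpi (fibre_rel M1 b) z1) = rpi (fibre_rel M0 0) z0].
Proof.
move=> hf grp1 grp0 par01 root01 sh1 sh0.
have b1 : b = b - cshift d1 by rewrite sh1 subr0.
have b0 : 0 = b - cshift d0 by rewrite sh0 subrr.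
pose phi := comparison_fun d1 grp0.
have phi_pol : is_pol phi := comparison_fun_pol d1 grp0.
have phi_inv : mx_stable h (cgrp d0) phi.
  by move=> w v W0w; exact: (comparison_fun_inv d1 grp0).
have phi_b : phi b != 0 := comparison_fun_b grp1 grp0.
have loc01 f := @im0_im1_localized _ _ _ _ _ _ _ _ grp1 grp0 par01 root01 M1 M0 f.
have loc10 f := @im1_im0_localized _ _ _ _ _ _ _ _ grp1 grp0 par01 root01 M1 M0 f.
have [q [q_pol q_inv q_b q_orb]] := exists_bump grp0.
have q_stable : mx_stable h (cgrp d0) q by move=> w v; exact: q_inv.
(* [cgrp d1] is W only by hypothesis, so the notions attached to the datum are rewritten into those
   attached to W. *)
have I1E : inv_ring M1 = inv_img1 M1 by apply/funext => f; rewrite /inv_ring /inv_img1 grp1.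
have m1E : point_ideal_pol d1 b = orbit_ideal_fun h b.
  by apply/funext => p; rewrite /point_ideal_pol /orbit_ideal_fun grp1.
pose L (z : center M1) (x : center M0) := local_class b M0 phi (centre_fun z) (centre_fun x).
have I1z (z : center M1) : inv_img1 M1 (centre_fun z) by rewrite -I1E; exact: centre_fun_inv_ring.
have I0x (x : center M0) : inv_img0 M0 (centre_fun x) by exact: centre_fun_inv_ring.
have Lcs a z1 z0 : val z1 = cs M1 a -> val z0 = cs M0 a -> L z1 z0.
  by move=> E1 E0; rewrite /L (centre_fun_cs E1) (centre_fun_cs E0); exact: local_class_const.
have [f [g [fK gK fL]]] : exists (f : {rmorphism rquot (fibre_rel M1 b) -> rquot (fibre_rel M0 0)})
    (g : {rmorphism rquot (fibre_rel M0 0) -> rquot (fibre_rel M1 b)}),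
  [/\ cancel f g, cancel g f & forall x y, L x y -> f (rpi (fibre_rel M1 b) x) = rpi (fibre_rel M0 0) y].
  apply: rel_iso.
  - move=> z; have [x Ix Lx] := local_class_total grp0 phi_pol phi_inv phi_b loc10 (I1z z).
    by have [x' x'E] := centre_fun_surj hf Ix; exists x'; rewrite /L x'E.
  - move=> x; have [z Iz Lz] := local_class_surj grp1 grp0 phi_pol phi_inv phi_b
      loc01 loc10 q_pol q_stable q_b q_orb (I0x x).
    by rewrite -I1E in Iz; have [z' z'E] := centre_fun_surj hf Iz; exists z'; rewrite /L z'E.
  - by apply: (Lcs 1); rewrite !rmorph1.
  - move=> z x z' x' Lzx Lzx'; rewrite /L !centre_funB.
    by apply: local_classB => //; exact: I0x.
  - move=> z x z' x' Lzx Lzx'; rewrite /L !centre_funM.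
    by apply: local_classM => //; exact: I0x.
  - move=> z x Lzx; rewrite (ideal_gen_centre hf b1) (ideal_gen_centre hf b0) I1E m1E.
    split; first exact: (local_class_ideal grp0 phi_pol phi_inv phi_b loc10 (I0x x) Lzx).
    exact: (local_class_ideal_inv grp1 grp0 phi_pol phi_inv phi_b
      loc01 q_pol q_stable q_b q_orb (I0x x) (I1z z) Lzx).
by exists f, g; split=> // a z1 z0 E1 E0; apply: fL; exact: Lcs E1 E0.
Qed.

(** * The presentation of the rational Cherednik algebra *)

Section FreeAlgebra.
Variables (K : choiceType) (C : comNzRingType) (S : pzRingType).
Variables (f : {rmorphism C -> S}) (g : K -> S).
Hypothesis fC : forall a u, f a * u = u * f a.
Local Notation A := {malg C[{fmonom K}]}.

Definition free_mon (m : fmonom K) : S := \prod_(i <- fmonom_val m) g i.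

Definition free_eval (x : A) : S :=
  \sum_(m <- monalg.msupp x) f (monalg.mcoeff m x) * free_mon m.

Lemma free_evalEw (r : seq (fmonom K)) x : uniq r -> {subset monalg.msupp x <= r} ->
  free_eval x = \sum_(m <- r) f (monalg.mcoeff m x) * free_mon m.
Proof.
move=> ur xr; rewrite (bigID (fun m => m \in monalg.msupp x)) /=.
rewrite [X in _ + X]big1 => [|m mx]; last first.
  by rewrite monalg.mcoeff_outdom // rmorph0 mul0r.
rewrite addr0 -big_filter; apply: perm_big; apply: uniq_perm.
- exact: fset_uniq.
- exact: filter_uniq.
- by move=> m; rewrite mem_filter; case: (boolP (m \in monalg.msupp x)) => //= /xr ->.
Qed.

Lemma free_eval_zmod_morphism : zmod_morphism free_eval.
Proof.
move=> x y.
pose r := undup (enum_fset (monalg.msupp x) ++ enum_fset (monalg.msupp y)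
                 ++ enum_fset (monalg.msupp (x - y))).
have ur : uniq r by exact: undup_uniq.
have rx : {subset monalg.msupp x <= r} by move=> m; rewrite mem_undup !mem_cat => ->.
have ry : {subset monalg.msupp y <= r}.
  by move=> m; rewrite mem_undup !mem_cat => ->; rewrite orbT.
have rxy : {subset monalg.msupp (x - y) <= r}.
  by move=> m; rewrite mem_undup !mem_cat => ->; rewrite !orbT.
rewrite !(@free_evalEw r) // -sumrB.
by apply: eq_bigr => m _; rewrite monalg.mcoeffB rmorphB mulrBl.
Qed.

HB.instance Definition _ := GRing.isZmodMorphism.Build A S free_eval free_eval_zmod_morphism.

Lemma free_evalU c m : free_eval << c *g m >> = f c * free_mon m.
Proof.
rewrite (@free_evalEw [:: m]) // ?big_seq1 ?monalg.mcoeffUU // => m'.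
rewrite monalg.msuppU; case: ifP => _; first by rewrite in_fset0.
by rewrite in_fset1 inE.
Qed.

Lemma free_monM (m m' : fmonom K) : free_mon (mmul m m') = free_mon m * free_mon m'.
Proof. by rewrite /free_mon fmM big_cat. Qed.

Lemma free_eval_monoid_morphism : monoid_morphism free_eval.
Proof.
split=> [|x y].
  rewrite (_ : 1 = << 1 *g mone >>) // free_evalU rmorph1 mul1r /free_mon fm1.
  by rewrite big_nil.
rewrite malgME !raddf_sum [x in free_eval x * _]monalgE.
rewrite raddf_sum mulr_suml; apply: eq_bigr => m _.
rewrite [in RHS](monalgE y) !raddf_sum mulr_sumr; apply: eq_bigr => m' _ /=.
rewrite !free_evalU free_monM rmorphM -!mulrA; congr (_ * _).
by rewrite !mulrA fC.
Qed.

HB.instance Definition _ := GRing.isMonoidMorphism.Build A S free_eval free_eval_monoid_morphism.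

Lemma free_algebra_univ : exists F : {rmorphism A -> S},
  (forall a, F (malgC a) = f a) /\ (forall i, F << fmu i >> = g i).
Proof.
exists (free_eval : {rmorphism _ -> _}); split=> [a|i].
  by rewrite /= free_evalU /free_mon fm1 big_nil mulr1.
by rewrite /= free_evalU rmorph1 mul1r /free_mon fmU big_seq1.
Qed.

End FreeAlgebra.

Lemma rquot_univ (A S : pzRingType) (r : set A) (F : {rmorphism A -> S}) :
  (forall x, r x -> F x = 0) ->
  exists F' : {rmorphism rquot r -> S}, forall x, F' (rpi r x) = F x.
Proof.
move=> Fr; pose F' (u : rquot r) := F (sval (cid (rpi_surj u))).
have Fi x : ideal_gen r x -> F x = 0.
  move=> /(_ [set x | F x = 0]); apply; split=> //; split=> /= [|x' y|a x' b].
  - exact: rmorph0.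
  - by rewrite rmorphB => -> ->; rewrite subrr.
  - by rewrite !rmorphM => ->; rewrite mulr0 mul0r.
have F'E x : F' (rpi r x) = F x.
  rewrite /F'; case: cid => y /= /rpiE /Fi; rewrite rmorphB => /eqP.
  by rewrite subr_eq0 => /eqP.
have FB : zmod_morphism F'.
  move=> u v; have [x ->] := rpi_surj u; have [y ->] := rpi_surj v.
  by rewrite -rmorphB !F'E rmorphB.
have FM : monoid_morphism F'.
  split=> [|u v]; first by rewrite -(rmorph1 (rpi r)) F'E rmorph1.
  have [x ->] := rpi_surj u; have [y ->] := rpi_surj v.
  by rewrite -rmorphM !F'E rmorphM.
pose mF := GRing.isMonoidMorphism.Build _ _ F' FM.
pose aF := GRing.isZmodMorphism.Build _ _ F' FB.
pose FF : {rmorphism rquot r -> S} := HB.pack F' aF mF.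
by exists FF.
Qed.

Section Interface.
Variables (R : realType) (gT : finGroupType) (W : {group gT}) (n : nat).
Variable h : mx_representation R[i] W n.
Variable d : cherednik_datum h.
Local Notation h0 := (crep d).
Local Notation H := (rca h0 (cpar d) (croot d) (ccoroot d)).
Local Notation pi := (rca_pi h0 (cpar d) (croot d) (ccoroot d)).
Local Notation sc := (rca_scalar h0 (cpar d) (croot d) (ccoroot d)).
Local Notation y_ := (@rca_y R gT (cgrp d) n).
Local Notation x_ := (@rca_x R gT (cgrp d) n).
Local Notation w_ := (@rca_w R gT (cgrp d) n).

Lemma rca_rel_eq u v : (rca_smash h0 `|` rca_commutation h0 (cpar d) (croot d) (ccoroot d)) (u - v) ->
  pi u = pi v.
Proof. by move=> r; apply/rpiE => I [_ rI]; exact: rI. Qed.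

Lemma rca_scale a u : pi (a *: u) = sc a * pi u.
Proof. by rewrite -mul_malgC rmorphM. Qed.

Lemma rca_xD a x x' : pi (x_ (a *: x + x')) = sc a * pi (x_ x) + pi (x_ x').
Proof.
have E : pi (x_ (a *: x + x')) = pi (a *: x_ x + x_ x').
  by apply: rca_rel_eq; left; exact: smash_x_linear.
by apply: (etrans E); rewrite rmorphD rca_scale.
Qed.

Lemma rca_yD a y y' : pi (y_ (a *: y + y')) = sc a * pi (y_ y) + pi (y_ y').
Proof.
have E : pi (y_ (a *: y + y')) = pi (a *: y_ y + y_ y').
  by apply: rca_rel_eq; left; exact: smash_y_linear.
by apply: (etrans E); rewrite rmorphD rca_scale.
Qed.

Lemma rca_w1 : pi (w_ 1%g) = 1.
Proof. by apply: etrans (rmorph1 pi); apply: rca_rel_eq; left; exact: smash_w1. Qed.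

Lemma rca_wM w w' : pi (w_ (w * w')%g) = pi (w_ w) * pi (w_ w').
Proof. by apply: etrans (rmorphM pi _ _); apply: rca_rel_eq; left; exact: smash_wM. Qed.

Lemma rca_eqMM u v u' v' :
  (rca_smash h0 `|` rca_commutation h0 (cpar d) (croot d) (ccoroot d)) (u * v - u' * v') ->
  pi u * pi v = pi u' * pi v'.
Proof. by move=> /rca_rel_eq E; rewrite -!rmorphM. Qed.

Lemma rca_wx w x : pi (w_ w) * pi (x_ x) = pi (x_ (x *m h0 (sgval w)^-1%g)) * pi (w_ w).
Proof. by apply: rca_eqMM; left; exact: smash_wx. Qed.

Lemma rca_wy w y : pi (w_ w) * pi (y_ y) = pi (y_ (h0 (sgval w) *m y)) * pi (w_ w).
Proof. by apply: rca_eqMM; left; exact: smash_wy. Qed.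

Lemma rca_xx x x' : pi (x_ x) * pi (x_ x') = pi (x_ x') * pi (x_ x).
Proof. by apply: rca_eqMM; right; exact: comm_xx. Qed.

Lemma rca_yy y y' : pi (y_ y) * pi (y_ y') = pi (y_ y') * pi (y_ y).
Proof. by apply: rca_eqMM; right; exact: comm_yy. Qed.

Lemma rca_xy x y : pi (x_ x) * pi (y_ y) - pi (y_ y) * pi (x_ x) =
  - \sum_(s in refl_set h0) sc (cpar d s * dot y (croot d s) * dot (ccoroot d s) x)
      * pi (w_ (subg (cgrp d) s)).
Proof.
have E : pi (x_ x * y_ y - y_ y * x_ x) = pi (- \sum_(s in refl_set h0)
   (cpar d s * dot y (croot d s) * dot (ccoroot d s) x) *: w_ (subg (cgrp d) s)).
  by apply: rca_rel_eq; right; exact: comm_xy.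
have -> : pi (x_ x) * pi (y_ y) - pi (y_ y) * pi (x_ x) = pi (x_ x * y_ y - y_ y * x_ x).
  by rewrite -(rmorphM pi (x_ x) (y_ y)) -(rmorphM pi (y_ y) (x_ x)) -(rmorphB pi).
apply: (etrans E).
rewrite rmorphN rmorph_sum; congr (- _); apply: eq_bigr => s _; exact: rca_scale.
Qed.

Lemma rca_sC a (u : H) : sc a * u = u * sc a.
Proof. by have /asboolP := rca_scalar_central h0 (cpar d) (croot d) (ccoroot d) a; apply. Qed.

Definition rca_gx (x : 'rV[R[i]]_n) : H := pi (x_ x).
Definition rca_gy (y : 'cV[R[i]]_n) : H := pi (y_ y).
Definition rca_gw (w : [subg cgrp d]) : H := pi (w_ w).

Lemma rca_relations : @cherednik_relations _ _ _ _ _ d _ sc rca_gx rca_gy rca_gw.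
Proof.
split.
- exact: rca_sC.
- exact: rca_xD.
- exact: rca_yD.
- exact: rca_w1.
- exact: rca_wM.
- exact: rca_wx.
- exact: rca_wy.
- exact: rca_xx.
- exact: rca_yy.
- exact: rca_xy.
Qed.

(** Monomials of the free algebra are lists of generators, from which letters are removed on the
    left. *)
Lemma rca_ind (P : H -> Prop) : P 1 ->
  (forall u v, P u -> P v -> P (u + v)) ->
  (forall a u, P u -> P (sc a * u)) -> (forall x u, P u -> P (rca_gx x * u)) ->
  (forall y u, P u -> P (rca_gy y * u)) -> (forall w u, P u -> P (rca_gw w * u)) ->
  forall u, P u.
Proof.
move=> P1 PD Ps Px Py Pw u; have [f ->] := rpi_surj u; change (P (pi f)).
have P0 : P 0 by rewrite -(mul0r 1) -(rmorph0 sc); exact: Ps.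
have Pmon (l : seq (rca_gens R (cgrp d) n)) : P (pi << FMonom l >>).
  elim: l => [|i l IH].
    have -> : << FMonom [::] >> = 1 :> rca_free R (cgrp d) n by rewrite -fmoneE.
    by rewrite rmorph1.
  have -> : << FMonom (i :: l) >> = << fmu i >> * << FMonom l >> :> rca_free R (cgrp d) n.
    rewrite malgM_def fgmulUU mulr1; congr << _ *g _ >>.
    apply/val_inj/esym; exact: (etrans (fmM (fmu i) (FMonom l)) (congr1 (cat^~ l) (fmU i))).
  by rewrite rmorphM; case: i => [[y|x]|w]; [exact: Py | exact: Px | exact: Pw].
rewrite (monalgE f) rmorph_sum; elim/big_ind: _ => // m _.
have -> : << monalg.mcoeff m f *g m >> = malgC (monalg.mcoeff m f) * << m >> :> rca_free R (cgrp d) n.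
  by rewrite malgM_def fgmulUU mulr1 mul1m.
rewrite rmorphM; apply: Ps; case: m => l; exact: Pmon.
Qed.

Lemma rca_univ (E : pzRingType) (es : {rmorphism R[i] -> E}) ex ey ew :
  @cherednik_relations _ _ _ _ _ d _ es ex ey ew ->
  exists F : {rmorphism H -> E}, [/\ forall a, F (sc a) = es a, forall x, F (rca_gx x) = ex x,
    forall y, F (rca_gy y) = ey y & forall w, F (rca_gw w) = ew w].
Proof.
move=> rel.
have [F [Fs Fg]] := free_algebra_univ (fun i : rca_gens R (cgrp d) n =>
  match i with inl (inl y) => ey y | inl (inr x) => ex x | inr w => ew w end) (rel_sC rel).
have FZ a u : F (a *: u) = es a * F u by rewrite -mul_malgC rmorphM Fs.
have Fx x : F (x_ x) = ex x by exact: Fg.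
have Fy y : F (y_ y) = ey y by exact: Fg.
have Fw w : F (w_ w) = ew w by exact: Fg.
have FM u v : F (u * v) = F u * F v by exact: rmorphM.
have FB u v : F u = F v -> F (u - v) = 0.
  by move=> Fuv; apply: etrans (rmorphB F u v) _; rewrite Fuv subrr.
have FD u v : F (u + v) = F u + F v by exact: rmorphD.
have FN u : F (- u) = - F u by exact: rmorphN.
have Fsum (r : seq gT) (P : pred gT) (e : gT -> rca_free R (cgrp d) n) :
    F (\sum_(s <- r | P s) e s) = \sum_(s <- r | P s) F (e s) by exact: rmorph_sum.
have Fr u : (rca_smash h0 `|` rca_commutation h0 (cpar d) (croot d) (ccoroot d)) u -> F u = 0.
  have FMM t v t' v' : F t * F v = F t' * F v' -> F (t * v - t' * v') = 0.
    by move=> Ftv; apply: FB; exact: (etrans (FM t v) (etrans Ftv (esym (FM t' v')))).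
  move=> [[a y y'|a x x'||w w'|w y|w x]|[x x'|y y'|x y]].
  - by apply: FB; rewrite (FD (a *: _)) FZ Fy Fy Fy; exact: rel_yD rel a y y'.
  - by apply: FB; rewrite (FD (a *: _)) FZ Fx Fx Fx; exact: rel_xD rel a x x'.
  - by apply: FB; rewrite Fw (rmorph1 F); exact: rel_w1 rel.
  - by apply: FB; rewrite (FM (w_ w)) Fw Fw Fw; exact: rel_wM rel w w'.
  - by apply: FMM; rewrite (Fw w) (Fy y) (Fy (_ *m _)); exact: rel_wy rel w y.
  - by apply: FMM; rewrite (Fw w) (Fx x) (Fx (_ *m _)); exact: rel_wx rel w x.
  - by apply: FMM; rewrite (Fx x) (Fx x'); exact: rel_xx rel x x'.
  - by apply: FMM; rewrite (Fy y) (Fy y'); exact: rel_yy rel y y'.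
  - apply: FB; rewrite (FD (x_ x * y_ y)) (FM (x_ x)) (FN (y_ y * x_ x)) (FM (y_ y)).
    rewrite (Fx x) (Fy y); apply: etrans (rel_xy rel x y) _.
    rewrite FN; congr (- _); apply: etrans (esym (Fsum _ _ _)).
    by apply: eq_bigr => s _; rewrite FZ Fw.
have [F' F'E] := rquot_univ Fr; exists F'; split=> [a|x|y|w].
- exact: (etrans (F'E _) (Fs a)).
- exact: (etrans (F'E _) (Fx x)).
- exact: (etrans (F'E _) (Fy y)).
- exact: (etrans (F'E _) (Fw w)).
Qed.

Lemma rca_model_exists : exists F : {rmorphism H -> crossed {poly R[i]} (point_action h)},
  [/\ forall a, F (sc a) = @dunkl_scalar _ _ _ _ h a, forall x, F (rca_gx x) = dunkl_x d x,
    forall y, F (rca_gy y) = dunkl_y d y & forall w, F (rca_gw w) = dunkl_w w].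
Proof.
have sB : zmod_morphism (@dunkl_scalar _ _ _ _ h).
  move=> a a'; rewrite /dunkl_scalar -rmorphB; congr xfun; apply/funext => p.
  by rewrite polyCB.
have sM : monoid_morphism (@dunkl_scalar _ _ _ _ h).
  by split=> [|a a']; [exact: rmorph1 | exact: dunkl_scalarM].
pose ms := GRing.isMonoidMorphism.Build _ _ _ sM.
pose zs := GRing.isZmodMorphism.Build _ _ _ sB.
pose es : {rmorphism R[i] -> crossed {poly R[i]} (point_action h)} :=
  HB.pack (@dunkl_scalar _ _ _ _ h) ms zs.
exact: (@rca_univ _ es _ _ _ (dunkl_relations d)).
Qed.

Definition rca_dunkl : {rmorphism H -> crossed {poly R[i]} (point_action h)} :=
  sval (cid rca_model_exists).

Lemma rca_dunkl_s a : rca_dunkl (sc a) = @dunkl_scalar _ _ _ _ h a.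
Proof. by have [] := svalP (cid rca_model_exists). Qed.
Lemma rca_dunkl_x x : rca_dunkl (rca_gx x) = dunkl_x d x.
Proof. by have [] := svalP (cid rca_model_exists). Qed.
Lemma rca_dunkl_y y : rca_dunkl (rca_gy y) = dunkl_y d y.
Proof. by have [] := svalP (cid rca_model_exists). Qed.
Lemma rca_dunkl_w w : rca_dunkl (rca_gw w) = dunkl_w w.
Proof. by have [] := svalP (cid rca_model_exists). Qed.

Definition rca_model : cherednik_model d :=
  @CherednikModel _ _ _ _ _ d H sc _ _ _ rca_relations rca_ind rca_dunkl
    rca_dunkl_s rca_dunkl_x rca_dunkl_y rca_dunkl_w.

Lemma cpoly_rca p : cpoly rca_model p = rca_poly h0 (cpar d) (croot d) (ccoroot d) p.
Proof.
rewrite /cpoly /eval_mon /rca_poly /mmap.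
apply/esym; apply: etrans (rmorph_sum pi _ _ _) _; apply: eq_bigr => m _.
apply: etrans (rmorphM pi _ _) _; congr (_ * _).
apply: etrans (rmorph_prod pi _ _ _) _; apply: eq_bigr => i _.
exact: (rmorphXn pi).
Qed.

Lemma fibre_relE b :
  @fibre_relations _ _ _ _ h0 (cpar d) (croot d) (ccoroot d) b = fibre_rel rca_model b.
Proof.
apply/funext => z; apply/propext; split=> -[p [pi0 pb] zE]; exists p.
- by split=> [w v|]; [exact: pi0 | exact: pb].
- by apply: etrans zE _; rewrite cpoly_rca.
- by split=> [w v|]; [exact: pi0 | exact: pb].
- by apply: etrans zE _; rewrite cpoly_rca.
Qed.

End Interface.

(** * The data attached to W and to the stabilizer of b *)

Section StabilizerDatum.
Variables (R : realType) (gT : finGroupType) (W : {group gT}) (n : nat).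
Variables (h : mx_representation R[i] W n).
Variables (alpha : gT -> 'rV[R[i]]_n) (alphav : gT -> 'cV[R[i]]_n).
Hypothesis halpha : roots_of_reflections h alpha alphav.
Variables (c : gT -> R[i]) (b : 'cV[R[i]]_n).
Hypothesis hc : forall s w, s \in reflections h -> w \in W -> c (s ^ w)%g = c s.
Local Notation Wb := (stabilizer_group h b).
Local Notation hb := (subg_repr h (stabilizer_sub h b) : mx_representation R[i] Wb n).

Lemma full_cshift_fix w : w \in W -> h w *m (0 : 'cV_n) = 0.
Proof. by move=> _; exact: mulmx0. Qed.

Definition full_datum : cherednik_datum h :=
  @CherednikDatum _ _ _ _ h W h alpha alphav c 0 (fintype.subxx _) (fun w _ => erefl) halpha hc
    full_cshift_fix.

Lemma stab_reflections s : s \in reflections hb -> s \in reflections h.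
Proof.
by rewrite inE => /andP[sb r1]; rewrite inE r1 andbT; exact: (fintype.subsetP (stabilizer_sub h b)).
Qed.

Lemma stab_roots : roots_of_reflections hb alpha alphav.
Proof. by move=> s /stab_reflections; exact: halpha. Qed.

Lemma stab_par s w : s \in reflections hb -> w \in Wb -> c (s ^ w)%g = c s.
Proof.
move=> /stab_reflections rs wb; apply: hc => //.
exact: (fintype.subsetP (stabilizer_sub h b)).
Qed.

Lemma stab_cshift_fix w : w \in Wb -> hb w *m b = b.
Proof. by rewrite inE => /andP[_ /eqP]. Qed.

Definition stab_datum : cherednik_datum h :=
  @CherednikDatum _ _ _ _ h Wb hb alpha alphav c b (stabilizer_sub h b) (fun w _ => erefl)
    stab_roots stab_par stab_cshift_fix.

Lemma mem_stab w : (w \in Wb) = (w \in W) && (h w *m b == b).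
Proof. by rewrite inE. Qed.

End StabilizerDatum.

Theorem corollary3p3 (R : realType) (gT : finGroupType) (W : {group gT}) (n : nat)
    (h : mx_representation R[i] W n) (hW : complex_reflection_group h)
    (alpha : gT -> 'rV[R[i]]_n) (alphav : gT -> 'cV[R[i]]_n)
    (halpha : roots_of_reflections h alpha alphav)
    (c : gT -> R[i])
    (hc : forall s w, s \in reflections h -> w \in W -> c (s ^ w)%g = c s)
    (b : 'cV[R[i]]_n) :
  let Wb := stabilizer_group h b in
  let hb := subg_repr h (stabilizer_sub h b) : mx_representation R[i] Wb n in
  inhabited (affine_scheme_iso (fibre_scalar h c alpha alphav b)
                               (fibre_scalar hb c alpha alphav 0)).
Proof.
move=> Wb hb.
have hf w : w \in W -> h w = 1%:M -> w = 1%g.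
  case: hW => + _ Ww hw => /fintype.subsetP/(_ w); rewrite !inE Ww mul1mx hw eqxx.
  by move=> /(_ isT)/eqP.
pose d1 := full_datum halpha hc; pose d0 := stab_datum halpha b hc.
have [f [g [fK gK fs]]] := @fibre_models_iso _ _ _ _ h d1 d0 b (rca_model d1) (rca_model d0)
  hf erefl (mem_stab h b) erefl erefl erefl erefl.
(* The fibre rings are quotients by [fibre_relations], equal but not convertible to [fibre_rel], so
   the rewriting takes place in the types of [f] and [g]. *)
move: f g fK gK fs; rewrite -!fibre_relE => f g fK gK fs.
pose f' : {rmorphism fibre_ring h c alpha alphav b -> fibre_ring hb c alpha alphav 0} := f.
pose g' : {rmorphism fibre_ring hb c alpha alphav 0 -> fibre_ring h c alpha alphav b} := g.
have f'K : cancel f' g' := fK.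
have g'K : cancel g' f' := gK.
have f's a : f' (fibre_scalar h c alpha alphav b a) = fibre_scalar hb c alpha alphav 0 a.
  exact: (fs a (rca_center_scalar h c alpha alphav a) (rca_center_scalar hb c alpha alphav a)).
exact: (inhabits (ring_iso_affine_scheme_iso f'K g'K f's)).
Qed.
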